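(* Let $N\ge2$, let $\Sigma\subset\mathbb{C}^N$ be compact, and let $k$ be an integer with $2\le k\le N$. If $K\subset\widehat{\Sigma}^{\,k}$ is a compact rationally convex set, then there is a compact subset $X$ of $\Sigma$ such that $h_r^{k-1}(X)\supset K$ and the set $h_r(X)\setminus K$ contains no analytic discs.
   Context: Let $X\subset\mathbb{C}^N$ be compact. An analytic subvariety of $\mathbb{C}^N$ of pure codimension $m$ means a pure-dimensional analytic subvariety of $\mathbb{C}^N$ of dimension $N-m$. The polynomial hull is $\widehat{X}=\{z: |p(z)|\le\max_X|p| \text{ for all polynomials } p\}$. For $1\le k\le N$, the $k$-rational hull $h_r^k(X)$ is the set of $z\in\mathbb{C}^N$ such that every analytic subvariety of $\mathbb{C}^N$ of pure codimension $\le k$ that passes through $z$ intersects $X$; $h_r(X)=h_r^1(X)$ is the usual rational hull $\{z: p(z)\in p(X) \text{ for all polynomials } p\}$, and $X$ is rationally convex if $h_r(X)=X$. For $2\le k\le N$ the $k$-polynomial hull $\widehat{X}^{\,k}$ is the set of $z\in\mathbb{C}^N$ such that $z\in h_r^{k-1}(X)$ and $z\in\widehat{X\cap V}$ for every analytic subvariety $V$ of $\mathbb{C}^N$ of pure codimension $\le k-1$ passing through $z$. An analytic disc is an injective holomorphic map $\sigma:D\to\mathbb{C}^N$ ($D$ the open unit disc); a set contains no analytic discs if no analytic disc has image in it. *)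

(* Defs.v *)
From HB Require Import structures.
From mathcomp Require Import all_boot all_order all_algebra.
From mathcomp Require Import all_classical all_reals all_analysis.
From mathcomp Require Import complex.
Import Order.TTheory GRing.Theory Num.Theory numFieldNormedType.Exports.

Set Implicit Arguments.
Unset Strict Implicit.
Unset Printing Implicit Defensive.

Local Open Scope ring_scope.
Local Open Scope classical_set_scope.

Section Defs.
Variable R : realType.
Local Notation C := (R[i]).

Definition CN (N : nat) : normedModType C := 'rV[C]_N.

Variable N : nat.

Inductive poly_fun : (CN N -> C) -> Prop :=
| poly_cst (c : C) : poly_fun (fun _ => c)
| poly_coord (i : 'I_N) : poly_fun (fun z : CN N => (z : 'rV[C]_N) 0 i)
| poly_add p q : poly_fun p -> poly_fun q -> poly_fun (fun z => p z + q z)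
| poly_mul p q : poly_fun p -> poly_fun q -> poly_fun (fun z => p z * q z).

Definition holo_on (m : nat) (U : set (CN N)) (f : CN N -> CN m) : Prop :=
  forall w, U w -> differentiable f w.

Definition analytic_set (V : set (CN N)) : Prop :=
  forall p : CN N, exists (U : set (CN N)) (m : nat) (f : CN N -> CN m),
    [/\ open U, U p, holo_on U f & V `&` U = U `&` f @^-1` [set 0]].

(* z is a regular point of V of dimension d: near z, V is a complex
   submanifold of dimension d (cut out by N - d holomorphic functions with
   surjective differential) *)
Definition regular_dim (V : set (CN N)) (z : CN N) (d : nat) : Prop :=
  [/\ (d <= N)%N, V z &
    exists (U : set (CN N)) (g : CN N -> CN (N - d)),
      [/\ open U, U z, holo_on U g, V `&` U = U `&` g @^-1` [set 0] &
        forall w, V w -> U w -> forall v : CN (N - d), exists u, 'd g w u = v]].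

(* dim_z V = limsup_{w -> z, w regular} dim_w V = d for every z in V *)
Definition pure_dim (V : set (CN N)) (d : nat) : Prop :=
  forall z, V z ->
    (forall U : set (CN N), open U -> U z -> exists w, U w /\ regular_dim V w d)
    /\ (exists U : set (CN N), [/\ open U, U z &
          forall w e, U w -> regular_dim V w e -> (e <= d)%N]).

Definition subvariety_codim (V : set (CN N)) (m : nat) : Prop :=
  [/\ (m <= N)%N, analytic_set V & pure_dim V (N - m)].

Definition rat_hull_k (k : nat) (X : set (CN N)) : set (CN N) :=
  [set z | forall (V : set (CN N)) (m : nat),
     (m <= k)%N -> subvariety_codim V m -> V z -> V `&` X !=set0].

Definition rat_hull (X : set (CN N)) : set (CN N) := rat_hull_k 1 X.

Definition rationally_convex (X : set (CN N)) : Prop := rat_hull X = X.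

Definition poly_hull (X : set (CN N)) : set (CN N) :=
  [set z | forall p, poly_fun p -> forall M : R,
     (forall x, X x -> `|p x| <= (M%:C)%C) -> `|p z| <= (M%:C)%C].

(* k-polynomial hull, 2 <= k <= N *)
Definition k_poly_hull (k : nat) (X : set (CN N)) : set (CN N) :=
  [set z | rat_hull_k k.-1 X z /\
     forall (V : set (CN N)) (m : nat),
       (m <= k.-1)%N -> subvariety_codim V m -> V z -> poly_hull (X `&` V) z].

Definition analytic_disc (sigma : C^o -> CN N) : Prop :=
  (forall w : C^o, `|w| < 1 -> differentiable sigma w) /\
  (forall w1 w2 : C^o, `|w1| < 1 -> `|w2| < 1 -> sigma w1 = sigma w2 -> w1 = w2).

Definition no_analytic_disc (A : set (CN N)) : Prop :=
  ~ exists sigma, analytic_disc sigma /\ forall w : C^o, `|w| < 1 -> A (sigma w).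

End Defs.

(* Main.v *)
(* Enumerate the polynomials p_j with coefficients in Q(i) that have no zero on K. Choosing e_j > 0
   one after the other, one finds polynomials P_n with |P_n| >= 1 on K and |P_n| <= 1/2 on
   the part of Sigma where some |p_j| <= e_j, j < n (raise the previous P_n to a high power and
   multiply by p_n). Let X be the part of Sigma where |p_j| >= e_j for all j. If a subvariety A of
   codimension < k through a point z of K missed X, then by compactness |P_n| <= 1/2 on the
   intersection of Sigma and A for some n, so z would not be in its polynomial hull.

   Every zero set {p_j = 0} is a subvariety of codimension 1 that misses X, so h_r(X) misses it. A disc
   sigma outside K has a point z = sigma(w) with sigma'(w) <> 0; a polynomial vanishing at z but nowhere
   on K can be made transverse to sigma at w, and its approximations p_j then vanish somewhere
   on the disc by Hurwitz, a contradiction.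

   Such a polynomial is obtained from the hypersurface through z that misses K, as given by rational
   convexity: the hypersurface has local generators of its ideal (the product over the intersection points
   with a complex line, extended by Riemann's theorem), these patch to a global generator on every
   box by Cousin's argument (logarithm of the quotient split by a Cauchy integral), and the generator is
   approximated by polynomials on the box. *)
Require Import Defs.
From HB Require Import structures.
From mathcomp Require Import all_boot all_order all_algebra.
From mathcomp Require Import all_classical all_reals all_analysis.
From mathcomp Require Import complex ring lra.
Import Order.TTheory GRing.Theory Num.Theory numFieldNormedType.Exports.
Import ComplexField Normc.

Set Implicit Arguments.
Unset Strict Implicit.
Unset Printing Implicit Defensive.
Local Open Scope ring_scope.
Local Open Scope classical_set_scope.

(** The polynomials without zeros on $K$ must be exhausted by a sequence, because each $e_n$ is
    chosen after $P_n$ and every $P_n$ has to remember all earlier conditions. Countability has a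
    price: the polynomial that vanishes at a given point of a disc need not belong to the sequence,
    and an approximation to it keeps a zero on the disc only if the original zero along the disc is
    isolated. The original could vanish on the whole disc, whence the perturbation to a nonzero
    derivative. The other obstacle is that the hulls are defined by arbitrary analytic subvarieties.
    Zero sets of polynomials must be shown to have pure dimension although a polynomial may have
    repeated factors, and a possibly transcendental hypersurface must be turned into a polynomial,
    which forces the Cousin argument. The values $1$ and $1/2$ only record a gap, which a high power
    of $P_n$ restores after the multiplication by $p_n$. *)

Local Notation re := (@complex.Re _).
Local Notation im := (@complex.Im _).

(** * Modulus, neighbourhoods, continuity *)

Section Modulus.
Context {R : realType}.
Local Notation C := R[i].

Definition nc (z : C) : R := normc z.

Lemma ncE (z : C) : (nc z)%:C%C = `|z|.
Proof. by rewrite normc_def /nc; case: z. Qed.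
Lemma nc_ge0 z : 0 <= nc z.
Proof. by case: z => a b; rewrite /nc /= sqrtr_ge0. Qed.
Lemma nc0 : nc 0 = 0. Proof. exact: normc0. Qed.
Lemma nc1 : nc 1 = 1. Proof. exact: normc1. Qed.
Lemma nc_eq0 z : (nc z == 0) = (z == 0).
Proof. by apply/eqP/eqP => [/eq0_normc//|->]; rewrite nc0. Qed.
Lemma nc_gt0 z : (0 < nc z) = (z != 0).
Proof. by rewrite lt0r nc_eq0 nc_ge0 andbT. Qed.
Lemma ncM z w : nc (z * w) = nc z * nc w. Proof. exact: normcM. Qed.
Lemma ncV z : nc z^-1 = (nc z)^-1. Proof. exact: normcV. Qed.
Lemma ncX z n : nc (z ^+ n) = nc z ^+ n.
Proof. by elim: n => [|n IH]; rewrite ?expr0 ?nc1// !exprS ncM IH. Qed.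
Lemma nc_prod (I : Type) (s : seq I) (P : pred I) (F : I -> C) :
  nc (\prod_(i <- s | P i) F i) = \prod_(i <- s | P i) nc (F i).
Proof. exact: (big_morph nc ncM nc1). Qed.
Lemma ncN z : nc (- z) = nc z. Proof. exact: normcN. Qed.
Lemma ncD z w : nc (z + w) <= nc z + nc w. Proof. exact: le_normcD. Qed.
Lemma ncB z w : nc (z - w) = nc (w - z). Proof. by rewrite -ncN opprB. Qed.
Lemma nc_tri z x y : nc (y - x) <= nc (z - x) + nc (y - z).
Proof. by rewrite (_ : y - x = z - x + (y - z)) ?ncD//; ring. Qed.
Lemma nc_sub z w : nc z - nc w <= nc (z - w).
Proof. by rewrite lerBlDr -{1}(subrK w z) ncD. Qed.
Lemma nc_sum (I : Type) (s : seq I) (P : pred I) (F : I -> C) :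
  nc (\sum_(i <- s | P i) F i) <= \sum_(i <- s | P i) nc (F i).
Proof.
apply: (big_ind2 (fun x y => nc x <= y)) => [|x1 x2 y1 y2 h1 h2|//].
  by rewrite nc0.
exact: le_trans (ncD _ _) (lerD h1 h2).
Qed.
Lemma nc_real (x : R) : nc x%:C%C = `|x|.
Proof. by rewrite /nc /= expr0n addr0 sqrtr_sqr. Qed.
Lemma nc_i : nc 'i%C = 1.
Proof. by rewrite /nc /= expr0n add0r expr1n sqrtr1. Qed.
Lemma nc_nat (n : nat) : nc n%:R = n%:R :> R.
Proof. by rewrite -(rmorph_nat (real_complex R)) nc_real ger0_norm. Qed.
Lemma Re_le_nc z : `|re z| <= nc z.
Proof.
case: z => a b; rewrite /nc /= -sqrtr_sqr; apply: ler_wsqrtr.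
by rewrite lerDl sqr_ge0.
Qed.
Lemma Im_le_nc z : `|im z| <= nc z.
Proof.
case: z => a b; rewrite /nc /= -sqrtr_sqr; apply: ler_wsqrtr.
by rewrite lerDr sqr_ge0.
Qed.
Lemma cE (z : C) : z = (re z)%:C%C + 'i%C * (im z)%:C%C.
Proof. exact: complexE. Qed.
Lemma nc_le z : nc z <= `|re z| + `|im z|.
Proof. by rewrite {1}(cE z) (le_trans (ncD _ _))// ncM nc_i mul1r !nc_real. Qed.
Lemma le_norm_nc (z : C) (M : R) : (`|z| <= M%:C%C) = (nc z <= M).
Proof. by rewrite -ncE lecR. Qed.
Lemma lt_norm_nc (z : C) (M : R) : (`|z| < M%:C%C) = (nc z < M).
Proof. by rewrite -ncE ltcR. Qed.

End Modulus.
Arguments nc : simpl never.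

Section Metric.
Context {R : realType}.
Local Notation C := R[i].

(* Real-valued distances: the norms of the library on R[i] take values in R[i]. *)
Structure met := Met {
  car :> Type;
  dist : car -> car -> R;
  dist0 : forall x, dist x x = 0;
  dist_tri : forall x y z, dist x z <= dist x y + dist y z }.

(** Read as near: local arguments are phrased as statements about germs at [x], which can be
    intersected, weakened and pulled back along continuous maps. *)
Definition nr (A : met) (x : A) (P : A -> Prop) : Prop :=
  exists2 e : R, 0 < e & forall y, dist x y < e -> P y.

Lemma nr_at (A : met) (x : A) P : nr x P -> P x.
Proof. by case=> e e0 h; apply: h; rewrite dist0. Qed.
Lemma nrW (A : met) (x : A) (P Q : A -> Prop) :
  (forall y, P y -> Q y) -> nr x P -> nr x Q.
Proof. by move=> h [e e0 he]; exists e => // y /he /h. Qed.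
Lemma nr_all (A : met) (x : A) (P : A -> Prop) : (forall y, P y) -> nr x P.
Proof. by move=> h; exists 1. Qed.
Lemma nrI (A : met) (x : A) (P Q : A -> Prop) :
  nr x P -> nr x Q -> nr x (fun y => P y /\ Q y).
Proof.
move=> [e e0 he] [f f0 hf]; exists (Num.min e f); first by rewrite lt_min e0.
by move=> y; rewrite lt_min => /andP[/he ? /hf].
Qed.
Lemma nrW2 (A : met) (x : A) (P Q T : A -> Prop) :
  (forall y, P y -> Q y -> T y) -> nr x P -> nr x Q -> nr x T.
Proof. by move=> h p q; apply: nrW (nrI p q) => y []; exact: h. Qed.
Lemma nrI_seq (A : met) (x : A) (I : eqType) (s : seq I) (P : I -> A -> Prop) :
  (forall i, i \in s -> nr x (P i)) -> nr x (fun y => forall i, i \in s -> P i y).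
Proof.
elim: s => [|i s IH] h; first exact: nr_all.
have hs j : j \in s -> nr x (P j) by move=> js; apply: h; rewrite in_cons js orbT.
apply: nrW2 (h i (mem_head _ _)) (IH hs).
by move=> y h1 h2 j; rewrite in_cons => /orP[/eqP->|/h2].
Qed.
Lemma nrI_fin (A : met) (x : A) (I : finType) (P : I -> A -> Prop) :
  (forall i, nr x (P i)) -> nr x (fun y => forall i, P i y).
Proof.
move=> h; apply: nrW (nrI_seq (s := enum I) (fun i _ => h i)) => y hy i.
by apply: hy; rewrite mem_enum.
Qed.
(** Local properties are open conditions: half the radius serves every point of the ball of half the
    radius. *)
Lemma nr_nr (A : met) (x : A) P : nr x P -> nr x (fun y => nr y P).
Proof.
move=> [e e0 h]; exists (e / 2); first lra.
move=> y hy; exists (e / 2); first lra.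
by move=> z hz; apply: h; have := dist_tri x y z; lra.
Qed.
Lemma nr_dist (A : met) (x : A) e : 0 < e -> nr x (fun y => dist x y < e).
Proof. by exists e. Qed.

Definition cont (A B : met) (f : A -> B) (x : A) : Prop :=
  forall e : R, 0 < e -> nr x (fun y => dist (f x) (f y) < e).

Lemma cont_id (A : met) (x : A) : cont id x.
Proof. by move=> e e0; exists e. Qed.
Lemma cont_cst (A B : met) (c : B) (x : A) : cont (fun _ => c) x.
Proof. by move=> e e0; apply: nr_all => y; rewrite dist0. Qed.
Lemma cont_nr (A B : met) (f : A -> B) (x : A) P :
  cont f x -> nr (f x) P -> nr x (fun y => P (f y)).
Proof. by move=> cf [e e0 h]; apply: nrW (cf e e0) => y /h. Qed.
Lemma cont_comp (A B D : met) (f : A -> B) (g : B -> D) (x : A) :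
  cont f x -> cont g (f x) -> cont (fun y => g (f y)) x.
Proof. by move=> cf cg e e0; apply: cont_nr cf (cg e e0). Qed.
Lemma cont_eq (A B : met) (f g : A -> B) (x : A) :
  nr x (fun y => f y = g y) -> cont f x -> cont g x.
Proof.
move=> h cf e e0; have fg := nr_at h.
by apply: nrW2 h (cf e e0) => y hy; rewrite -fg hy.
Qed.

Lemma metC_tri (x y z : C) : nc (z - x) <= nc (y - x) + nc (z - y).
Proof. exact: nc_tri. Qed.
Lemma metC0 (x : C) : nc (x - x) = 0. Proof. by rewrite subrr nc0. Qed.
Canonical metC := @Met C (fun x y => nc (y - x)) metC0 metC_tri.

Lemma metR0 (x : R) : `|x - x| = 0. Proof. by rewrite subrr normr0. Qed.
Lemma metR_tri (x y z : R) : `|z - x| <= `|y - x| + `|z - y|.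
Proof. by have := ler_normD (z - y) (y - x); rewrite subrKA; lra. Qed.
Canonical metR := @Met R (fun x y => `|y - x|) metR0 metR_tri.

(** Maximum norm, so that balls are polydiscs; the initial value 0 of the maximum also settles
    [n = 0]. *)
Definition nV (n : nat) (x : 'rV[C]_n) : R := \big[Num.max/0]_(i < n) nc (x 0 i).

Lemma nV_ge0 n (x : 'rV[C]_n) : 0 <= nV x.
Proof. by rewrite /nV; apply: bigmax_ge_id. Qed.
Lemma nV_coord n (x : 'rV[C]_n) i : nc (x 0 i) <= nV x.
Proof. exact: (le_bigmax _ (fun i => nc (x 0 i))). Qed.
Lemma nV_le n (x : 'rV[C]_n) e : 0 <= e -> (forall i, nc (x 0 i) <= e) -> nV x <= e.
Proof. by move=> e0 h; apply: bigmax_le. Qed.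
Lemma nV_lt n (x : 'rV[C]_n) e : 0 < e -> (forall i, nc (x 0 i) < e) -> nV x < e.
Proof. by move=> e0 h; apply: bigmax_lt. Qed.
Lemma nV0 n : nV (0 : 'rV[C]_n) = 0.
Proof. by apply/eqP; rewrite eq_le nV_ge0 nV_le// => i; rewrite mxE nc0. Qed.
Lemma nVD n (x y : 'rV[C]_n) : nV (x + y) <= nV x + nV y.
Proof.
apply: nV_le => [|i]; first by rewrite addr_ge0 ?nV_ge0.
by rewrite mxE (le_trans (ncD _ _))// lerD ?nV_coord.
Qed.
Lemma nVZ n (c : C) (x : 'rV[C]_n) : nV (c *: x) <= nc c * nV x.
Proof.
apply: nV_le => [|i]; first by rewrite mulr_ge0 ?nc_ge0 ?nV_ge0.
by rewrite mxE ncM ler_wpM2l ?nc_ge0 ?nV_coord.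
Qed.
Lemma metV0 n (x : 'rV[C]_n) : nV (x - x) = 0. Proof. by rewrite subrr nV0. Qed.
Lemma metV_tri n (x y z : 'rV[C]_n) : nV (z - x) <= nV (y - x) + nV (z - y).
Proof. by have := nVD (z - y) (y - x); rewrite subrKA; lra. Qed.
Canonical metV n := @Met 'rV[C]_n (fun x y => nV (y - x)) (@metV0 n) (@metV_tri n).

Lemma metP0 (A B : met) (x : A * B) :
  Num.max (dist x.1 x.1) (dist x.2 x.2) = 0.
Proof. by rewrite !dist0 maxxx. Qed.
Lemma metP_tri (A B : met) (x y z : A * B) :
  Num.max (dist x.1 z.1) (dist x.2 z.2) <=
  Num.max (dist x.1 y.1) (dist x.2 y.2) + Num.max (dist y.1 z.1) (dist y.2 z.2).
Proof.
rewrite ge_max; apply/andP; split.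
  by apply: le_trans (dist_tri _ y.1 _) _; rewrite lerD // le_max lexx.
by apply: le_trans (dist_tri _ y.2 _) _; rewrite lerD // le_max lexx orbT.
Qed.
Canonical metP (A B : met) :=
  @Met (A * B)%type (fun x y => Num.max (dist x.1 y.1) (dist x.2 y.2))
    (@metP0 A B) (@metP_tri A B).

Lemma cont_fst (A B : met) (x : A * B) : cont fst x.
Proof. by move=> e e0; exists e => // y; rewrite /= gt_max => /andP[]. Qed.
Lemma cont_snd (A B : met) (x : A * B) : cont snd x.
Proof. by move=> e e0; exists e => // y; rewrite /= gt_max => /andP[]. Qed.
Lemma cont_pair (A B D : met) (f : A -> B) (g : A -> D) (x : A) :
  cont f x -> cont g x -> cont (fun y => (f y, g y)) x.
Proof.
move=> cf cg e e0; apply: nrW2 (cf e e0) (cg e e0) => y h1 h2.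
by rewrite /= gt_max h1.
Qed.

Section Alg.
Variables (A : met) (x : A).
Implicit Types f g : A -> C.

Lemma contD f g : cont f x -> cont g x -> cont (fun y => f y + g y) x.
Proof.
move=> cf cg e e0; have e2 : 0 < e / 2 by lra.
apply: nrW2 (cf _ e2) (cg _ e2) => y /= h1 h2.
have := ncD (f y - f x) (g y - g x).
rewrite (_ : _ - _ + _ = f y + g y - (f x + g x)); first lra.
ring.
Qed.
Lemma contN f : cont f x -> cont (fun y => - f y) x.
Proof. by move=> cf e /cf; apply: nrW => y /=; rewrite -opprD ncN. Qed.
Lemma contB f g : cont f x -> cont g x -> cont (fun y => f y - g y) x.
Proof. by move=> cf cg; apply: contD => //; apply: contN. Qed.
Lemma contM f g : cont f x -> cont g x -> cont (fun y => f y * g y) x.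
Proof.
move=> cf cg e e0.
have a0 := nc_ge0 (f x); have b0 := nc_ge0 (g x).
have [d d0 [hd hd2]] : exists2 d, 0 < d & d <= 1 /\ d * (2 * (nc (f x) + nc (g x) + 1)) <= e.
  exists (Num.min 1 (e / (2 * (nc (f x) + nc (g x) + 1)))).
    by rewrite lt_min ltr01 divr_gt0//; lra.
  split; first by rewrite ge_min lexx.
  by rewrite -ler_pdivlMr; [rewrite ge_min lexx orbT | lra].
apply: nrW2 (cf _ d0) (cg _ d0) => y /= h1 h2.
have -> : f y * g y - f x * g x = (f y - f x) * (g y - g x) + f x * (g y - g x)
   + (f y - f x) * g x by ring.
apply: le_lt_trans (ncD _ _) _.
apply: le_lt_trans (lerD (ncD _ _) (lexx _)) _; rewrite !ncM.
have u0 := nc_ge0 (f y - f x); have w0 := nc_ge0 (g y - g x).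
move: (nc (f x)) (nc (g x)) (nc (f y - f x)) (nc (g y - g x)) a0 b0 u0 w0 h1 h2 hd2.
move=> a b u w a0 b0 u0 w0 h1 h2 hd2.
have : u * w <= d * 1 by apply: ler_pM => //; lra.
have : a * w <= a * d by apply: ler_wpM2l => //; lra.
have : u * b <= d * b by apply: ler_wpM2r => //; lra.
nra.
Qed.
Lemma contV f : f x != 0 -> cont f x -> cont (fun y => (f y)^-1) x.
Proof.
move=> fx cf e e0; have n0 : 0 < nc (f x) by rewrite nc_gt0.
pose d := Num.min (nc (f x) / 2) (e * nc (f x) ^+ 2 / 2).
have d0 : 0 < d by rewrite /d lt_min; apply/andP; split; [|have := exprn_gt0 2 n0]; nra.
apply: nrW (cf _ d0) => y /=; rewrite /d lt_min => /andP[h1 h2].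
have hy : nc (f x) / 2 < nc (f y) by have := nc_sub (f x) (f y); rewrite ncB; lra.
have fy : f y != 0 by rewrite -nc_gt0; lra.
have -> : (f y)^-1 - (f x)^-1 = (f x - f y) / (f x * f y) by field; rewrite fx fy.
rewrite ncM ncV ncM ltr_pdivrMr; last by rewrite mulr_gt0//; lra.
rewrite ncB; apply: lt_le_trans h2 _; rewrite expr2.
by have := mulr_gt0 e0 n0; nra.
Qed.
Lemma contX f n : cont f x -> cont (fun y => f y ^+ n) x.
Proof.
move=> cf; elim: n => [|n IH]; first exact: cont_cst.
by apply: cont_eq (contM cf IH); apply: nr_all => y; rewrite exprS.
Qed.
Lemma cont_sum (I : Type) (s : seq I) (F : I -> A -> C) :
  (forall i, cont (F i) x) -> cont (fun y => \sum_(i <- s) F i y) x.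
Proof.
move=> h; elim: s => [|i s IH].
  by apply: cont_eq (cont_cst (0 : C) x); apply: nr_all => y; rewrite big_nil.
by apply: cont_eq (contD (h i) IH); apply: nr_all => y; rewrite big_cons.
Qed.
Lemma cont_neq0 f : cont f x -> f x != 0 -> nr x (fun y => f y != 0).
Proof.
move=> cf fx; have n0 : 0 < nc (f x) by rewrite nc_gt0.
apply: nrW (cf _ n0) => y; rewrite /= => h.
apply/negP => /eqP fy; move: h; rewrite fy sub0r ncN; lra.
Qed.
Lemma cont_bound f : cont f x -> nr x (fun y => nc (f y) <= nc (f x) + 1).
Proof.
move=> cf; apply: nrW (cf _ ltr01) => y /= h.
by have := nc_sub (f y) (f x); lra.
Qed.

Lemma contVD n (f g : A -> 'rV[C]_n) : cont f x -> cont g x -> cont (fun y => f y + g y) x.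
Proof.
move=> cf cg e e0; have e2 : 0 < e / 2 by lra.
apply: nrW2 (cf _ e2) (cg _ e2) => y /= h1 h2.
have := nVD (f y - f x) (g y - g x).
by rewrite addrACA -opprD; lra.
Qed.
Lemma contVZ n (f : A -> C) (g : A -> 'rV[C]_n) :
  cont f x -> cont g x -> cont (fun y => f y *: g y) x.
Proof.
move=> cf cg e e0.
have h i : nr x (fun y => nc ((f y *: g y - f x *: g x) 0 i) < e).
  have cgi : cont (fun y => g y 0 i) x.
    move=> a a0; apply: nrW (cg a a0) => y /=.
    by apply: le_lt_trans; have := nV_coord (g y - g x) i; rewrite !mxE.
  by apply: nrW (contM cf cgi e0) => y /=; rewrite !mxE.
by apply: nrW (nrI_fin h) => y hy; apply: nV_lt.
Qed.
End Alg.

Lemma cont_coord n (x : 'rV[C]_n) i : cont (fun y : 'rV[C]_n => y 0 i) x.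
Proof.
move=> e e0; apply: nrW (nr_dist x e0) => y /=.
by apply: le_lt_trans; have := nV_coord (y - x) i; rewrite !mxE.
Qed.

Lemma cont_row (A : met) (x : A) n (f : A -> 'rV[C]_n) :
  (forall i, cont (fun y => f y 0 i) x) -> cont f x.
Proof.
move=> h e e0; apply: nrW (nrI_fin (fun i => h i e e0)) => y hy.
by apply: nV_lt => // i; rewrite !mxE; apply: hy.
Qed.

End Metric.

(** * Compactness by bisection of boxes *)

Section Bisection.
Context {R : realType}.

(** A failing box has a failing piece after all its sides are halved, and so on; the nested failing
    boxes shrink to a point [pt], where the local premise gives a contradiction. This is the source
    of most compactness arguments below. The local premise is asked only for the dyadic sides
    [L0 j / 2 ^+ n], the only ones that occur. *)
Lemma box_ind (J : finType) (P : (J -> R) -> (J -> R) -> Prop) (lo0 L0 : J -> R) :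
  (forall j, 0 <= L0 j) ->
  (forall lo L, (forall j, 0 <= L j) ->
    (forall e : J -> bool, P (fun j => lo j + (if e j then L j / 2 else 0))
                             (fun j => L j / 2)) -> P lo L) ->
  (forall pt : J -> R, (forall j, lo0 j <= pt j <= lo0 j + L0 j) ->
    exists2 d : R, 0 < d & forall lo n,
      (forall j, [/\ lo0 j <= lo j, lo j <= pt j, pt j <= lo j + L0 j / 2 ^+ n,
         lo j + L0 j / 2 ^+ n <= lo0 j + L0 j & L0 j / 2 ^+ n < d]) ->
      P lo (fun j => L0 j / 2 ^+ n)) ->
  P lo0 L0.
Proof.
move=> L00 hcut hloc; apply: contrapT => nP.
pose L n := fun j : J => L0 j / 2 ^+ n.
have L_ge0 n j : 0 <= L n j by rewrite divr_ge0// exprn_ge0.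
have LS n : (fun j => L n j / 2) = L n.+1.
  by apply/funext => j; rewrite /L exprSr invfM mulrA.
(* If [P lo (L n)] holds there is nothing to choose; returning [lo] makes the choice function
   total. *)
have step (n : nat) (lo : J -> R) : exists lo' : J -> R, ~ P lo (L n) ->
   ~ P lo' (L n.+1) /\ forall j, lo j <= lo' j <= lo j + L n.+1 j.
  have [h|h] := pselect (P lo (L n)); first by exists lo.
  have /existsNP[e he] := contra_not (hcut lo (L n) (L_ge0 n)) h.
  exists (fun j => lo j + (if e j then L n j / 2 else 0)) => _.
  split; first by rewrite -LS.
  move=> j; rewrite -LS; have := L_ge0 n j; case: (e j); lra.
pose nxt n lo := projT1 (cid (step n lo)).
have nxtP n lo : ~ P lo (L n) -> ~ P (nxt n lo) (L n.+1) /\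
   forall j, lo j <= nxt n lo j <= lo j + L n.+1 j by exact: projT2 (cid (step n lo)).
pose s := fix s n := if n is m.+1 then nxt m (s m) else lo0.
have L0E : L 0%N = L0 by apply/funext => j; rewrite /L expr0 divr1.
have sP n : ~ P (s n) (L n).
  by elim: n => [|n IH]; [rewrite L0E|case: (nxtP n _ IH)].
have sS n j : s n j <= s n.+1 j <= s n j + L n.+1 j by case: (nxtP n _ (sP n)).
have LSS n j : L n.+1 j + L n.+1 j = L n j by rewrite -LS; lra.
have hi n m j : s (n + m)%N j + L (n + m)%N j <= s n j + L n j.
  elim: m => [|m IH]; rewrite ?addn0 ?addnS//; apply: le_trans IH.
  have := sS (n + m)%N j; have := LSS (n + m)%N j; lra.
have lo_ n m j : s n j <= s (n + m)%N j.
  elim: m => [|m IH]; rewrite ?addn0 ?addnS//; apply: le_trans IH _.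
  by case/andP: (sS (n + m)%N j).
have cross n m j : s n j <= s m j + L m j.
  have [h|/ltnW h] := leqP n m.
    by have := lo_ n (m - n)%N j; rewrite subnKC//; have := L_ge0 m j; lra.
  by have := hi m (n - m)%N j; rewrite subnKC//; have := L_ge0 n j; lra.
(* Lower corners increase and upper corners decrease, so the supremum of the lower corners lies in
   every box of the sequence. *)
pose pt j := sup [set s n j | n in setT].
have ubd m j : ubound [set s n j | n in setT] (s m j + L m j) by move=> _ [n _ <-].
have ne j : [set s n j | n in setT] !=set0 by exists (s 0%N j); exists 0%N.
have pt1 n j : s n j <= pt j.
  by apply: ub_le_sup; [exists (s 0%N j + L 0%N j)|exists n].
have pt2 n j : pt j <= s n j + L n j by apply: ge_sup.
have [|d d0 hd] := hloc pt.
  by move=> j; have := pt1 0%N j; have := pt2 0%N j; rewrite L0E /= => ? ?; lra.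
(* Since [n < 2 ^ n], it suffices that [n] exceed the sum of all sides divided by [d]. *)
have [n hn] : exists n, forall j, L n j < d.
  pose M := \sum_j L0 j.
  have M0 : 0 <= M by apply: sumr_ge0.
  have hM j : L0 j <= M by rewrite /M (bigD1 j)//= lerDl sumr_ge0.
  have hn := archi_boundP (divr_ge0 M0 (ltW d0)).
  exists (Num.bound (M / d)) => j; rewrite /L ltr_pdivrMr ?exprn_gt0//.
  apply: le_lt_trans (hM j) _; rewrite mulrC -ltr_pdivrMr//.
  by apply: lt_le_trans hn _; rewrite -natrX ler_nat ltnW// ltn_expl.
apply: (sP n); apply: hd => j; split=> //.
- by have := lo_ 0%N n j.
- by have := hi 0%N n j; rewrite L0E.
- exact: hn.
Qed.

(** Interval case, over a one-element index type. With [P] an equivalence or an implication between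
    the endpoints it expresses connectedness: a property is continued along a segment. *)
Lemma bisect1 (P : R -> R -> Prop) (a b : R) : a <= b ->
  (forall x m y, a <= x -> y <= b -> x <= m <= y -> P x m -> P m y -> P x y) ->
  (forall x, a <= x <= b -> exists2 d : R, 0 < d & forall y z,
     a <= y -> z <= b -> y <= x <= z -> z - y < d -> P y z) ->
  P a b.
Proof.
move=> ab hcut hloc.
pose Q (lo L : unit -> R) := a <= lo tt -> lo tt + L tt <= b -> P (lo tt) (lo tt + L tt).
have : Q (fun _ => a) (fun _ => b - a).
  apply: box_ind => [_|lo L L0 h h1 h2|pt hpt]; first by rewrite subr_ge0.
    have Lt := L0 tt.
    apply: (hcut _ (lo tt + L tt / 2)) => //; first by lra.
      by have := h (fun _ => false); rewrite /Q /= addr0; apply; lra.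
    have := h (fun _ => true); rewrite /Q /=.
    rewrite (_ : lo tt + L tt / 2 + L tt / 2 = lo tt + L tt); last by lra.
    by apply; lra.
  have [|d d0 hd] := hloc (pt tt); first by have := hpt tt; lra.
  exists d => // lo n /(_ tt) [h1 h2 h3 h4 h5] h6 h7.
  by apply: hd => //; lra.
by rewrite /Q subrKC; apply.
Qed.

(** Cutting one coordinate at a time means that a property has to be glued across a single face
    only, which is all that Cousin patching can do. *)
Lemma box_cut_ind (J : finType) (P : (J -> R) -> (J -> R) -> Prop) (lo0 L0 : J -> R) :
  (forall j, 0 <= L0 j) ->
  (forall lo L j, (forall j, 0 <= L j) ->
     P lo (fun k => if k == j then L k / 2 else L k) ->
     P (fun k => if k == j then lo k + L k / 2 else lo k)
       (fun k => if k == j then L k / 2 else L k) -> P lo L) ->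
  (forall pt : J -> R, exists2 d : R, 0 < d & forall lo L : J -> R,
      (forall j, [/\ 0 <= L j, lo j <= pt j, pt j <= lo j + L j & L j < d]) ->
      P lo L) ->
  P lo0 L0.
Proof.
move=> L00 hcut hloc; apply: box_ind => // [lo L Lge0 h|pt _]; last first.
  have [d d0 hd] := hloc pt; exists d => // lo n hl; apply: hd => j.
  by case: (hl j) => *; split => //; rewrite divr_ge0// exprn_ge0.
pose hL (s : seq J) (L : J -> R) j := if j \in s then L j / 2 else L j.
(* Only the coordinates listed in [s] are halved; the enumeration of all of [J] then gives the
   simultaneous halving of [box_ind]. *)
suff generates (s : seq J) : uniq s -> forall lo L, (forall j, 0 <= L j) ->
    (forall e : J -> bool, P (fun j => lo j + (if (j \in s) && e j then L j / 2 else 0))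
       (hL s L)) -> P lo L.
  apply: (generates (enum J) (enum_uniq J)) => // e; have := h e.
  rewrite (_ : hL _ _ = (fun j => L j / 2)); last first.
    by apply/funext => j; rewrite /hL mem_enum.
  by under [in X in _ -> X]eq_fun do rewrite mem_enum /=.
elim: s => [_ lo1 L1 L10 h1|j s IH /= /andP[js us] lo1 L1 L10 h1].
  by have := h1 (fun _ => true); congr (P _ _); apply/funext => j /=; rewrite addr0.
pose L2 k := if k == j then L1 k / 2 else L1 k.
have L20 k : 0 <= L2 k by rewrite /L2; case: eqP => _ //; rewrite divr_ge0.
have hL2 : hL s L2 = hL (j :: s) L1.
  apply/funext => k; rewrite /hL /L2 in_cons.
  by have [->|] := eqVneq k j; rewrite ?(negbTE js).
apply: (hcut _ _ j L10); apply: (IH us _ L2 L20) => e; rewrite hL2.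
  have := h1 (fun k => (k != j) && e k); congr (P _ _); apply/funext => k /=.
  rewrite in_cons /L2; have [->|kj] := eqVneq k j; rewrite ?(negbTE js)//=.
have := h1 (fun k => (k == j) || e k); congr (P _ _); apply/funext => k /=.
rewrite in_cons /L2; have [->|kj] := eqVneq k j; rewrite ?(negbTE js)//= ?addr0//.
Qed.

End Bisection.

(** * Integrals of continuous complex functions over intervals *)

Section Integral.
Context {R : realType}.
Local Notation C := R[i].

Lemma c_eq (x y : C) : re x = re y -> im x = im y -> x = y.
Proof. by case: x y => ? ? [? ?] /= -> ->. Qed.
Lemma reD (x y : C) : re (x + y) = re x + re y. Proof. by case: x y => ? ? []. Qed.
Lemma imD (x y : C) : im (x + y) = im x + im y. Proof. by case: x y => ? ? []. Qed.
Lemma reN (x : C) : re (- x) = - re x. Proof. by case: x. Qed.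
Lemma imN (x : C) : im (- x) = - im x. Proof. by case: x. Qed.
Lemma reM (x y : C) : re (x * y) = re x * re y - im x * im y.
Proof. by case: x y => ? ? []. Qed.
Lemma imM (x y : C) : im (x * y) = re x * im y + im x * re y.
Proof. by case: x y => ? ? []. Qed.

Definition Jr (f : R -> R) (a b : R) : R :=
  \int[@lebesgue_measure R]_(x in `[a, b]) f x.
Definition J (g : R -> C) (a b : R) : C :=
  Complex (Jr (fun t => re (g t)) a b) (Jr (fun t => im (g t)) a b).
Definition con (g : R -> C) (a b : R) := forall t, a <= t <= b -> cont g t.
Definition rcon (f : R -> R) (a b : R) := forall t, a <= t <= b -> cont f t.

Lemma rcon_re g a b : con g a b -> rcon (fun t => re (g t)) a b.
Proof.
move=> h t /h hg e /hg; apply: nrW => y /=; apply: le_lt_trans.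
by have := Re_le_nc (g y - g t); case: (g y) (g t) => ? ? [].
Qed.
Lemma rcon_im g a b : con g a b -> rcon (fun t => im (g t)) a b.
Proof.
move=> h t /h hg e /hg; apply: nrW => y /=; apply: le_lt_trans.
by have := Im_le_nc (g y - g t); case: (g y) (g t) => ? ? [].
Qed.

Lemma rcon_int (f : R -> R) a b : rcon f a b ->
  (@lebesgue_measure R).-integrable `[a, b] (EFin \o f).
Proof.
move=> h; apply: continuous_compact_integrable; first exact: segment_compact.
apply: continuous_in_subspaceT => t; rewrite inE /= in_itv /= => /h hf.
apply/cvgrPdist_lt => e e0; have [d d0 hd] := hf e e0.
near=> y; rewrite distrC; apply: hd => /=; rewrite distrC.
near: y; exact: (@nbhsx_ballx _ R^o t d d0).
Unshelve. all: by end_near. Qed.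

Lemma JrD f g a b : rcon f a b -> rcon g a b ->
  Jr (fun t => f t + g t) a b = Jr f a b + Jr g a b.
Proof. by move=> hf hg; rewrite /Jr RintegralD//; exact: rcon_int. Qed.
Lemma JrZ r f a b : rcon f a b -> Jr (fun t => r * f t) a b = r * Jr f a b.
Proof. by move=> hf; rewrite /Jr RintegralZl//; exact: rcon_int. Qed.
Lemma rcon_cst c a b : rcon (fun _ => c) a b.
Proof. by move=> t _; exact: cont_cst. Qed.
Lemma Jr_cst r a b : a <= b -> Jr (fun _ => r) a b = r * (b - a).
Proof.
move=> ab; rewrite /Jr Rintegral_cst//= lebesgue_measure_itv /=.
case: ifPn => [_|]; first by rewrite -EFinB.
by rewrite lte_fin -leNgt => ba; rewrite (_ : b = a) ?subrr//; lra.
Qed.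
Lemma le_Jr f g a b : rcon f a b -> rcon g a b ->
  (forall t, a <= t <= b -> f t <= g t) -> Jr f a b <= Jr g a b.
Proof.
move=> hf hg h; apply: le_Rintegral => //; try exact: rcon_int.
Qed.
Lemma Jr_chasles f a m b : a <= m -> m <= b -> rcon f a b ->
  Jr f a b = Jr f a m + Jr f m b.
Proof.
move=> am mb hf; have := @Rintegral_itvB _ f (BLeft a) (BRight b) m.
rewrite !bnd_simp /Jr => /(_ (rcon_int hf) am mb).
rewrite Rintegral_itv_obnd_cbnd => [<-|]; first by rewrite addrC subrK.
have : rcon f m b by move=> t /andP[h1 h2]; apply: hf; rewrite h2 (le_trans am).
move=> /rcon_int hi; apply: integrableS hi => //.
by move=> x /=; rewrite !in_itv /= => /andP[/ltW -> ->].
Qed.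

Lemma con_sub g a b a' b' : a <= a' -> b' <= b -> con g a b -> con g a' b'.
Proof. by move=> h1 h2 h t /andP[h3 h4]; apply: h; rewrite (le_trans h1) ?(le_trans h4). Qed.
Lemma conD f g a b : con f a b -> con g a b -> con (fun t => f t + g t) a b.
Proof. by move=> hf hg t ht; apply: contD; [exact: hf|exact: hg]. Qed.
Lemma conM f g a b : con f a b -> con g a b -> con (fun t => f t * g t) a b.
Proof. by move=> hf hg t ht; apply: contM; [exact: hf|exact: hg]. Qed.
Lemma con_cst c a b : con (fun _ => c) a b.
Proof. by move=> t _; exact: cont_cst. Qed.

Lemma J_ext f g a b : (forall t, a <= t <= b -> f t = g t) -> J f a b = J g a b.
Proof.
move=> h; rewrite /J /Jr; congr Complex; apply: eq_Rintegral => t;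
  by rewrite inE /= in_itv /= => /h ->.
Qed.
Lemma J_D f g a b : con f a b -> con g a b ->
  J (fun t => f t + g t) a b = J f a b + J g a b.
Proof.
move=> hf hg; apply: c_eq; rewrite ?reD ?imD /=.
  rewrite -JrD; [|exact: rcon_re|exact: rcon_re].
  by congr (Jr _ a b); apply/funext => t; rewrite reD.
rewrite -JrD; [|exact: rcon_im|exact: rcon_im].
by congr (Jr _ a b); apply/funext => t; rewrite imD.
Qed.
Lemma J_Z c f a b : con f a b -> J (fun t => c * f t) a b = c * J f a b.
Proof.
move=> hf; have hr := rcon_re hf; have hi := rcon_im hf.
have hZ r (h : R -> R) : rcon h a b -> rcon (fun t => r * h t) a b.
  move=> hh t /hh ch e e0.
  have e1 : 0 < e / (`|r| + 1) by rewrite divr_gt0// ltr_pwDr.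
  apply: nrW (ch _ e1) => y /=; rewrite -mulrBr normrM ltr_pdivlMr ?ltr_pwDr//.
  by have := normr_ge0 (h y - h t); have := normr_ge0 r; nra.
apply: c_eq; rewrite ?reM ?imM /=.
  have -> : - (im c * Jr (fun t => im (f t)) a b) = Jr (fun t => - im c * im (f t)) a b.
    by rewrite JrZ// mulNr.
  rewrite -JrZ// -JrD; [|exact: hZ|exact: hZ].
  by congr (Jr _ a b); apply/funext => t; rewrite reM mulNr.
rewrite -!JrZ// -JrD; [|exact: hZ|exact: hZ].
by congr (Jr _ a b); apply/funext => t; rewrite imM.
Qed.
Lemma J_cst c a b : a <= b -> J (fun _ => c) a b = c * (b - a)%:C%C.
Proof. by move=> ab; apply: c_eq; rewrite ?reM ?imM /= Jr_cst//; ring. Qed.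
Lemma J_re_ge g a b m : a <= b -> con g a b ->
  (forall t, a <= t <= b -> m <= re (g t)) -> m * (b - a) <= re (J g a b).
Proof.
move=> ab hg h; rewrite -Jr_cst//; apply: le_Jr => //; first exact: rcon_cst.
exact: rcon_re.
Qed.
Lemma J_im_ge g a b m : a <= b -> con g a b ->
  (forall t, a <= t <= b -> m <= im (g t)) -> m * (b - a) <= im (J g a b).
Proof.
move=> ab hg h; rewrite -Jr_cst//; apply: le_Jr => //; first exact: rcon_cst.
exact: rcon_im.
Qed.
(** The factor 2 comes from estimating real and imaginary parts separately; crude constants are
    harmless in all later limits. *)
Lemma J_bound g a b M : a <= b -> con g a b ->
  (forall t, a <= t <= b -> nc (g t) <= M) -> nc (J g a b) <= 2 * M * (b - a).
Proof.
move=> ab hg h.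
have hr t : a <= t <= b -> `|re (g t)| <= M by move=> /h; apply: le_trans (Re_le_nc _).
have hi t : a <= t <= b -> `|im (g t)| <= M by move=> /h; apply: le_trans (Im_le_nc _).
have aux f : rcon f a b -> (forall t, a <= t <= b -> `|f t| <= M) -> `|Jr f a b| <= M * (b - a).
  move=> hf hM; rewrite ler_norml; apply/andP; split.
    rewrite -mulNr -Jr_cst//; apply: le_Jr => //; first exact: rcon_cst.
    by move=> t /hM; rewrite ler_norml => /andP[].
  rewrite -Jr_cst//; apply: le_Jr => //; first exact: rcon_cst.
  by move=> t /hM; rewrite ler_norml => /andP[].
apply: le_trans (nc_le _) _; rewrite /J /=.
have := aux _ (rcon_re hg) hr; have := aux _ (rcon_im hg) hi; lra.
Qed.
Lemma J_chasles g a m b : a <= m -> m <= b -> con g a b ->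
  J g a b = J g a m + J g m b.
Proof.
move=> am mb hg; rewrite /J [RHS]/GRing.add /=.
by rewrite (Jr_chasles am mb (rcon_re hg)) (Jr_chasles am mb (rcon_im hg)).
Qed.

(** Mean value inequality from pointwise Lipschitz bounds: the interval is bisected until each piece
    is short and contains a point [x] through which the triangle inequality gives the bound. The
    slack [e] is removed at the end. With [M = 0] it proves equality of the two end values. *)
Lemma mvt (G : R -> C) (a b M : R) : a <= b ->
  (forall x e, a <= x <= b -> 0 < e -> exists2 d, 0 < d &
     forall y, a <= y <= b -> `|y - x| < d -> nc (G y - G x) <= (M + e) * `|y - x|) ->
  nc (G b - G a) <= M * (b - a).
Proof.
move=> ab h; apply/ler_addgt0Pr => e e0.
pose e' := e / (b - a + 1).
have e'0 : 0 < e' by rewrite divr_gt0//; lra.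
have : nc (G b - G a) <= (M + e') * (b - a).
  apply: (bisect1 (P := fun y z => nc (G z - G y) <= (M + e') * (z - y))) ab _ _.
    move=> x m y _ _ _ h1 h2; have := nc_tri (G m) (G x) (G y); lra.
  move=> x hx; have [d d0 hd] := h x e' hx e'0; exists d => // y z ay zb yxz zy.
  have h1 := hd y; have h2 := hd z.
  have {}h1 : nc (G y - G x) <= (M + e') * (x - y).
    have := h1; rewrite -normrN opprB ger0_norm; last lra.
    by apply; lra.
  have {}h2 : nc (G z - G x) <= (M + e') * (z - x).
    have := h2; rewrite ger0_norm; last lra.
    by apply; lra.
  by have := nc_tri (G x) (G y) (G z); rewrite (ncB (G x) (G y)); lra.
have : e' * (b - a) <= e.
  rewrite /e' mulrAC ler_pdivrMr; nra.
lra.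
Qed.

Definition rder (G : R -> C) (a b x : R) (d : C) := forall e, 0 < e ->
  exists2 dl, 0 < dl & forall y, a <= y <= b -> `|y - x| < dl ->
    nc (G y - G x - d * (y - x)%:C%C) <= e * `|y - x|.

(** The indefinite integral minus [G] has derivative 0, so [mvt] with [M = 0] applies. *)
Lemma J_ftc (G g : R -> C) a b : a <= b -> con g a b ->
  (forall x, a <= x <= b -> rder G a b x (g x)) -> J g a b = G b - G a.
Proof.
move=> ab hg hG.
(* An increment of the indefinite integral differs from its linear term by at most twice the
   oscillation of [g] times the length, on either side of [x]. *)
have key x y : a <= x <= b -> a <= y <= b ->
   forall e, 0 <= e -> (forall t, `|t - x| <= `|y - x| -> nc (g t - g x) <= e) ->
   nc (J g a y - J g a x - g x * (y - x)%:C%C) <= 2 * e * `|y - x|.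
  move=> /andP[ax xb] /andP[ay yb] e e0 he.
  have aux u w : a <= u -> u <= w -> w <= b -> w - u = `|y - x| ->
     (forall t, u <= t <= w -> `|t - x| <= `|y - x|) ->
     nc (J g u w - g x * (w - u)%:C%C) <= 2 * e * `|y - x|.
    move=> au uw wb E ht.
    have cg : con g u w by apply: con_sub hg.
    have -> : J g u w - g x * (w - u)%:C%C = J (fun t => g t + - g x) u w.
      by rewrite J_D ?J_cst ?mulNr//; exact: con_cst.
    rewrite -E; apply: J_bound => //; first by apply: conD => //; exact: con_cst.
    by move=> t tt; apply: he; apply: ht.
  have [xy|yx] := leP x y.
    have -> : J g a y = J g a x + J g x y by apply: J_chasles => //; apply: con_sub hg.
    rewrite (_ : J g a x + J g x y - J g a x = J g x y); last by ring.
    by apply: aux => //; [rewrite ger0_norm; lra|move=> t h; rewrite !ger0_norm; lra].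
  have -> : J g a x = J g a y + J g y x.
    by apply: J_chasles => //; [exact: ltW|apply: con_sub hg].
  have -> : J g a y - (J g a y + J g y x) - g x * (y - x)%:C%C =
     - (J g y x - g x * (x - y)%:C%C).
     rewrite -(opprB y x) rmorphN mulrN; ring.
  rewrite ncN; apply: aux => //; first exact: ltW.
    by rewrite ler0_norm; lra.
  by move=> t h; rewrite !ler0_norm; lra.
have : nc ((J g a b - G b) - (J g a a - G a)) <= 0 * (b - a).
  apply: (mvt (G := fun x => J g a x - G x)) ab _ => x e hx e0.
  have e4 : 0 < e / 4 by lra.
  have [d1 d10 h1] := hG x hx _ e4.
  have [d2 d20 h2] := hg x hx _ e4.
  exists (Num.min d1 d2); first by rewrite lt_min d10.
  move=> y hy; rewrite lt_min => /andP[y1 y2].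
  have k := key x y hx hy (e / 4) (ltW e4).
  have {}k : nc (J g a y - J g a x - g x * (y - x)%:C%C) <= 2 * (e / 4) * `|y - x|.
    by apply: k => t ht; apply: ltW; apply: h2; apply: le_lt_trans y2.
  have := h1 y hy y1.
  set A := J g a y - J g a x - _ in k *; set B := G y - G x - _ => hB.
  have -> : J g a y - G y - (J g a x - G x) = A - B by rewrite /A /B; ring.
  have := ncD A (- B); rewrite ncN add0r; have := normr_ge0 (y - x).
  nra.
rewrite mul0r => h; have /eqP := le_anti (introT andP (conj h (nc_ge0 _))).
rewrite nc_eq0 subr_eq0 => /eqP E.
have Jaa : J g a a = 0.
  have : nc (J g a a) <= 2 * (nc (g a) + 1) * (a - a).
    apply: J_bound => //; first by apply: con_sub hg.
    by move=> t ht; rewrite (_ : t = a) ?lerDl//; lra.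
  rewrite subrr mulr0 => h0; have /eqP := le_anti (introT andP (conj h0 (nc_ge0 _))).
  by rewrite nc_eq0 => /eqP.
by rewrite -[LHS](subrK (G b)) E Jaa; ring.
Qed.

End Integral.
Arguments J : simpl never.

Lemma distCE {R : realType} (x y : R[i]) : dist x y = nc (y - x). Proof. by []. Qed.
Lemma distRE {R : realType} (x y : R) : dist x y = `|y - x|. Proof. by []. Qed.
Lemma distVE {R : realType} n (x y : 'rV[R[i]]_n) : dist x y = nV (y - x).
Proof. by []. Qed.

(** * Holomorphic functions of one variable *)

Section Cder.
Context {R : realType}.
Local Notation C := R[i].
Implicit Types (f g : C -> C) (z w d : C).

(* Caratheodory form of the complex derivative *)
Definition cder f z d := exists phi : C -> C,
  [/\ cont phi z, phi z = d & nr z (fun w => f w = f z + phi w * (w - z))].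
Definition cdiff f z := exists d, cder f z d.

Lemma cder_eps f z d : cder f z d -> forall e, 0 < e ->
  nr z (fun w => nc (f w - f z - d * (w - z)) <= e * nc (w - z)).
Proof.
move=> [phi [cp pz h]] e e0; apply: nrW2 h (cp _ e0) => w /= -> hw.
rewrite (_ : _ - _ = (phi w - phi z) * (w - z)); last by rewrite pz; ring.
by rewrite ncM ler_wpM2r ?nc_ge0// ltW.
Qed.
Lemma eps_cder f z d : (forall e, 0 < e ->
  nr z (fun w => nc (f w - f z - d * (w - z)) <= e * nc (w - z))) -> cder f z d.
Proof.
move=> h; exists (fun w => if w == z then d else (f w - f z) / (w - z)).
rewrite eqxx; split=> //; last first.
  apply: nr_all => w; have [->|wz] := eqVneq w z; first by rewrite subrr mulr0 addr0.
  by rewrite divfK ?subr_eq0// subrKC.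
move=> e e0; have e2 : 0 < e / 2 by lra.
apply: nrW (h _ e2) => w hw /=; rewrite eqxx.
have [_|wz] := eqVneq w z; first by rewrite subrr nc0.
have n0 : 0 < nc (w - z) by rewrite nc_gt0 subr_eq0.
have -> : (f w - f z) / (w - z) - d = (f w - f z - d * (w - z)) / (w - z).
  by field; rewrite subr_eq0.
rewrite ncM ncV ltr_pdivrMr//; apply: le_lt_trans hw _.
by rewrite ltr_pM2r//; lra.
Qed.
Lemma cder_cont f z d : cder f z d -> cont f z.
Proof.
move=> [phi [cp pz h]].
apply: (@cont_eq _ _ _ (fun w => f z + phi w * (w - z))).
  by apply: nrW h => w ->.
apply: contD; first exact: cont_cst.
by apply: contM => //; apply: contB; [exact: cont_id|exact: cont_cst].
Qed.
Lemma cdiff_cont f z : cdiff f z -> cont f z.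
Proof. by move=> [d /cder_cont]. Qed.
Lemma cder_eq f g z d : nr z (fun w => f w = g w) -> cder f z d -> cder g z d.
Proof.
move=> h [phi [cp pz hp]]; exists phi; split=> //.
have E : f z = g z := nr_at h.
by apply: nrW2 h hp => w <-; rewrite -E.
Qed.
Lemma cder_cst c z : cder (fun _ => c) z 0.
Proof.
by exists (fun _ => 0); split=> //; [exact: cont_cst|apply: nr_all => w; rewrite mul0r addr0].
Qed.
Lemma cder_id z : cder (fun w => w) z 1.
Proof.
by exists (fun _ => 1); split=> //; [exact: cont_cst|apply: nr_all => w; ring].
Qed.
Lemma cderD f g z a b : cder f z a -> cder g z b -> cder (fun w => f w + g w) z (a + b).
Proof.
move=> [p [cp <- hp]] [q [cq <- hq]]; exists (fun w => p w + q w); split=> //.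
  exact: contD.
by apply: nrW2 hp hq => w -> ->; ring.
Qed.
Lemma cderM f g z a b : cder f z a -> cder g z b ->
  cder (fun w => f w * g w) z (a * g z + f z * b).
Proof.
move=> df dg; have cg := cder_cont dg.
move: df dg => [p [cp <- hp]] [q [cq <- hq]].
exists (fun w => p w * g w + f z * q w); split=> //.
  by apply: contD; apply: contM => //; exact: cont_cst.
by apply: nrW2 hp hq => w -> ->; ring.
Qed.
Lemma cderN f z a : cder f z a -> cder (fun w => - f w) z (- a).
Proof.
move=> [p [cp <- hp]]; exists (fun w => - p w); split=> //; first exact: contN.
by apply: nrW hp => w ->; ring.
Qed.
Lemma cderV f z a : f z != 0 -> cder f z a -> cder (fun w => (f w)^-1) z (- a / f z ^+ 2).
Proof.
move=> fz df; have cf := cder_cont df; move: df => [p [cp <- hp]].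
exists (fun w => - p w / (f w * f z)); split.
- apply: contM; first exact: contN.
  by apply: contV; [rewrite mulf_neq0|apply: contM => //; exact: cont_cst].
- by rewrite expr2.
- apply: nrW2 hp (cont_neq0 cf fz) => w E fw.
  have := congr1 (fun t => t - f z) E; rewrite [RHS]addrC addKr => E'.
  have -> : - p w / (f w * f z) * (w - z) = - (p w * (w - z)) / (f w * f z) by ring.
  by rewrite -E'; field; rewrite fz fw.
Qed.
Lemma cder_comp f g z a b : cder f z a -> cder g (f z) b ->
  cder (fun w => g (f w)) z (b * a).
Proof.
move=> df; have cf := cder_cont df; move: df => [p [cp <- hp]] [q [cq <- hq]].
exists (fun w => q (f w) * p w); split=> //; first by apply: contM => //; exact: cont_comp.
by apply: nrW2 hp (cont_nr cf hq) => w E ->; rewrite {2}E; ring.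
Qed.
Lemma cder_uniq f z a b : cder f z a -> cder f z b -> a = b.
Proof.
move=> da db; apply/eqP; rewrite -subr_eq0 -nc_eq0; apply/eqP/le_anti.
rewrite nc_ge0 andbT; apply/ler_addgt0Pr => e e0; rewrite add0r.
have e2 : 0 < e / 2 by lra.
have [r r0 h] := nrI (cder_eps da e2) (cder_eps db e2).
have [] := h (z + (r / 2)%:C%C).
  by rewrite /= addrC addKr nc_real ger0_norm; lra.
set u := (r / 2)%:C%C; rewrite (_ : z + u - z = u); last by ring.
have u0 : 0 < nc u by rewrite nc_real ger0_norm; lra.
move=> h1 h2; rewrite -(ler_pM2r u0) -ncM.
have -> : (a - b) * u = (f (z + u) - f z - b * u) - (f (z + u) - f z - a * u) by ring.
apply: le_trans (ncD _ _) _; rewrite ncN; lra.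
Qed.

Lemma cdiff_eq f g z : nr z (fun w => f w = g w) -> cdiff f z -> cdiff g z.
Proof. by move=> h [d /(cder_eq h)]; exists d. Qed.
Lemma cdiff_cst c z : cdiff (fun _ => c) z. Proof. by exists 0; exact: cder_cst. Qed.
Lemma cdiff_id z : cdiff (fun w => w) z. Proof. by exists 1; exact: cder_id. Qed.
Lemma cdiffD f g z : cdiff f z -> cdiff g z -> cdiff (fun w => f w + g w) z.
Proof. by move=> [a ha] [b hb]; eexists; exact: cderD ha hb. Qed.
Lemma cdiffN f z : cdiff f z -> cdiff (fun w => - f w) z.
Proof. by move=> [a ha]; eexists; exact: cderN ha. Qed.
Lemma cdiffB f g z : cdiff f z -> cdiff g z -> cdiff (fun w => f w - g w) z.
Proof. by move=> hf hg; apply: cdiffD => //; exact: cdiffN. Qed.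
Lemma cdiffM f g z : cdiff f z -> cdiff g z -> cdiff (fun w => f w * g w) z.
Proof. by move=> [a ha] [b hb]; eexists; exact: cderM ha hb. Qed.
Lemma cdiffV f z : f z != 0 -> cdiff f z -> cdiff (fun w => (f w)^-1) z.
Proof. by move=> fz [a ha]; eexists; exact: cderV fz ha. Qed.
Lemma cdiff_comp f g z : cdiff f z -> cdiff g (f z) -> cdiff (fun w => g (f w)) z.
Proof. by move=> [a ha] [b hb]; eexists; exact: cder_comp ha hb. Qed.
Lemma cdiffX f z n : cdiff f z -> cdiff (fun w => f w ^+ n) z.
Proof.
move=> df; elim: n => [|n IH]; first exact: cdiff_cst.
by apply: cdiff_eq (cdiffM df IH); apply: nr_all => w; rewrite exprS.
Qed.
Lemma cdiff_prod (I : Type) (s : seq I) (F : I -> C -> C) z :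
  (forall i, cdiff (F i) z) -> cdiff (fun w => \prod_(i <- s) F i w) z.
Proof.
move=> h; elim: s => [|i s IH].
  by apply: cdiff_eq (cdiff_cst 1 z); apply: nr_all => w; rewrite big_nil.
by apply: cdiff_eq (cdiffM (h i) IH); apply: nr_all => w; rewrite big_cons.
Qed.

End Cder.

(** * Integrals over boundaries of rectangles and Goursat's theorem *)

Section Contour.
Context {R : realType}.
Local Notation C := R[i].
Implicit Types (f g : C -> C) (a b c d : R).

Lemma hsub (x y c : R) : Complex y c - Complex x c = (y - x)%:C%C.
Proof. by apply: c_eq; rewrite ?reD ?reN ?imD ?imN /=; ring. Qed.
Lemma vsub (x y a : R) : Complex a y - Complex a x = 'i%C * (y - x)%:C%C.
Proof. by apply: c_eq; rewrite ?reD ?reN ?imD ?imN ?reM ?imM /=; ring. Qed.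
Lemma cont_h (c x : R) : cont (fun t : R => Complex t c) x.
Proof. by move=> e e0; exists e => // y; rewrite distCE distRE hsub nc_real. Qed.
Lemma cont_v (a x : R) : cont (fun t : R => Complex a t) x.
Proof. by move=> e e0; exists e => // y; rewrite distCE distRE vsub ncM nc_i mul1r nc_real. Qed.

Definition on_rect a b c d (z : C) : Prop :=
  ((re z = a \/ re z = b) /\ c <= im z <= d) \/ ((im z = c \/ im z = d) /\ a <= re z <= b).
Definition in_rect a b c d (z : C) : Prop := a <= re z <= b /\ c <= im z <= d.
Definition in_rect_open a b c d (z : C) : Prop := a < re z < b /\ c < im z < d.

(** Counterclockwise: bottom and right, then top and left with reversed sign; the factor ['i] comes
    from $dz = i\,dy$ on vertical sides. *)
Definition oint f a b c d : C :=
  J (fun x => f (Complex x c)) a b + 'i%C * J (fun y => f (Complex b y)) c d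
  - J (fun x => f (Complex x d)) a b - 'i%C * J (fun y => f (Complex a y)) c d.

Arguments oint : simpl never.

Definition cob f a b c d := forall z, on_rect a b c d z -> cont f z.

Lemma cob_b f a b c d : c <= d -> cob f a b c d -> con (fun x => f (Complex x c)) a b.
Proof.
by move=> cd h t ht; apply: cont_comp (cont_h c t) (h _ _); right; split=> //; left.
Qed.
Lemma cob_t f a b c d : c <= d -> cob f a b c d -> con (fun x => f (Complex x d)) a b.
Proof.
by move=> cd h t ht; apply: cont_comp (cont_h d t) (h _ _); right; split=> //; right.
Qed.
Lemma cob_r f a b c d : a <= b -> cob f a b c d -> con (fun x => f (Complex b x)) c d.
Proof.
by move=> cd h t ht; apply: cont_comp (cont_v b t) (h _ _); left; split=> //; right.
Qed.
Lemma cob_l f a b c d : a <= b -> cob f a b c d -> con (fun x => f (Complex a x)) c d.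
Proof.
by move=> cd h t ht; apply: cont_comp (cont_v a t) (h _ _); left; split=> //; left.
Qed.

Section Lin.
Variables (a b c d : R).
Hypotheses (ab : a <= b) (cd : c <= d).

Lemma oint_ext f g : (forall z, on_rect a b c d z -> f z = g z) ->
  oint f a b c d = oint g a b c d.
Proof.
move=> h; rewrite /oint; congr (_ + _ * _ - _ - _ * _); apply: J_ext => t ht; apply: h.
- by right; split=> //; left.
- by left; split=> //; right.
- by right; split=> //; right.
- by left; split=> //; left.
Qed.
Lemma ointD f g : cob f a b c d -> cob g a b c d ->
  oint (fun z => f z + g z) a b c d = oint f a b c d + oint g a b c d.
Proof.
move=> hf hg; rewrite /oint !J_D; try solve [exact: cob_b|exact: cob_t|exact: cob_l|exact: cob_r].
- by ring.
- exact: cob_l hf.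
- exact: cob_l hg.
- exact: cob_t hf.
- exact: cob_t hg.
- exact: cob_r hf.
- exact: cob_r hg.
- exact: cob_b hf.
- exact: cob_b hg.
Qed.
Lemma ointZ k f : cob f a b c d ->
  oint (fun z => k * f z) a b c d = k * oint f a b c d.
Proof.
move=> hf; rewrite /oint.
rewrite (J_Z k (cob_b cd hf)) (J_Z k (cob_t cd hf)) (J_Z k (cob_l ab hf)) (J_Z k (cob_r ab hf)).
ring.
Qed.
Lemma oint_bound f M : cob f a b c d -> (forall z, on_rect a b c d z -> nc (f z) <= M) ->
  nc (oint f a b c d) <= 4 * M * ((b - a) + (d - c)).
Proof.
move=> hf h; rewrite /oint.
have hb : nc (J (fun x => f (Complex x c)) a b) <= 2 * M * (b - a).
  by apply: J_bound => //; [exact: cob_b hf|move=> t ht; apply: h; right; split=> //; left].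
have ht : nc (J (fun x => f (Complex x d)) a b) <= 2 * M * (b - a).
  by apply: J_bound => //; [exact: cob_t hf|move=> t ht; apply: h; right; split=> //; right].
have hl : nc (J (fun x => f (Complex a x)) c d) <= 2 * M * (d - c).
  by apply: J_bound => //; [exact: cob_l hf|move=> t ht'; apply: h; left; split=> //; left].
have hr : nc (J (fun x => f (Complex b x)) c d) <= 2 * M * (d - c).
  by apply: J_bound => //; [exact: cob_r hf|move=> t ht'; apply: h; left; split=> //; right].
move: hb ht hl hr; set B := J _ a b; set T := J _ a b; set L := J _ c d; set Q := J _ c d.
move=> hb ht hl hr.
have := ncD (B + 'i%C * Q - T) (- ('i%C * L)); have := ncD (B + 'i%C * Q) (- T).
by have := ncD B ('i%C * Q); rewrite !ncN !ncM nc_i !mul1r; lra.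
Qed.
Lemma oint_der F f : cob f a b c d -> (forall z, on_rect a b c d z -> cder F z (f z)) ->
  oint f a b c d = 0.
Proof.
move=> cf hF.
have hh y : (y = c \/ y = d) -> forall x, a <= x <= b ->
    rder (fun x => F (Complex x y)) a b x (f (Complex x y)).
  move=> hy x hx e e0.
  have [r r0 hr] := cder_eps (hF (Complex x y) (or_intror (conj hy hx))) e0.
  exists r => // x' _ hx'; by have := hr (Complex x' y); rewrite distCE hsub nc_real; apply.
have hv x : (x = a \/ x = b) -> forall y, c <= y <= d ->
    rder (fun y => F (Complex x y)) c d y ('i%C * f (Complex x y)).
  move=> hx y hy e e0.
  have [r r0 hr] := cder_eps (hF (Complex x y) (or_introl (conj hx hy))) e0.
  exists r => // y' _ hy'; have := hr (Complex x y'); rewrite distCE vsub ncM nc_i mul1r nc_real.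
  by rewrite mulrA (mulrC (f _)); apply.
rewrite /oint -!J_Z; [|exact: cob_l cf|exact: cob_r cf].
rewrite (J_ftc ab _ (hh c _)); [|exact: cob_b cf|by left].
rewrite (J_ftc ab _ (hh d _)); [|exact: cob_t cf|by right].
rewrite (J_ftc cd _ (hv a _)); [|by apply: conM; [exact: con_cst|exact: cob_l cf]|by left].
rewrite (J_ftc cd _ (hv b _)); [|by apply: conM; [exact: con_cst|exact: cob_r cf]|by right].
ring.
Qed.
End Lin.

Lemma onb_inr a b c d z : a <= b -> c <= d -> on_rect a b c d z -> in_rect a b c d z.
Proof. by move=> ab cd [[[|] h1 h2]|[[|] h1 h2]]; rewrite /in_rect h1 h2 !lexx ?ab ?cd. Qed.
Lemma inr_cob f a b c d : a <= b -> c <= d ->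
  (forall z, in_rect a b c d z -> cont f z) -> cob f a b c d.
Proof. by move=> ab cd h z hz; apply: h; exact: onb_inr. Qed.

Lemma oint_cutv f a m b c d : a <= m -> m <= b -> c <= d ->
  (forall z, in_rect a b c d z -> cont f z) ->
  oint f a b c d = oint f a m c d + oint f m b c d.
Proof.
move=> am mb cd cf; have ab := le_trans am mb.
have h := inr_cob ab cd cf.
rewrite /oint (J_chasles am mb (cob_b cd h)) (J_chasles am mb (cob_t cd h)).
ring.
Qed.
Lemma oint_cuth f a b c m d : c <= m -> m <= d -> a <= b ->
  (forall z, in_rect a b c d z -> cont f z) ->
  oint f a b c d = oint f a b c m + oint f a b m d.
Proof.
move=> cm md ab cf; have cd := le_trans cm md.
have h := inr_cob ab cd cf.
rewrite /oint (J_chasles cm md (cob_l ab h)) (J_chasles cm md (cob_r ab h)).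
ring.
Qed.

(** Bisection bounds the integral by $e$ times the square of the half-perimeter, for every $e > 0$.
    This bound is additive, since each of four quarters carries a quarter of it. On small boxes [f]
    is affine up to a small error, and the affine part integrates to 0. *)
Lemma goursat f a b c d : a <= b -> c <= d ->
  (forall z, in_rect a b c d z -> cdiff f z) -> oint f a b c d = 0.
Proof.
move=> ab cd df.
have cf z : in_rect a b c d z -> cont f z by move=> /df /cdiff_cont.
apply/eqP; rewrite -nc_eq0; apply/eqP/le_anti; rewrite nc_ge0 andbT.
pose s := (b - a) + (d - c).
suff main e : 0 < e -> nc (oint f a b c d) <= e * s ^+ 2.
  apply/ler_addgt0Pr => e e0; rewrite add0r.
  have s0 : 0 < s ^+ 2 + 1 by rewrite ltr_wpDl// sqr_ge0.
  apply: le_trans (main _ (divr_gt0 e0 s0)) _.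
  rewrite mulrAC ler_pdivrMr//; have := sqr_ge0 s; nra.
move=> e0.
pose P (lo L : bool -> R) := a <= lo true -> lo true + L true <= b ->
  c <= lo false -> lo false + L false <= d ->
  nc (oint f (lo true) (lo true + L true) (lo false) (lo false + L false))
    <= e * (L true + L false) ^+ 2.
pose lo0 (x : bool) := if x then a else c.
pose L0 (x : bool) := if x then b - a else d - c.
have : P lo0 L0.
  apply: box_ind.
  - by move=> []; rewrite /L0; lra.
  - move=> lo L Lge h h1 h2 h3 h4.
    have L1 := Lge true; have L2 := Lge false.
    have sub z : in_rect (lo true) (lo true + L true) (lo false) (lo false + L false) z ->
      cont f z by move=> [? ?]; apply: cf; split; lra.
    rewrite (@oint_cutv _ _ (lo true + L true / 2)); [|lra|lra|lra|exact: sub].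
    rewrite (@oint_cuth _ _ _ _ (lo false + L false / 2)); [|lra|lra|lra|]; last first.
      by move=> z [? ?]; apply: sub; split; lra.
    rewrite (@oint_cuth _ _ (lo true + L true) _ (lo false + L false / 2)); [|lra|lra|lra|]; last first.
      by move=> z [? ?]; apply: sub; split; lra.
    have f2 : lo true + L true / 2 <= b by lra.
    have f3 : a <= lo true + L true / 2 by lra.
    have g2 : lo false + L false / 2 <= d by lra.
    have g3 : c <= lo false + L false / 2 by lra.
    have H (e1 e2 : bool) := h (fun x => if x then e1 else e2).
    move: (H false false) (H false true) (H true false) (H true true).
    rewrite /P /= !addr0.
    have half (x y : R) : x + y / 2 + y / 2 = x + y by lra.
    rewrite !half.
    move=> /(_ h1 f2 h3 g2) k1.
    move=> /(_ h1 f2 g3 h4) k2.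
    move=> /(_ f3 h2 h3 g2) k3.
    move=> /(_ f3 h2 g3 h4) k4.
    have T4 (x y u v : C) : nc (x + y + (u + v)) <= nc x + nc y + (nc u + nc v).
      by apply: le_trans (ncD _ _) (lerD (ncD _ _) (ncD _ _)).
    apply: le_trans (T4 _ _ _ _) _.
    apply: le_trans (lerD (lerD k1 k2) (lerD k3 k4)) _.
    by rewrite le_eqVlt; apply/orP; left; apply/eqP; field.
  - move=> pt hpt.
    pose z0 := Complex (pt true) (pt false).
    have hz0 : in_rect a b c d z0.
      by have := hpt true; have := hpt false; rewrite /lo0 /L0 /= => ? ?; split=> /=; lra.
    have [dd hdd] := df _ hz0.
    (* Compensates the factor 4 of [oint_bound]. *)
    have e4 : 0 < e / 4 by lra.
    have [r r0 hr] := cder_eps hdd e4.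
    exists (r / 2) => [|lo n hl]; first lra.
    move: (hl true) (hl false); set l1 := L0 true / _; set l2 := L0 false / _.
    move=> [g1 g2 g3 g4 g5] [k1 k2 k3 k4 k5] h1 h2 h3 h4.
    have l10 : 0 <= l1 by rewrite /l1 /L0 divr_ge0 ?exprn_ge0//; lra.
    have l20 : 0 <= l2 by rewrite /l2 /L0 divr_ge0 ?exprn_ge0//; lra.
    have [? ?] : lo true <= lo true + l1 /\ lo false <= lo false + l2 by lra.
    rewrite -/l1 -/l2 in h2 h4 *.
    set a1 := lo true; set b1 := a1 + l1; set c1 := lo false; set d1 := c1 + l2.
    have sub z : in_rect a1 b1 c1 d1 z -> cont f z.
      by rewrite /b1 /d1 /a1 /c1 => -[? ?]; apply: cf; split; lra.
    pose A z := f z0 + dd * (z - z0).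
    have cA z : cont A z.
      apply: contD; first exact: cont_cst.
      by apply: contM; [exact: cont_cst|apply: contB; [exact: cont_id|exact: cont_cst]].
    (* The affine approximation has an explicit quadratic primitive. *)
    have dA : oint A a1 b1 c1 d1 = 0.
      apply: (@oint_der _ _ _ _ _ _ (fun z => f z0 * z + dd * ((z - z0) ^+ 2 / 2))) => //.
      move=> z _; have i1 := cder_id z; have k z' := cder_cst z' z.
      have q := cderD i1 (k (- z0)).
      have := cderD (cderM (k (f z0)) i1) (cderM (k dd) (cderM (cderM q q) (k 2^-1))).
      rewrite (_ : _ + _ = A z); last by rewrite /A; field.
      by apply: cder_eq; apply: nr_all => y; rewrite expr2.
    have -> : oint f a1 b1 c1 d1 = oint (fun z => f z + (-1) * A z) a1 b1 c1 d1.
      rewrite ointD ?ointZ ?dA ?mulr0 ?addr0//.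
      - exact: inr_cob.
      - by move=> z _; apply: contM; [exact: cont_cst|].
    apply: le_trans (@oint_bound _ _ _ _ _ _ _ (e / 4 * (l1 + l2)) _ _) _ => //.
    - apply: inr_cob => // z hz; apply: contD; first exact: sub.
      by apply: contM; [exact: cont_cst|].
    - move=> z hz; have : in_rect a1 b1 c1 d1 z by apply: onb_inr hz.
      rewrite /b1 /d1 /a1 /c1 => -[? ?].
      have hzn : nc (z - z0) <= l1 + l2.
        apply: le_trans (nc_le _) _; rewrite reD imD reN imN /=.
        by apply: lerD; rewrite ler_norml; lra.
      rewrite mulN1r (_ : f z - A z = f z - f z0 - dd * (z - z0)); last by rewrite /A; ring.
      apply: le_trans (hr z _) _ => /=; first by apply: le_lt_trans hzn _; lra.
      by rewrite ler_wpM2l//; lra.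
    - have -> : b1 - a1 = l1 by rewrite /b1 addrC addKr.
      have -> : d1 - c1 = l2 by rewrite /d1 addrC addKr.
      clear; rewrite (_ : 4 * (e / 4 * (l1 + l2)) * (l1 + l2) = e * (l1 + l2) ^+ 2)//.
      by field.
rewrite /P /lo0 /L0 /= => /(_ (lexx _)); rewrite !subrKC => /(_ (lexx _) (lexx _) (lexx _)).
by rewrite -/s.
Qed.

End Contour.

(** * Cauchy's formula on rectangles *)

Section Cauchy.
Context {R : realType}.
Local Notation C := R[i].
Implicit Types (f g : C -> C) (a b c d : R).

Lemma cont_bounded (g : R -> C) a b : a <= b -> con g a b ->
  exists M, forall t, a <= t <= b -> nc (g t) <= M.
Proof.
move=> ab cg.
apply: (bisect1 (P := fun y z => exists M, forall t, y <= t <= z -> nc (g t) <= M)) ab _ _.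
  move=> x m y _ _ _ [M1 h1] [M2 h2]; exists (Num.max M1 M2) => t /andP[xt ty].
  rewrite le_max; have [tm|/ltW mt] := leP t m; first by rewrite h1// xt.
  by rewrite h2 ?orbT// mt.
move=> x hx; have [r r0 hr] := cont_bound (cg x hx).
exists r => // y z _ _ yxz zy; exists (nc (g x) + 1) => t ht; apply: hr.
by rewrite distRE ltr_norml; lra.
Qed.

Lemma cob_bounded f a b c d : a <= b -> c <= d -> cob f a b c d ->
  exists M, forall z, on_rect a b c d z -> nc (f z) <= M.
Proof.
move=> ab cd cf.
have [M1 h1] := cont_bounded ab (cob_b cd cf); have [M2 h2] := cont_bounded ab (cob_t cd cf).
have [M3 h3] := cont_bounded cd (cob_l ab cf); have [M4 h4] := cont_bounded cd (cob_r ab cf).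
exists (Num.max (Num.max M1 M2) (Num.max M3 M4)) => -[x y].
case=> [[[|] /= -> hy]|[[|] /= -> hx]]; rewrite !le_max.
- by rewrite h3 ?orbT.
- by rewrite h4 ?orbT.
- by rewrite h1.
- by rewrite h2 ?orbT.
Qed.

(** One [eta] serves all [w'] near [w], which gives the bounds on Cauchy kernels their uniformity in
    the pole. *)
Lemma onb_dist a b c d w : in_rect_open a b c d w -> exists2 eta, 0 < eta &
  forall z w', on_rect a b c d z -> nc (w' - w) < eta -> eta <= nc (z - w').
Proof.
move=> [/andP[h1 h2] /andP[h3 h4]].
pose m := Num.min (Num.min (re w - a) (b - re w)) (Num.min (im w - c) (d - im w)).
have m0 : 0 < m by rewrite !lt_min; lra.
have [m1 m2 m3 m4] : [/\ m <= re w - a, m <= b - re w, m <= im w - c & m <= d - im w].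
  by rewrite /m; split; rewrite !ge_min lexx ?orbT.
exists (m / 2) => [|z w' hz hw]; first lra.
have hzw : m <= nc (z - w).
  have hr := Re_le_nc (z - w); have hi := Im_le_nc (z - w).
  move: hr hi; rewrite reD imD reN imN.
  case: hz => [[[|] -> _]|[[|] -> _]] hr hi.
  - by apply: le_trans m1 _; apply: le_trans hr; rewrite -normrN opprB ler_norm.
  - by apply: le_trans m2 _; apply: le_trans hr; rewrite ler_norm.
  - by apply: le_trans m3 _; apply: le_trans hi; rewrite -normrN opprB ler_norm.
  - by apply: le_trans m4 _; apply: le_trans hi; rewrite ler_norm.
by have := nc_tri w' w z; lra.
Qed.

Lemma onb_neq a b c d w z : in_rect_open a b c d w -> on_rect a b c d z -> z != w.
Proof.
move=> /onb_dist [e e0 h] /h - /(_ w); rewrite subrr nc0 => /(_ e0) hz.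
by rewrite -subr_eq0 -nc_gt0; lra.
Qed.

Lemma inro_lt a b c d w : in_rect_open a b c d w -> a < b /\ c < d.
Proof. by move=> [? ?]; split; lra. Qed.

(** Cutting out a square of half side $e$ around [w] leaves four rectangles that avoid [w], where
    Goursat applies. On the square [f] is bounded by $M$, and half the perimeter is $4e$, so its
    integral is at most $16Me$. *)
Lemma goursat_pt f a b c d w : in_rect_open a b c d w ->
  (forall z, in_rect a b c d z -> cont f z) ->
  (forall z, in_rect a b c d z -> z != w -> cdiff f z) -> oint f a b c d = 0.
Proof.
move=> hw cf df; have [ab cd] := inro_lt hw.
move: (hw) => [/andP[h1 h2] /andP[h3 h4]].
have hwi : in_rect a b c d w by split; lra.
have [r r0 hr] := cont_bound (cf _ hwi).
apply/eqP; rewrite -nc_eq0; apply/eqP/le_anti; rewrite nc_ge0 andbT.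
set M := nc (f w) + 1 in hr; have M0 : 0 < M by rewrite /M ltr_wpDl ?nc_ge0.
suff main e : 0 < e -> e < re w - a -> e < b - re w -> e < im w - c -> e < d - im w ->
    e < r / 2 -> nc (oint f a b c d) <= 16 * M * e.
  apply/ler_addgt0Pr => e e0; rewrite add0r.
  pose m := Num.min (Num.min (Num.min (re w - a) (b - re w)) (Num.min (im w - c) (d - im w)))
     (Num.min (r / 2) (e / (16 * M))).
  have m0 : 0 < m by rewrite /m !lt_min (divr_gt0 e0) ?mulr_gt0//; lra.
  have [m1 m2 m3 m4] : [/\ m <= re w - a, m <= b - re w, m <= im w - c & m <= d - im w].
    by rewrite /m; split; rewrite !ge_min lexx ?orbT.
  have m5 : m <= r / 2 by rewrite /m !ge_min lexx ?orbT.
  have m6 : m <= e / (16 * M) by rewrite /m !ge_min lexx ?orbT.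
  apply: le_trans (main (m / 2) _ _ _ _ _ _) _; try lra.
  by move: m6; rewrite ler_pdivlMr ?mulr_gt0//; nra.
move=> e0 e1 e2 e3 e4 e5.
have sub a' b' c' d' : a <= a' -> b' <= b -> c <= c' -> d' <= d ->
   forall z, in_rect a' b' c' d' z -> cont f z.
  by move=> ? ? ? ? z [? ?]; apply: cf; split; lra.
have zero a' b' c' d' : a <= a' -> b' <= b -> c <= c' -> d' <= d -> a' <= b' -> c' <= d' ->
   (~ in_rect a' b' c' d' w) -> oint f a' b' c' d' = 0.
  move=> ? ? ? ? ? ? nw; apply: goursat => // z hz; apply: df.
    by case: hz => ? ?; split; lra.
  by apply/eqP => E; apply: nw; rewrite -E.
have [A1 A2 A3 A4] : [/\ a <= re w - e, re w + e <= b, c <= im w - e & im w + e <= d] by split; lra.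
have [B1 B2] : re w - e <= re w + e /\ im w - e <= im w + e by lra.
have [A1' A2'] := (le_trans A1 B1, le_trans B1 A2).
have [A3' A4'] := (le_trans A3 B2, le_trans B2 A4).
have [W1 W2] : (re w <= re w - e) = false /\ (re w + e <= re w) = false.
  by split; apply/negbTE; rewrite -ltNge; lra.
have [W3 W4] : (im w <= im w - e) = false /\ (im w + e <= im w) = false.
  by split; apply/negbTE; rewrite -ltNge; lra.
have [ab' cd'] := (ltW ab, ltW cd).
rewrite (@oint_cutv _ _ _ (re w - e) _ _ _ A1 A2' cd' cf).
rewrite (zero a) ?lexx//; last by case; rewrite W1 andbF.
rewrite (@oint_cutv _ _ _ (re w + e) _ _ _ B1 A2 cd' (sub _ _ _ _ A1 (lexx _) (lexx _) (lexx _))).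
rewrite (zero (re w + e)) ?lexx//; last by case; rewrite W2.
have cm := sub _ _ _ _ A1 A2 (lexx c) (lexx d).
rewrite (@oint_cuth _ _ _ _ _ (im w - e) _ A3 A4' B1 cm).
rewrite (zero _ _ c) ?lexx//; last by case=> _; rewrite W3 andbF.
rewrite (@oint_cuth _ _ _ _ _ (im w + e) _ B2 A4 B1 (sub _ _ _ _ A1 A2 A3 (lexx _))).
rewrite (zero _ _ (im w + e)) ?lexx//; last by case=> _; rewrite W4.
rewrite add0r addr0 add0r addr0.
apply: le_trans (@oint_bound _ _ _ _ _ B1 B2 _ M _ _) _; last by clear; lra.
  exact: inr_cob B1 B2 (sub _ _ _ _ A1 A2 A3 A4).
move=> z hz; have [k1 k2] : in_rect (re w - e) (re w + e) (im w - e) (im w + e) z.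
  exact: onb_inr B1 B2 hz.
clear - hr k1 k2 e5; apply: hr; rewrite distCE; apply: le_lt_trans (nc_le _) _; rewrite reD imD reN imN.
have : `|re z - re w| <= e by rewrite ler_norml; lra.
have : `|im z - im w| <= e by rewrite ler_norml; lra.
lra.
Qed.

Lemma cob_inv a b c d w : in_rect_open a b c d w -> cob (fun z => (z - w)^-1) a b c d.
Proof.
move=> hw z /(onb_neq hw) zw; apply: contV; first by rewrite subr_eq0.
by apply: contB; [exact: cont_id|exact: cont_cst].
Qed.

Lemma cobM f g a b c d : cob f a b c d -> cob g a b c d -> cob (fun z => f z * g z) a b c d.
Proof. by move=> hf hg z hz; apply: contM; [exact: hf|exact: hg]. Qed.

(* The difference quotient of [f] at [w] is continuous at [w] and holomorphic elsewhere. *)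
Lemma cauchy_pre f a b c d w : in_rect_open a b c d w -> (forall z, in_rect a b c d z -> cdiff f z) ->
  oint (fun z => f z / (z - w)) a b c d = f w * oint (fun z => (z - w)^-1) a b c d.
Proof.
move=> hw df; have [/ltW ab /ltW cd] := inro_lt hw.
have hwi : in_rect a b c d w by case: hw => ? ?; split; lra.
have [dd hdd] := df w hwi; have [phi [cp pw hp]] := hdd.
pose g z := if z == w then dd else (f z - f w) / (z - w).
have gE z : z != w -> nr z (fun y => (f y - f w) / (y - w) = g y).
  move=> zw; have n0 : 0 < nc (w - z) by rewrite nc_gt0 subr_eq0 eq_sym.
  exists (nc (w - z)) => // y; rewrite distCE /g; have [->|//] := eqVneq y w.
  by rewrite ltxx.
have dg z : in_rect a b c d z -> z != w -> cdiff g z.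
  move=> hz zw; apply: cdiff_eq (gE z zw) _; apply: cdiffM.
    by apply: cdiffB; [exact: df|exact: cdiff_cst].
  apply: cdiffV; first by rewrite subr_eq0.
  by apply: cdiffB; [exact: cdiff_id|exact: cdiff_cst].
have cg z : in_rect a b c d z -> cont g z.
  move=> hz; have [->|zw] := eqVneq z w; last exact: cdiff_cont (dg z hz zw).
  apply: cont_eq cp; apply: nrW hp => y E; rewrite /g.
  have [->|yw] := eqVneq y w; first by rewrite pw.
  by rewrite E; field; rewrite subr_eq0.
have := goursat_pt hw cg dg.
have -> : oint g a b c d = oint (fun z => f z / (z - w) + (- f w) * (z - w)^-1) a b c d.
  apply: oint_ext => z hz; rewrite /g (negbTE (onb_neq hw hz)).
  by rewrite mulrBl mulNr.
have cf : cob f a b c d by apply: inr_cob => // z hz; apply: cdiff_cont; exact: df.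
have ci := cob_inv hw.
rewrite ointD//; [|exact: cobM|by apply: cobM => // z _; exact: cont_cst].
by rewrite ointZ// mulNr => /eqP; rewrite subr_eq0 => /eqP.
Qed.

Lemma seg_lt (x y z t : R) : x < y -> x < z -> 0 <= t -> t <= 1 -> x < (1 - t) * y + t * z.
Proof.
move=> xy xz t0 t1; have [yz|/ltW zy] := leP y z.
  have : 0 <= t * (z - y) by rewrite mulr_ge0// subr_ge0.
  lra.
have : 0 <= (1 - t) * (y - z) by rewrite mulr_ge0// subr_ge0.
lra.
Qed.
Lemma seg_gt (x y z t : R) : y < x -> z < x -> 0 <= t -> t <= 1 -> (1 - t) * y + t * z < x.
Proof.
move=> xy xz t0 t1; have := @seg_lt (- x) (- y) (- z) t.
by rewrite !ltrN2 !mulrN -opprD ltrN2; apply.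
Qed.

(** When the pole moves along the segment [p], the derivative of the integral is a multiple of the
    integral of $(z-w)^{-2}$, which has a primitive; the remainder is quadratic, so [mvt] applies
    with [M = 0]. *)
Lemma oint_inv_const a b c d w w' : in_rect_open a b c d w -> in_rect_open a b c d w' ->
  oint (fun z => (z - w)^-1) a b c d = oint (fun z => (z - w')^-1) a b c d.
Proof.
move=> hw hw'; have [/ltW ab /ltW cd] := inro_lt hw.
pose p t := w + t%:C%C * (w' - w).
have pin t : 0 <= t <= 1 -> in_rect_open a b c d (p t).
  move: hw hw' => [/andP[? ?] /andP[? ?]] [/andP[? ?] /andP[? ?]] /andP[? ?].
  have rE : re (p t) = (1 - t) * re w + t * re w' by rewrite /p reD reM reD reN /=; ring.
  have iE : im (p t) = (1 - t) * im w + t * im w' by rewrite /p imD imM imD imN /=; ring.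
  by rewrite /in_rect_open rE iE !seg_lt ?seg_gt// !andbT; split.
pose G t := oint (fun z => (z - p t)^-1) a b c d.
have : nc (G 1 - G 0) <= 0 * (1 - 0).
  apply: mvt => // t e ht e0; rewrite add0r.
  have hp := pin t ht; have [eta eta0 he] := onb_dist hp.
  pose D := nc (w' - w) + 1; have D0 : 0 < D by rewrite /D ltr_wpDl ?nc_ge0.
  pose S := 4 * eta^-1 ^+ 3 * ((b - a) + (d - c)).
  have S0 : 0 <= S by rewrite /S mulr_ge0 ?mulr_ge0 ?exprn_ge0 ?invr_ge0//; lra.
  exists (Num.min (eta / D) (e / (D ^+ 2 * S + 1))).
    by rewrite lt_min !divr_gt0// ltr_wpDl// mulr_ge0// exprn_ge0// ltW.
  move=> y hy; rewrite lt_min ltr_pdivlMr// ltr_pdivlMr; last first.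
    by rewrite ltr_wpDl// mulr_ge0// exprn_ge0// ltW.
  move=> /andP[y1 y2]; set h := p y - p t.
  have hE : h = (y - t)%:C%C * (w' - w) by rewrite /h /p rmorphB; ring.
  have hn : nc h <= `|y - t| * D.
    by rewrite hE ncM nc_real ler_wpM2l// /D lerDl.
  have hny : nc (p y - p t) < eta by apply: le_lt_trans hn _.
  have py := pin y hy.
  have c1 := cob_inv hp; have c2 := cob_inv py.
  have z1 : oint (fun z => (z - p t)^-1 ^+ 2) a b c d = 0.
    apply: (@oint_der _ _ _ _ _ ab cd (fun z => - (z - p t)^-1)).
      by move=> z hz; apply: contX; exact: c1.
    move=> z hz; have zn := onb_neq hp hz.
    have zn' : z - p t != 0 by rewrite subr_eq0.
    have k := cderD (cder_id z) (cder_cst (- p t) z).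
    have := cderN (@cderV _ (fun y => y - p t) z _ zn' k); rewrite addr0 mulN1r opprK exprVn.
    exact.
  have cc : cob (fun z => (z - p t)^-1 ^+ 2 * (z - p y)^-1) a b c d.
    by apply: cobM => // z hz; apply: contX; exact: c1.
  have -> : G y - G t = h ^+ 2 * oint (fun z => (z - p t)^-1 ^+ 2 * (z - p y)^-1) a b c d.
    have -> : G y = oint (fun z => (z - p t)^-1 + (h * (z - p t)^-1 ^+ 2 +
       h ^+ 2 * ((z - p t)^-1 ^+ 2 * (z - p y)^-1))) a b c d.
      apply: oint_ext => z hz; have z1' := onb_neq hp hz; have z2' := onb_neq py hz.
      by rewrite /h; field; rewrite !subr_eq0 z1' z2'.
    rewrite ointD//; last first.
      move=> z hz; apply: contD; apply: contM; try exact: cont_cst; last exact: cc.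
      by apply: contX; exact: c1.
    rewrite ointD//; last first.
    - by move=> z hz; apply: contM; [exact: cont_cst|exact: cc].
    - by move=> z hz; apply: contM; [exact: cont_cst|apply: contX; exact: c1].
    rewrite !ointZ// ?z1; last by move=> z hz; apply: contX; exact: c1.
    by rewrite /G; ring.
  have B : nc (oint (fun z => (z - p t)^-1 ^+ 2 * (z - p y)^-1) a b c d) <= S.
    apply: oint_bound => // z hz.
    have q1 : eta <= nc (z - p t) by apply: he; rewrite // subrr nc0.
    have q2 : eta <= nc (z - p y) by apply: he.
    rewrite ncM ncX !ncV (exprSr _ 2); apply: ler_pM; rewrite ?exprn_ge0 ?invr_ge0 ?nc_ge0//.
      apply: lerXn2r; rewrite ?nnegrE ?invr_ge0 ?nc_ge0//; first exact: ltW.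
      by rewrite lef_pV2// posrE (lt_le_trans eta0).
    by rewrite lef_pV2// posrE (lt_le_trans eta0).
  rewrite ncM ncX; apply: le_trans (ler_wpM2l _ B) _; first by rewrite exprn_ge0 ?nc_ge0.
  apply: (@le_trans _ _ ((`|y - t| * D) ^+ 2 * S)).
    by rewrite ler_wpM2r// lerXn2r// nnegrE ?nc_ge0// mulr_ge0// ltW.
  have n0 := normr_ge0 (y - t).
  rewrite (_ : (_ * D) ^+ 2 * S = `|y - t| * (D ^+ 2 * S) * `|y - t|); last by ring.
  by rewrite ler_wpM2r//; nra.
rewrite mul0r => hl; have /eqP := le_anti (introT andP (conj hl (nc_ge0 _))).
rewrite nc_eq0 subr_eq0 /G /p rmorph1 rmorph0 mul1r mul0r addr0 subrKC => /eqP ->.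
by [].
Qed.

Lemma im_inv (z : C) : im z^-1 = - im z / nc z ^+ 2.
Proof.
by case: z => x y; rewrite /nc /= sqr_sqrtr ?addr_ge0 ?sqr_ge0// mulNr.
Qed.
Lemma re_inv (z : C) : re z^-1 = re z / nc z ^+ 2.
Proof. by case: z => x y; rewrite /nc /= sqr_sqrtr ?addr_ge0 ?sqr_ge0. Qed.

(** In the imaginary part each of the four sides contributes a positive amount, because [w] lies
    strictly inside. *)
Lemma oint_inv_neq0 a b c d w : in_rect_open a b c d w ->
  oint (fun z => (z - w)^-1) a b c d != 0.
Proof.
move=> hw; have [ab cd] := inro_lt hw; have ci := cob_inv hw.
case: (hw) => /andP[h1 h2] /andP[h3 h4].
have [ab' cd'] := (ltW ab, ltW cd).
pose S := (b - a) + (d - c); have S0 : 0 < S by rewrite /S; lra.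
have bnd z : on_rect a b c d z -> 0 < nc (z - w) <= S.
  move=> hz; rewrite nc_gt0 subr_eq0 (onb_neq hw hz) /=.
  have [k1 k2] := onb_inr ab' cd' hz.
  apply: le_trans (nc_le _) _; rewrite reD imD reN imN.
  by rewrite /S; apply: lerD; rewrite ler_norml; lra.
have low x z : on_rect a b c d z -> 0 < x -> x / S ^+ 2 <= x / nc (z - w) ^+ 2.
  move=> /bnd /andP[n0 nS] x0; rewrite ler_pM2l// lef_pV2 ?posrE ?exprn_gt0//.
  by rewrite lerXn2r// nnegrE// ltW.
suff : 0 < im (oint (fun z => (z - w)^-1) a b c d).
  by move=> h; apply/eqP => E; move: h; rewrite E ltxx.
rewrite /oint !imD !imN !imM /= !mul0r !mul1r !add0r.
have q1 : (im w - c) / S ^+ 2 * (b - a) <= im (J (fun x => (Complex x c - w)^-1) a b).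
  apply: J_im_ge => //; first exact: cob_b ci.
  move=> t ht; have hz : on_rect a b c d (Complex t c) by right; split=> //; left.
  by rewrite im_inv imD imN /= opprB; apply: low => //; lra.
have q2 : (d - im w) / S ^+ 2 * (b - a) <= im (J (fun x => - (Complex x d - w)^-1) a b).
  apply: J_im_ge => //; first by move=> t ht; apply: contN; exact: (cob_t cd' ci).
  move=> t ht; have hz : on_rect a b c d (Complex t d) by right; split=> //; right.
  by rewrite imN im_inv imD imN /= mulNr opprK; apply: low => //; lra.
have q3 : (b - re w) / S ^+ 2 * (d - c) <= re (J (fun x => (Complex b x - w)^-1) c d).
  apply: J_re_ge => //; first exact: cob_r ci.
  move=> t ht; have hz : on_rect a b c d (Complex b t) by left; split=> //; right.
  by rewrite re_inv reD reN /=; apply: low => //; lra.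
have q4 : (re w - a) / S ^+ 2 * (d - c) <= re (J (fun x => - (Complex a x - w)^-1) c d).
  apply: J_re_ge => //; first by move=> t ht; apply: contN; exact: (cob_l ab' ci).
  move=> t ht; have hz : on_rect a b c d (Complex a t) by left; split=> //; left.
  by rewrite reN re_inv reD reN /= -mulNr opprB; apply: low => //; lra.
have N1 (h : R -> C) x y : con h x y -> J (fun t => - h t) x y = - J h x y.
  move=> ch; rewrite -[RHS]mulN1r -J_Z//.
  by congr (J _ x y); apply/funext => t; rewrite mulN1r.
rewrite N1 ?imN in q2; last exact: cob_t ci.
rewrite N1 ?reN in q4; last exact: cob_l ci.
have S2 : 0 < S ^+ 2 by rewrite exprn_gt0.
have p1 : 0 < (im w - c) / S ^+ 2 * (b - a) by rewrite mulr_gt0 ?divr_gt0 ?subr_gt0 ?exprn_gt0//; lra.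
have p2 : 0 < (d - im w) / S ^+ 2 * (b - a) by rewrite mulr_gt0 ?divr_gt0 ?subr_gt0 ?exprn_gt0//; lra.
have p3 : 0 < (b - re w) / S ^+ 2 * (d - c) by rewrite mulr_gt0 ?divr_gt0 ?subr_gt0 ?exprn_gt0//; lra.
have p4 : 0 < (re w - a) / S ^+ 2 * (d - c) by rewrite mulr_gt0 ?divr_gt0 ?subr_gt0 ?exprn_gt0//; lra.
move: (lt_le_trans p1 q1) (lt_le_trans p2 q2) (lt_le_trans p3 q3) (lt_le_trans p4 q4).
by clear; rewrite /J /=; lra.
Qed.

(* plays the role of 2 pi i, whose value is never needed *)
Definition cK a b c d : C :=
  oint (fun z => (z - Complex ((a + b) / 2) ((c + d) / 2))^-1) a b c d.

Lemma cK_neq0 a b c d : a < b -> c < d -> cK a b c d != 0.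
Proof. by move=> ab cd; apply: oint_inv_neq0; split=> /=; lra. Qed.

Lemma cauchy_formula f a b c d w : in_rect_open a b c d w -> (forall z, in_rect a b c d z -> cdiff f z) ->
  oint (fun z => f z / (z - w)) a b c d = cK a b c d * f w.
Proof.
move=> hw df; rewrite cauchy_pre// mulrC; congr (_ * _).
by apply: oint_inv_const => //; have [ab cd] := inro_lt hw; split=> /=; lra.
Qed.

End Cauchy.
Arguments cK : simpl never.

(** * Integrals depending on a parameter *)

Section ParamIntegral.
Context {R : realType}.
Local Notation C := R[i].

(** Tube lemma, with bisection of the interval in place of a finite subcover. *)
Lemma tube (A : met) (x0 : A) (a b : R) (Q : A -> R -> Prop) : a <= b ->
  (forall t, a <= t <= b -> nr ((x0, t) : metP A metR) (fun p => Q p.1 p.2)) ->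
  nr x0 (fun x => forall t, a <= t <= b -> Q x t).
Proof.
move=> ab h.
apply: (bisect1 (P := fun y z => nr x0 (fun x => forall t, y <= t <= z -> Q x t))) ab _ _.
  move=> x m y _ _ _; apply: nrW2 => u h1 h2 t /andP[xt ty].
  have [tm|/ltW mt] := leP t m; first by apply: h1; rewrite xt.
  by apply: h2; rewrite mt.
move=> t ht; have [r r0 hr] := h t ht; exists r => // y z _ _ yz zy; exists r => // x hx s hs.
by apply: (hr (x, s)); rewrite /= gt_max hx /= ltr_norml; lra.
Qed.

Definition jcont (A B : met) (g : A -> B -> C) (x : A) (t : B) :=
  cont (fun p : metP A B => g p.1 p.2) ((x, t) : metP A B).

Lemma jcont_comp (A B D : met) (g : A -> B -> C) (h : D -> A) (k : D -> B) (x : D) :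
  jcont g (h x) (k x) -> cont h x -> cont k x -> cont (fun y => g (h y) (k y)) x.
Proof.
move=> cg ch ck; have := cont_pair ch ck => cp.
exact: (cont_comp (f := fun y => (h y, k y) : metP A B) cp cg).
Qed.
Lemma jcont_fst (A B : met) (g : A -> B -> C) (x : A) (t : B) :
  jcont g x t -> cont (fun y => g y t) x.
Proof. by move=> h; apply: jcont_comp h _ _; [exact: cont_id|exact: cont_cst]. Qed.
Lemma jcont_snd (A B : met) (g : A -> B -> C) (x : A) (t : B) :
  jcont g x t -> cont (fun s => g x s) t.
Proof. by move=> h; apply: jcont_comp h _ _; [exact: cont_cst|exact: cont_id]. Qed.

Lemma J_B f g a b : con f a b -> con g a b ->
  J (fun t => f t - g t) a b = J f a b - J g a b :> C.
Proof.
move=> hf hg; rewrite -[- J g a b]mulN1r -J_Z// -J_D//; last by apply: conM => //; exact: con_cst.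
by apply: J_ext => t _; rewrite mulN1r.
Qed.

Lemma J_cont (A : met) (g : A -> R -> C) (x0 : A) a b : a <= b ->
  (forall t, a <= t <= b -> jcont g x0 t) -> nr x0 (fun x => con (g x) a b) ->
  cont (fun x => J (g x) a b) x0.
Proof.
move=> ab jg cg e e0.
pose e' := e / (4 * (b - a + 1)).
have e'0 : 0 < e' by rewrite divr_gt0//; lra.
have e'2 : 0 < e' / 2 by lra.
have cg0 : con (g x0) a b := nr_at cg.
have T : nr x0 (fun x => forall t, a <= t <= b -> nc (g x t - g x0 t) < e').
  apply: tube ab _ => t ht.
  have cs : cont (fun p : metP A metR => g x0 p.2) ((x0, t) : metP A metR).
    apply: (cont_comp (g := g x0) (cont_snd _)); exact: cg0.
  apply: nrW2 (jg t ht _ e'2) (cs _ e'2) => -[x s] /= h1 h2.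
  have := nc_tri (g x0 t) (g x0 s) (g x s); rewrite (ncB (g x0 t)); lra.
apply: nrW2 cg T => x cx hx; rewrite distCE -J_B//.
apply: (@le_lt_trans _ _ (2 * e' * (b - a))).
  apply: J_bound => //; first by move=> t ht; apply: contB; [exact: cx|exact: cg0].
  by move=> t ht; apply: ltW; exact: hx.
have : e' * (4 * (b - a + 1)) = e by rewrite /e' divfK//; lra.
nra.
Qed.

Lemma inro_open a b c d (w : C) : in_rect_open a b c d w -> nr w (in_rect_open a b c d).
Proof.
move=> [/andP[h1 h2] /andP[h3 h4]].
pose m := Num.min (Num.min (re w - a) (b - re w)) (Num.min (im w - c) (d - im w)).
have m0 : 0 < m by rewrite !lt_min; lra.
exists m => // z; rewrite distCE => hz.
have := le_lt_trans (Re_le_nc _) hz; have := le_lt_trans (Im_le_nc _) hz.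
rewrite /m !lt_min reD imD reN imN !ltr_norml.
by move=> /andP[/andP[/andP[? ?] /andP[? ?]] /andP[/andP[? ?] /andP[? ?]]] ?; split; lra.
Qed.
Lemma inro_inr a b c d (w : C) : in_rect_open a b c d w -> in_rect a b c d w.
Proof. by move=> [? ?]; split; lra. Qed.

(** First-order Taylor estimate in which [eta] and [B] depend on the rectangle and [s0] but not on
    [f]. This uniformity is what differentiation under the integral sign needs. *)
Lemma cauchy_quad a b c d (s0 : C) : in_rect_open a b c d s0 ->
  exists2 eta, 0 < eta & exists2 B, 0 <= B & forall f M,
  (forall z, in_rect a b c d z -> cdiff f z) -> (forall z, on_rect a b c d z -> nc (f z) <= M) ->
  forall s, nc (s - s0) < eta ->
  nc (f s - f s0 - (cK a b c d)^-1 * oint (fun z => f z * (z - s0)^-1 ^+ 2) a b c d * (s - s0))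
    <= B * M * nc (s - s0) ^+ 2.
Proof.
move=> hs0; have [eta eta0 he] := onb_dist hs0; have [r r0 hr] := inro_open hs0.
have [ab cd] := inro_lt hs0; have [ab' cd'] := (ltW ab, ltW cd).
have K0 := cK_neq0 ab cd.
exists (Num.min eta r); first by rewrite lt_min eta0.
pose S := (b - a) + (d - c); have S0 : 0 < S by rewrite /S; lra.
exists ((nc (cK a b c d))^-1 * (4 * eta^-1 ^+ 3 * S)).
  by rewrite !mulr_ge0 ?exprn_ge0 ?invr_ge0 ?nc_ge0// ltW.
move=> f M df hM s; rewrite lt_min => /andP[h1 h2].
have hs : in_rect_open a b c d s by apply: hr; rewrite distCE.
have cf : cob f a b c d by apply: inr_cob => // z hz; apply: cdiff_cont; exact: df.
have c1 := cob_inv hs0; have c2 := cob_inv hs.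
have c12 : cob (fun z => (z - s0)^-1 ^+ 2) a b c d by move=> z hz; apply: contX; exact: c1.
have c3 := cobM c12 c2.
have E : oint (fun z => f z / (z - s)) a b c d =
    oint (fun z => f z / (z - s0)) a b c d +
    ((s - s0) * oint (fun z => f z * (z - s0)^-1 ^+ 2) a b c d +
    (s - s0) ^+ 2 * oint (fun z => f z * ((z - s0)^-1 ^+ 2 * (z - s)^-1)) a b c d).
  have i1 := cobM cf c1; have i2 := cobM cf c12; have i3 := cobM cf c3.
  have k u g : cob g a b c d -> cob (fun z => u * g z) a b c d.
    by move=> cg; apply: cobM cg => z _; exact: cont_cst.
  have i4 : cob (fun z => (s - s0) * (f z * (z - s0)^-1 ^+ 2) +
      (s - s0) ^+ 2 * (f z * ((z - s0)^-1 ^+ 2 * (z - s)^-1))) a b c d.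
    by move=> z hz; apply: contD; [exact: (k _ _ i2)|exact: (k _ _ i3)].
  have e1 := etrans (ointD ab' cd' (k (s - s0) _ i2) (k ((s - s0) ^+ 2) _ i3))
    (congr2 +%R (ointZ ab' cd' (s - s0) i2) (ointZ ab' cd' ((s - s0) ^+ 2) i3)).
  apply: etrans (etrans (ointD ab' cd' i1 i4) (congr2 +%R erefl e1)).
  apply: oint_ext => z hz; have z1 := onb_neq hs0 hz; have z2 := onb_neq hs hz.
  by field; rewrite !subr_eq0 z1 z2.
have {}E : f s - f s0 - (cK a b c d)^-1 * oint (fun z => f z * (z - s0)^-1 ^+ 2) a b c d * (s - s0)
    = (cK a b c d)^-1 * ((s - s0) ^+ 2 * oint (fun z => f z * ((z - s0)^-1 ^+ 2 * (z - s)^-1)) a b c d).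
  move: E; rewrite (cauchy_formula hs df) (cauchy_formula hs0 df).
  set X := oint _ a b c d; set Y := oint _ a b c d => E.
  have -> : (s - s0) ^+ 2 * Y = cK a b c d * f s - cK a b c d * f s0 - (s - s0) * X.
    by rewrite E; ring.
  by field.
rewrite E ncM ncV ncM ncX.
have M0 : 0 <= M.
  apply: le_trans (hM (Complex a c) _); first exact: nc_ge0.
  by left; split; [left|rewrite /= lexx].
have B : nc (oint (fun z => f z * ((z - s0)^-1 ^+ 2 * (z - s)^-1)) a b c d)
     <= 4 * (M * eta^-1 ^+ 3) * S.
  apply: oint_bound => //; first exact: cobM.
  move=> z hz.
  have q1 : eta <= nc (z - s0) by apply: he; rewrite // subrr nc0.
  have q2 : eta <= nc (z - s) by apply: he.
  rewrite ncM ncM ncX !ncV (exprSr _ 2); apply: ler_pM; rewrite ?mulr_ge0 ?exprn_ge0 ?invr_ge0 ?nc_ge0 ?hM//.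
  apply: ler_pM; rewrite ?exprn_ge0 ?invr_ge0 ?nc_ge0//.
    apply: lerXn2r; rewrite ?nnegrE ?invr_ge0 ?nc_ge0//; first exact: ltW.
    by rewrite lef_pV2// posrE (lt_le_trans eta0).
  by rewrite lef_pV2// posrE (lt_le_trans eta0).
rewrite [leRHS](_ : _ = (nc (cK a b c d))^-1 * (nc (s - s0) ^+ 2 * (4 * (M * eta^-1 ^+ 3) * S)));
  last by ring.
by rewrite ler_wpM2l ?invr_ge0 ?nc_ge0// ler_wpM2l ?exprn_ge0 ?nc_ge0.
Qed.

Lemma quad_cder f (s0 d : C) eta B : 0 < eta -> 0 <= B ->
  (forall s, nc (s - s0) < eta -> nc (f s - f s0 - d * (s - s0)) <= B * nc (s - s0) ^+ 2) ->
  cder f s0 d.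
Proof.
move=> eta0 B0 h; apply: eps_cder => e e0.
have p0 : 0 < e / (B + 1) by rewrite divr_gt0// ltr_wpDl.
exists (Num.min eta (e / (B + 1))); first by rewrite lt_min eta0.
move=> s; rewrite distCE lt_min ltr_pdivlMr ?ltr_wpDl// => /andP[h1 h2].
apply: le_trans (h s h1) _; rewrite expr2 mulrA ler_wpM2r ?nc_ge0//.
by have := nc_ge0 (s - s0); nra.
Qed.

Lemma square_in (z0 z : C) q : 0 <= q ->
  in_rect (re z0 - q) (re z0 + q) (im z0 - q) (im z0 + q) z -> nc (z - z0) <= 2 * q.
Proof.
move=> q0 [h1 h2]; apply: le_trans (nc_le _) _; rewrite reD imD reN imN.
have : `|re z - re z0| <= q by rewrite ler_norml; lra.
have : `|im z - im z0| <= q by rewrite ler_norml; lra.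
lra.
Qed.

Lemma clamp_lip (a b t y : R) :
  `|Num.max a (Num.min b y) - Num.max a (Num.min b t)| <= `|y - t|.
Proof.
have H (u v w : R) : `|Num.max w u - Num.max w v| <= `|u - v|.
  rewrite !maxEle; have := ler_norm (u - v); have := ler_norm (- (u - v)); rewrite normrN.
  move=> h1 h2; have h3 := normr_ge0 (u - v).
  by case: (leP w u) => ?; case: (leP w v) => ?; rewrite ler_norml; apply/andP; split; lra.
have H' (u v w : R) : `|Num.min w u - Num.min w v| <= `|u - v|.
  rewrite !minEle; have := ler_norm (u - v); have := ler_norm (- (u - v)); rewrite normrN.
  move=> h1 h2; have h3 := normr_ge0 (u - v).
  by case: (leP w u) => ?; case: (leP w v) => ?; rewrite ler_norml; apply/andP; split; lra.
exact: le_trans (H _ _ _) (H' _ _ _).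
Qed.

(** On a small square around [s0] the functions [g^~ t] are bounded uniformly in [t], so
    [cauchy_quad] bounds their first-order remainders uniformly and the integral of the derivatives
    is the derivative of the integral. *)
Lemma J_cdiff (g : C -> R -> C) (s0 : C) a b : a <= b ->
  nr s0 (fun s => forall t, a <= t <= b -> cdiff (g^~ t) s /\ jcont g s t) ->
  cdiff (fun s => J (g s) a b) s0.
Proof.
move=> ab hg; have g0 := nr_at hg.
have cg0 : con (g s0) a b by move=> t ht; apply: jcont_snd (proj2 (g0 t ht)).
have [M0 hM0] := cont_bounded ab cg0.
have T : nr s0 (fun s => forall t, a <= t <= b -> nc (g s t) <= M0 + 1).
  apply: tube ab _ => t ht; have [_ jt] := g0 t ht.
  by apply: nrW (cont_bound jt) => p; have /= := hM0 t ht; lra.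
have [r r0 hr] := nrI hg T.
pose q := r / 4; have q0 : 0 < q by rewrite /q; lra.
pose a1 := re s0 - q; pose b1 := re s0 + q; pose c1 := im s0 - q; pose d1 := im s0 + q.
have hs0 : in_rect_open a1 b1 c1 d1 s0 by rewrite /a1 /b1 /c1 /d1; split; lra.
have [[/ltW ab1 /ltW cd1]] := (inro_lt hs0).
have sub z : in_rect a1 b1 c1 d1 z -> dist s0 z < r.
  by move=> /(square_in (ltW q0)); rewrite distCE /q; lra.
have [eta eta0 [B B0 hB]] := cauchy_quad hs0.
pose g' t := (cK a1 b1 c1 d1)^-1 * oint (fun z => g z t * (z - s0)^-1 ^+ 2) a1 b1 c1 d1.
pose B1 := B * (M0 + 1).
have M1 : 0 <= M0 + 1 by have := hM0 a; rewrite lexx ab => /(_ isT); have := nc_ge0 (g s0 a); lra.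
have B10 : 0 <= B1 by rewrite mulr_ge0.
have key t s : a <= t <= b -> nc (s - s0) < eta ->
    nc (g s t - g s0 t - g' t * (s - s0)) <= B1 * nc (s - s0) ^+ 2.
  move=> ht hs; apply: (hB (g^~ t)) => // z.
    by move=> /sub /hr [/(_ t ht)[]].
  by move=> hz; have /sub/hr [_ /(_ t ht)] := onb_inr ab1 cd1 hz.
(* [con] asks for two-sided continuity at the endpoints, while [g'] is controlled only on [[a, b]];
   clamping extends it by constants. *)
pose cl t := Num.max a (Num.min b t).
have cl_in t : a <= cl t <= b by rewrite /cl le_max lexx /= ge_max ab ge_min lexx.
have cl_id t : a <= t <= b -> cl t = t.
  by move=> /andP[h1 h2]; rewrite /cl (min_idPr h2) (max_idPr h1).
have cl_cont t : cont cl t.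
  by move=> e e0; exists e => // y; rewrite !distRE; apply: le_lt_trans; exact: clamp_lip.
pose g2 t := g' (cl t).
have cg' : con g2 a b.
  move=> t _ e e0; have ht := cl_in t.
  (* With this step the difference quotient [Q] is within [e / 4] of [g'] for all [t] at once; [Q]
     is continuous, so the values of [g'] at nearby points are within [e]. *)
  pose dl := Num.min (Num.min (eta / 2) (r / 2)) (e / (4 * (B1 + 1))).
  have dl0 : 0 < dl by rewrite !lt_min !divr_gt0// mulr_gt0// ltr_wpDl.
  pose s1 := s0 + dl%:C%C.
  have s1E : s1 - s0 = dl%:C%C by rewrite /s1 addrC addKr.
  have n1 : nc (s1 - s0) = dl by rewrite s1E nc_real gtr0_norm.
  have le1 : dl <= eta / 2 by rewrite /dl !ge_min lexx.
  have le2 : dl <= r / 2 by rewrite /dl !ge_min lexx orbT.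
  have le3 : dl * (4 * (B1 + 1)) <= e.
    by rewrite -ler_pdivlMr ?mulr_gt0 ?ltr_wpDl// /dl !ge_min lexx !orbT.
  have n0 : s1 - s0 != 0 by rewrite -nc_gt0 n1.
  pose Q t := (g s1 t - g s0 t) / (s1 - s0).
  have qd u : a <= u <= b -> nc (Q u - g' u) <= e / 4.
    move=> hu; have := key u s1 hu; rewrite n1 => /(_ ltac:(lra)).
    have -> : g s1 u - g s0 u - g' u * (s1 - s0) = (Q u - g' u) * (s1 - s0).
      by rewrite /Q mulrBl divfK.
    rewrite ncM n1 expr2 mulrA ler_pM2r//; nra.
  have cQ : cont Q (cl t).
    apply: contM; last exact: cont_cst.
    have [/(_ _ ht) [_ j1] _] : (forall t, a <= t <= b -> cdiff (g^~ t) s1 /\ jcont g s1 t) /\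
       (forall t, a <= t <= b -> nc (g s1 t) <= M0 + 1) by apply: hr; rewrite distCE n1; lra.
    by apply: contB; [exact: jcont_snd j1|exact: cg0].
  have e4 : 0 < e / 4 by lra.
  apply: nrW (cont_comp (g := Q) (cl_cont t) cQ e4) => y; rewrite !distCE => hy.
  have := qd _ (cl_in y); have := qd _ (cl_in t); rewrite /g2.
  have := nc_tri (Q (cl t)) (g' (cl t)) (g' (cl y)).
  have := nc_tri (Q (cl y)) (Q (cl t)) (g' (cl y)).
  rewrite (ncB (g' (cl y)) (Q (cl y))); lra.
exists (J g2 a b); apply: (@quad_cder _ _ _ (Num.min eta r) (2 * B1 * (b - a))).
- by rewrite lt_min eta0.
- by rewrite !mulr_ge0// subr_ge0.
move=> s; rewrite lt_min => /andP[h1 h2].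
have [hgs _] : (forall t, a <= t <= b -> cdiff (g^~ t) s /\ jcont g s t) /\
       (forall t, a <= t <= b -> nc (g s t) <= M0 + 1) by apply: hr.
have cgs : con (g s) a b by move=> t ht; apply: jcont_snd (proj2 (hgs t ht)).
have cz : con (fun t => (s - s0) * g2 t) a b by apply: conM => //; exact: con_cst.
rewrite mulrC -J_Z// -J_B// -J_B//; last by move=> t ht; apply: contB; [exact: cgs|exact: cg0].
rewrite (_ : 2 * B1 * (b - a) * _ = 2 * (B1 * nc (s - s0) ^+ 2) * (b - a)); last by ring.
apply: J_bound => //.
  by move=> t ht; apply: contB; [apply: contB; [exact: cgs|exact: cg0]|exact: cz].
by move=> t ht; rewrite /g2 cl_id// mulrC; apply: key.
Qed.

Section Edges.
Variables (a b c d : R).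
Hypotheses (ab : a <= b) (cd : c <= d).

Lemma oint_cont (A : met) (g : A -> C -> C) (x0 : A) :
  nr x0 (fun x => forall z, on_rect a b c d z -> jcont g x z) ->
  cont (fun x => oint (g x) a b c d) x0.
Proof.
move=> h; have h0 := nr_at h; rewrite /oint.
have H y : (forall x, a <= x <= b -> on_rect a b c d (Complex x y)) ->
    cont (fun x => J (fun t => g x (Complex t y)) a b) x0.
  move=> hy; apply: J_cont ab _ _.
    move=> t /hy/h0 j; apply: (jcont_comp (h := fun p : metP A metR => p.1) (k := fun p => Complex p.2 y) (x := (x0, t)) j).
      exact: cont_fst.
    exact: (cont_comp (g := fun t => Complex t y) (cont_snd _) (cont_h _ _)).
  apply: nrW h => x hx t /hy/hx/jcont_snd j.
  by apply: (cont_comp (g := g x) (cont_h y t)).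
have V y : (forall x, c <= x <= d -> on_rect a b c d (Complex y x)) ->
    cont (fun x => J (fun t => g x (Complex y t)) c d) x0.
  move=> hy; apply: J_cont cd _ _.
    move=> t /hy/h0 j; apply: (jcont_comp (h := fun p : metP A metR => p.1) (k := fun p => Complex y p.2) (x := (x0, t)) j).
      exact: cont_fst.
    exact: (cont_comp (g := fun t => Complex y t) (cont_snd _) (cont_v _ _)).
  apply: nrW h => x hx t /hy/hx/jcont_snd j.
  by apply: (cont_comp (g := g x) (cont_v y t)).
apply: contB; [apply: contB; [apply: contD|]|].
- by apply: H => x hx; right; split=> //; left.
- by apply: contM; [exact: cont_cst|apply: V => x hx; left; split=> //; right].
- by apply: H => x hx; right; split=> //; right.
- by apply: contM; [exact: cont_cst|apply: V => x hx; left; split=> //; left].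
Qed.

Lemma oint_cdiff (g : C -> C -> C) (s0 : C) :
  nr s0 (fun s => forall z, on_rect a b c d z -> cdiff (g^~ z) s /\ jcont g s z) ->
  cdiff (fun s => oint (g s) a b c d) s0.
Proof.
move=> h; rewrite /oint.
have H y : (forall x, a <= x <= b -> on_rect a b c d (Complex x y)) ->
    cdiff (fun x => J (fun t => g x (Complex t y)) a b) s0.
  move=> hy; apply: J_cdiff ab _; apply: nrW h => x hx t /hy/hx [dg j]; split=> //.
  apply: (jcont_comp (h := fun p : metP metC metR => p.1) (k := fun p => Complex p.2 y) (x := (x, t)) j).
    exact: cont_fst.
  exact: (cont_comp (g := fun t => Complex t y) (cont_snd _) (cont_h _ _)).
have V y : (forall x, c <= x <= d -> on_rect a b c d (Complex y x)) ->
    cdiff (fun x => J (fun t => g x (Complex y t)) c d) s0.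
  move=> hy; apply: J_cdiff cd _; apply: nrW h => x hx t /hy/hx [dg j]; split=> //.
  apply: (jcont_comp (h := fun p : metP metC metR => p.1) (k := fun p => Complex y p.2) (x := (x, t)) j).
    exact: cont_fst.
  exact: (cont_comp (g := fun t => Complex y t) (cont_snd _) (cont_v _ _)).
apply: cdiffB; [apply: cdiffB; [apply: cdiffD|]|].
- by apply: H => x hx; right; split=> //; left.
- by apply: cdiffM; [exact: cdiff_cst|apply: V => x hx; left; split=> //; right].
- by apply: H => x hx; right; split=> //; right.
- by apply: cdiffM; [exact: cdiff_cst|apply: V => x hx; left; split=> //; left].
Qed.
End Edges.

End ParamIntegral.

(** * Division by zeros, maximum principle, isolated zeros *)

Section OneVariable.
Context {R : realType}.
Local Notation C := R[i].
Implicit Types (f g u : C -> C) (z w a : C) (r : R).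

Definition sq z0 r := in_rect (re z0 - r) (re z0 + r) (im z0 - r) (im z0 + r).
Definition sqo z0 r := in_rect_open (re z0 - r) (re z0 + r) (im z0 - r) (im z0 + r).
Definition sqb z0 r := on_rect (re z0 - r) (re z0 + r) (im z0 - r) (im z0 + r).
Definition oq f z0 r := oint f (re z0 - r) (re z0 + r) (im z0 - r) (im z0 + r).
Definition kq z0 r : C := cK (re z0 - r) (re z0 + r) (im z0 - r) (im z0 + r).

Lemma sq_nc z0 r z : 0 <= r -> sq z0 r z -> nc (z - z0) <= 2 * r.
Proof. exact: square_in. Qed.
Lemma nc_sqo z0 r z : nc (z - z0) < r -> sqo z0 r z.
Proof.
move=> h; have := le_lt_trans (Re_le_nc _) h; have := le_lt_trans (Im_le_nc _) h.
by rewrite !ltr_norml reD imD reN imN => ? ?; split; lra.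
Qed.
Lemma sqo_sq z0 r z : sqo z0 r z -> sq z0 r z. Proof. exact: inro_inr. Qed.
Lemma sqb_sq z0 r z : 0 <= r -> sqb z0 r z -> sq z0 r z.
Proof. by move=> r0; apply: onb_inr; lra. Qed.
Lemma sqo0 z0 r : 0 < r -> sqo z0 r z0. Proof. by move=> r0; split; lra. Qed.
Lemma sqb_ge z0 r z : sqb z0 r z -> r <= nc (z - z0).
Proof.
have hr := Re_le_nc (z - z0); have hi := Im_le_nc (z - z0).
move: hr hi; rewrite reD imD reN imN !ler_norml => /andP[? ?] /andP[? ?].
by move=> [[[|] E _]|[[|] E _]]; lra.
Qed.
Lemma kq_neq0 z0 r : 0 < r -> kq z0 r != 0.
Proof. by move=> r0; apply: cK_neq0; lra. Qed.
Lemma sq_cob f z0 r : 0 <= r -> (forall z, sq z0 r z -> cdiff f z) ->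
  cob f (re z0 - r) (re z0 + r) (im z0 - r) (im z0 + r).
Proof. by move=> r0 h z /(sqb_sq r0) /h /cdiff_cont. Qed.
Lemma sq_bounded f z0 r : 0 <= r -> (forall z, sq z0 r z -> cdiff f z) ->
  exists2 M, 0 <= M & forall z, sqb z0 r z -> nc (f z) <= M.
Proof.
move=> r0 df; have h1 : re z0 - r <= re z0 + r by lra.
have h2 : im z0 - r <= im z0 + r by lra.
have [M hM] := cob_bounded h1 h2 (sq_cob r0 df); exists M => //.
apply: le_trans (hM (Complex (re z0 - r) (im z0 - r)) _); first exact: nc_ge0.
by left; split; [left|rewrite /= lexx].
Qed.
Lemma sqo_or_sqb z0 r z : sq z0 r z -> sqo z0 r z \/ sqb z0 r z.
Proof.
move=> [/andP[h1 h2] /andP[h3 h4]]; rewrite /sqo /sqb /in_rect_open /on_rect h1 h2 h3 h4.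
have [->|n1] := eqVneq (re z) (re z0 - r); first by right; left; split=> //; left.
have [->|n2] := eqVneq (re z) (re z0 + r); first by right; left; split=> //; right.
have [->|n3] := eqVneq (im z) (im z0 - r); first by right; right; split=> //; left.
have [->|n4] := eqVneq (im z) (im z0 + r); first by right; right; split=> //; right.
by left; rewrite !lt_neqAle h1 h2 h3 h4 n2 n4 eq_sym n1 eq_sym n3.
Qed.

Lemma cont_sndf (A B D : @met R) (h : B -> D) (x : metP A B) :
  cont h x.2 -> cont (fun p : metP A B => h p.2) x.
Proof. by move=> ch; apply: (cont_comp (g := h)) ch; exact: cont_snd. Qed.
Lemma cont_fstf (A B D : @met R) (h : A -> D) (x : metP A B) :
  cont h x.1 -> cont (fun p : metP A B => h p.1) x.
Proof. by move=> ch; apply: (cont_comp (g := h)) ch; exact: cont_fst. Qed.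

Lemma jcont_kernel f z w (n : nat) : cont f z -> z != w ->
  jcont (fun s y : C => f y * (y - s)^-1 ^+ n) w z.
Proof.
move=> cf zw; rewrite /jcont; apply: contM; first exact: cont_sndf.
apply: contX; apply: contV; first by rewrite subr_eq0.
by apply: contB; [exact: cont_snd|exact: cont_fst].
Qed.

(** The density need only be continuous on the contour, so holomorphic functions can be manufactured
    from boundary values alone. *)
Lemma cauchy_cdiff f (a b c d : R) w (n : nat) : cob f a b c d -> in_rect_open a b c d w ->
  cdiff (fun s => oint (fun z => f z * (z - s)^-1 ^+ n) a b c d) w.
Proof.
move=> cf hw; have [/ltW ab /ltW cd] := inro_lt hw.
apply: oint_cdiff => //; apply: nrW (inro_open hw) => s hs z hz.
have zs := onb_neq hs hz; split; last by apply: jcont_kernel => //; exact: cf.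
apply: cdiffM; first exact: cdiff_cst.
apply: cdiffX; apply: cdiffV; first by rewrite subr_eq0.
by apply: cdiffB; [exact: cdiff_cst|exact: cdiff_id].
Qed.

Lemma nr_sq z0 P : nr z0 P -> exists2 r, 0 < r & forall z, sq z0 r z -> P z.
Proof.
move=> [e e0 h]; exists (e / 4) => [|z hz]; first lra.
by apply: h; rewrite distCE; apply: le_lt_trans (sq_nc _ hz) _; lra.
Qed.

(** The value of the quotient at [a] is supplied by the Cauchy integral [Phi], which equals
    $f(s)/(s-a)$ for $s \ne a$ by partial fractions and $f(a)=0$. The quotient is a function on all
    of the plane, holomorphic wherever [f] is, so that zeros can be divided out repeatedly. *)
Lemma cquot f a : nr a (cdiff f) -> f a = 0 ->
  exists g, (forall z, f z = (z - a) * g z) /\ (forall z, cdiff f z -> cdiff g z).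
Proof.
move=> /nr_sq [r r0 df] fa.
have cf := sq_cob (ltW r0) df; have ha := sqo0 a r0; have ci := cob_inv ha.
pose Phi s := (kq a r)^-1 * oq (fun z => f z * (z - a)^-1 * (z - s)^-1 ^+ 1) a r.
have dPhi s : sqo a r s -> cdiff Phi s.
  by move=> hs; apply: cdiffM; [exact: cdiff_cst|apply: cauchy_cdiff => //; exact: cobM].
pose g z := if z == a then Phi a else f z / (z - a).
have gE z : z != a -> nr z (fun y => f y / (y - a) = g y).
  move=> za; have n0 : 0 < nc (a - z) by rewrite nc_gt0 subr_eq0 eq_sym.
  exists (nc (a - z)) => // y; rewrite distCE /g; have [->|//] := eqVneq y a.
  by rewrite ltxx.
exists g; split=> [z|z dz].
  by rewrite /g; have [->|za] := eqVneq z a; rewrite ?subrr ?fa ?mul0r// mulrC divfK// subr_eq0.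
have [->|za] := eqVneq z a; last first.
  apply: cdiff_eq (gE z za) _; apply: cdiffM => //.
  apply: cdiffV; first by rewrite subr_eq0.
  by apply: cdiffB; [exact: cdiff_id|exact: cdiff_cst].
apply: cdiff_eq (dPhi a ha); apply: nrW (inro_open ha) => s hs.
rewrite /g; have [->//|sa] := eqVneq s a.
have cs := cob_inv hs.
have k0 := kq_neq0 a r0.
have E1 := cauchy_formula hs df; have E2 := cauchy_formula ha df.
rewrite fa mulr0 in E2.
have E : oq (fun z => f z / (z - s)) a r = (s - a) * oq (fun z => f z * (z - a)^-1 * (z - s)^-1 ^+ 1) a r.
  have cfs := cobM cf cs; have cfa := cobM cf ci; have cn : cob (fun z => (-1) * (f z / (z - a)))
     (re a - r) (re a + r) (im a - r) (im a + r) by apply: cobM cfa => y _; exact: cont_cst.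
  have : oq (fun z => f z / (z - s) + (-1) * (f z / (z - a))) a r =
      (s - a) * oq (fun z => f z * (z - a)^-1 * (z - s)^-1 ^+ 1) a r.
    rewrite -ointZ; [|lra|lra|by apply: cobM; [exact: cobM|exact: cs]].
    apply: oint_ext => y hz; have z1 := onb_neq ha hz; have z2 := onb_neq hs hz.
    by field; rewrite !subr_eq0 z1 z2.
  by rewrite /oq ointD//; [rewrite ointZ//; [rewrite E2 mulr0 addr0|lra|lra]|lra|lra].
rewrite /Phi -[X in _ * X](mulKf (x := s - a)) ?subr_eq0// -E /oq E1.
by rewrite -/(kq a r); field; rewrite subr_eq0 sa k0.
Qed.

(** The derivative is itself a Cauchy integral, hence holomorphic again. *)
Lemma derivative_exists f z0 : nr z0 (cdiff f) -> exists2 f' : C -> C,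
  nr z0 (fun z => cder f z (f' z)) & nr z0 (cdiff f').
Proof.
move=> /nr_sq [r r0 df]; have cf := sq_cob (ltW r0) df; have h0 := sqo0 z0 r0.
exists (fun s => (kq z0 r)^-1 * oq (fun z => f z * (z - s)^-1 ^+ 2) z0 r).
  apply: nrW (inro_open h0) => s hs.
  have [eta eta0 [B B0 hB]] := cauchy_quad hs.
  have [M M0 hM] := sq_bounded (ltW r0) df.
  apply: quad_cder eta0 (mulr_ge0 B0 M0) _ => w hw.
  exact: hB df hM w hw.
apply: nrW (inro_open h0) => s hs.
by apply: cdiffM; [exact: cdiff_cst|apply: cauchy_cdiff].
Qed.

(** Power trick: if $x/M$ exceeded 1, its powers would outgrow [D] by Bernoulli's inequality. It
    removes the constants left by crude integral bounds. *)
Lemma pow_bound (x M D : R) : 0 <= x -> 0 <= M -> (forall n, x ^+ n <= D * M ^+ n) -> x <= M.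
Proof.
move=> x0 M0 h; rewrite leNgt; apply/negP => Mx.
have [ME|Mn] := eqVneq M 0; first by have := h 1%N; rewrite ME !expr1 mulr0; lra.
have Mp : 0 < M by rewrite lt0r Mn.
pose y := x / M - 1.
have y0 : 0 < y by rewrite /y subr_gt0 ltr_pdivlMr// mul1r.
have B n : 1 + n%:R * y <= D.
  have hn : (1 + y) ^+ n <= D.
    by rewrite /y subrKC expr_div_n ler_pdivrMr ?exprn_gt0.
  apply: le_trans hn; elim: n {h} => [|n IH]; first by rewrite mul0r addr0 expr0.
  rewrite exprS -natr1; have : 0 <= n%:R * y * y by rewrite !mulr_ge0// ltW.
  have : (1 + y) * (1 + n%:R * y) <= (1 + y) * (1 + y) ^+ n by rewrite ler_wpM2l// addr_ge0// ltW.
  lra.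
have D0 : 0 <= D by have := B 0%N; rewrite mul0r; lra.
have := archi_boundP (divr_ge0 D0 (ltW y0)); rewrite ltr_pdivrMr//.
by have := B (Num.bound (D / y)); lra.
Qed.

(** Cauchy's formula for [f ^+ n] gives the bound up to a constant independent of [n], which
    [pow_bound] removes. *)
Lemma max_principle f (a b c d : R) w M : in_rect_open a b c d w ->
  (forall z, in_rect a b c d z -> cdiff f z) -> (forall z, on_rect a b c d z -> nc (f z) <= M) ->
  nc (f w) <= M.
Proof.
move=> hw df hM; have [ab cd] := inro_lt hw; have [ab' cd'] := (ltW ab, ltW cd).
have M0 : 0 <= M.
  apply: le_trans (hM (Complex a c) _); first exact: nc_ge0.
  by left; split; [left|rewrite /= lexx].
have [eta eta0 he] := onb_dist hw; have K0 := cK_neq0 ab cd.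
pose D := 4 * eta^-1 * ((b - a) + (d - c)) / nc (cK a b c d).
apply: (@pow_bound _ _ D) => // [|n]; first exact: nc_ge0.
have dfn z : in_rect a b c d z -> cdiff (fun z => f z ^+ n) z by move=> /df; exact: cdiffX.
have E := cauchy_formula hw dfn.
have nK : 0 < nc (cK a b c d) by rewrite nc_gt0.
rewrite -ncX -(ler_pM2l nK) -ncM -E.
have -> : nc (cK a b c d) * (D * M ^+ n) = 4 * (M ^+ n * eta^-1) * ((b - a) + (d - c)).
  by rewrite /D; field; rewrite !gt_eqF.
apply: oint_bound => //.
  apply: cobM; last exact: cob_inv.
  by apply: inr_cob => // z /dfn /cdiff_cont.
move=> z hz; rewrite ncM ncX ncV; apply: ler_pM; rewrite ?exprn_ge0 ?invr_ge0 ?nc_ge0//.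
  by apply: lerXn2r; rewrite ?nnegrE ?nc_ge0// hM.
have q : eta <= nc (z - w) by apply: he; rewrite // subrr nc0.
by rewrite lef_pV2// posrE (lt_le_trans eta0).
Qed.

(** If [f] had no zero, the inverse of [f] would violate the maximum principle at [w]. *)
Lemma zero_exists f (a b c d : R) w m : in_rect_open a b c d w ->
  (forall z, in_rect a b c d z -> cdiff f z) -> (forall z, on_rect a b c d z -> m <= nc (f z)) ->
  nc (f w) < m -> exists2 z, in_rect a b c d z & f z = 0.
Proof.
move=> hw df hm hfw; apply: contrapT => nz.
have fz z : in_rect a b c d z -> f z != 0.
  by move=> hz; apply/eqP => E; apply: nz; exists z.
have fw := fz w (inro_inr hw).
have m0 : 0 < m by apply: le_lt_trans hfw; exact: nc_ge0.
have [/ltW ab /ltW cd] := inro_lt hw.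
have : nc (f w)^-1 <= m^-1.
  apply: (max_principle (f := fun z => (f z)^-1) hw).
    by move=> z hz; apply: cdiffV; [exact: fz|exact: df].
  move=> z hz; rewrite ncV lef_pV2 ?posrE ?hm// nc_gt0.
  by apply: fz; exact: onb_inr hz.
by rewrite ncV lef_pV2 ?posrE ?nc_gt0//; lra.
Qed.

(** If $z-a$ can be divided out forever, the maximum principle on the square of half side $r$ bounds
    the $n$-th quotient by $M/r^n$, so $|f(w)| \le M\,2^{-n}$ for $|w-a|<r/2$ and all $n$. Otherwise
    the division stops at the order of the zero. *)
Lemma isolated_zero f a : nr a (cdiff f) -> nr a (fun z => f z = 0) \/
  exists m g, [/\ forall z, f z = (z - a) ^+ m * g z, forall z, cdiff f z -> cdiff g z & g a != 0].
Proof.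
move=> df; have [h|h] := pselect (exists m g,
  [/\ forall z, f z = (z - a) ^+ m * g z, forall z, cdiff f z -> cdiff g z & g a != 0]); [by right|left].
have H n : exists g, (forall z, f z = (z - a) ^+ n * g z) /\ (forall z, cdiff f z -> cdiff g z).
  elim: n => [|n [g [E dg]]]; first by exists f; split=> // z; rewrite expr0 mul1r.
  have ga : g a = 0.
    by apply/eqP/negP => /negP ga; apply: h; exists n, g.
  have [g' [E' dg']] := cquot (nrW dg df) ga.
  by exists g'; split=> [z|z /dg /dg'//]; rewrite exprSr -mulrA -E'.
have [r r0 {}df] := nr_sq df.
have [M M0 hM] := sq_bounded (ltW r0) df.
exists (r / 2) => [|w]; first lra.
rewrite distCE => hw.
have hws : sqo a r w by apply: nc_sqo; lra.
have B n : nc (f w) <= M * (1 / 2) ^+ n.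
  have [g [E dg]] := H n.
  have : nc (g w) <= M * r^-1 ^+ n.
    apply: max_principle hws _ _ => [z hz|z hz]; first by apply: dg; apply: df.
    have q := sqb_ge hz; have zn : 0 < nc (z - a) by lra.
    have -> : g z = f z * (z - a)^-1 ^+ n.
      by rewrite E exprVn mulrAC mulfV ?mul1r// expf_neq0// -nc_gt0.
    rewrite ncM ncX ncV; apply: ler_pM; rewrite ?exprn_ge0 ?invr_ge0 ?nc_ge0 ?hM//.
    by apply: lerXn2r; rewrite ?nnegrE ?invr_ge0 ?nc_ge0 ?(ltW r0)// lef_pV2.
  rewrite E ncM ncX => hg.
  apply: le_trans (ler_wpM2l _ hg) _; first by rewrite exprn_ge0// nc_ge0.
  rewrite mulrCA ler_wpM2l//.
  rewrite -exprMn; apply: lerXn2r; rewrite ?nnegrE ?mulr_ge0 ?invr_ge0 ?nc_ge0 ?(ltW r0)//.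
  by rewrite ler_pdivrMr//; lra.
have : nc (f w) <= 0.
  rewrite leNgt; apply/negP => x0.
  suff : 1 <= 1 / 2 :> R by lra.
  apply: (@pow_bound _ _ (M / nc (f w))) => [||n]; [lra|lra|].
  by rewrite expr1n mulrAC ler_pdivlMr// (mul1r (nc (f w))); exact: B.
by move=> h0; apply/eqP; rewrite -nc_eq0 eq_le h0 nc_ge0.
Qed.

End OneVariable.

(** * Zeros in a square and the argument principle *)

Section Zeros.
Context {R : realType}.
Local Notation C := R[i].
Implicit Types (f g u : C -> C) (z w a : C) (r : R).

Lemma nr_not_single z a : nr z (fun y => y = a) -> False.
Proof.
move=> [e e0 h].
have H (t : R) : 0 <= t -> t < e -> z + t%:C%C = a.
  by move=> t0 te; apply: h; rewrite distCE addrC addKr nc_real ger0_norm.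
have h1 := H 0 (lexx _) e0; have h2 : z + (e / 2)%:C%C = a by apply: H; lra.
have : nc (z + (e / 2)%:C%C - (z + 0%:C%C)) = 0 by rewrite h1 h2 subrr nc0.
rewrite (_ : _ - _ = (e / 2)%:C%C); last by rewrite rmorph0; ring.
by rewrite nc_real ger0_norm; lra.
Qed.

Lemma isolated_nr f a : nr a (cdiff f) -> nr a (fun z => f z = 0) \/
  nr a (fun z => z != a -> f z != 0).
Proof.
move=> df; have [|[m [g [E dg ga]]]] := isolated_zero df; [by left|right].
have cg := cdiff_cont (dg a (nr_at df)).
apply: nrW (cont_neq0 cg ga) => z gz za.
by rewrite E mulf_neq0// expf_neq0// subr_eq0.
Qed.

(** Near each point of the segment either [f] vanishes or its zeros are isolated, so vanishing
    identically near a point is a locally constant condition along the segment. *)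
Lemma identity_seg f z w : (forall t : R, 0 <= t <= 1 -> nr (z + t%:C%C * (w - z)) (cdiff f)) ->
  nr z (fun y => f y = 0) -> nr w (fun y => f y = 0).
Proof.
move=> df; pose p (t : R) := z + t%:C%C * (w - z); pose Z t := nr (p t) (fun y => f y = 0).
have cp t : cont p t.
  apply: contD; first exact: cont_cst.
  apply: contM; last exact: cont_cst.
  move=> e e0; exists e => // y; rewrite distCE distRE -rmorphB nc_real; exact.
suff : Z 0 <-> Z 1.
  by rewrite /Z /p rmorph0 rmorph1 mul0r mul1r addr0 subrKC => -[].
apply: (bisect1 (P := fun s t => Z s <-> Z t) ler01) => [x m y _ _ _ h1 h2|x hx].
  by rewrite h1.
have [h|h] := isolated_nr (df x hx).
  have [e e0 he] := cont_nr (cp x) (nr_nr h).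
  exists e => // y y' _ _ yx yy; split=> _; apply: he; rewrite distRE ltr_norml; lra.
have [e e0 he] := cont_nr (cp x) (nr_nr h).
have N t : `|t - x| < e -> ~ Z t.
  move=> /he ht hZ; apply: (@nr_not_single (p t) (p x)).
  by apply: nrW2 ht hZ => y h1 /eqP h2; apply/eqP/negP => /negP /h1; rewrite h2.
exists e => // y y' _ _ yx yy; split=> h0; exfalso.
  by apply: N h0; rewrite ltr_norml; lra.
by apply: N h0; rewrite ltr_norml; lra.
Qed.

Lemma sq_seg z0 r z w (t : R) : sq z0 r z -> sq z0 r w -> 0 <= t <= 1 ->
  sq z0 r (z + t%:C%C * (w - z)).
Proof.
move=> [/andP[a1 a2] /andP[a3 a4]] [/andP[b1 b2] /andP[b3 b4]] /andP[t0 t1].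
rewrite /sq /in_rect !reD !imD !reM !imM !reD !imD !reN !imN /= !mul0r subr0 addr0.
have H (x y lo hi : R) : lo <= x -> x <= hi -> lo <= y -> y <= hi -> lo <= x + t * (y - x) <= hi.
  move=> h1 h2 h3 h4.
  have p1 : 0 <= (1 - t) * (x - lo) by rewrite mulr_ge0; lra.
  have p2 : 0 <= t * (y - lo) by rewrite mulr_ge0; lra.
  have p3 : 0 <= (1 - t) * (hi - x) by rewrite mulr_ge0; lra.
  have p4 : 0 <= t * (hi - y) by rewrite mulr_ge0; lra.
  by apply/andP; split; lra.
by split; apply: H.
Qed.

(** Bisection shows that there are finitely many zeros; dividing each out to its full order makes
    [l] the list of zeros with multiplicity. *)
Lemma factor_sq f z0 r : 0 < r -> (forall z, sq z0 r z -> nr z (cdiff f)) ->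
  (forall z, sqb z0 r z -> f z != 0) ->
  exists l u, [/\ forall z, f z = (\prod_(a <- l) (z - a)) * u z,
    forall z, cdiff f z -> cdiff u z, forall z, sq z0 r z -> u z != 0 &
    forall a, a \in l -> sqo z0 r a].
Proof.
move=> r0 df fb.
(* The invariant that survives division by linear factors. For [f] itself, vanishing near one point
   would spread to a corner of the square. *)
pose Good g := forall z, sq z0 r z -> nr z (cdiff g) /\ ~ nr z (fun y => g y = 0).
have Gf : Good f.
  move=> z hz; split; first exact: df.
  move=> h0; pose w := Complex (re z0 - r) (im z0 - r).
  have hw : sqb z0 r w by left; split; [left|rewrite /= lexx /=; lra].
  have /nr_at fw : nr w (fun y => f y = 0).
    apply: identity_seg h0 => t ht; apply: df; apply: sq_seg => //.
    by apply: sqb_sq => //; exact: ltW.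
  by move: (fb w hw); rewrite fw eqxx.
(* A small box around any point has at most one zero in the square: none if the point is outside the
   square or not a zero, and only the point itself otherwise. *)
have [s hs] : exists s : seq C, forall z, sq z0 r z -> f z = 0 -> z \in s.
  pose box (lo L : bool -> R) z := lo true <= re z <= lo true + L true /\
    lo false <= im z <= lo false + L false.
  pose P (lo L : bool -> R) := exists s : seq C,
    forall z, box lo L z -> sq z0 r z -> f z = 0 -> z \in s.
  have : P (fun x : bool => if x then re z0 - r else im z0 - r) (fun _ => 2 * r).
    apply: box_cut_ind.
    - by move=> _; lra.
    - move=> lo L j L0 [s1 h1] [s2 h2]; exists (s1 ++ s2) => z hz hq fz; rewrite mem_cat.
      have Lj := L0 j.
      suff hc : box lo (fun k => if k == j then L k / 2 else L k) z \/
         box (fun k => if k == j then lo k + L k / 2 else lo k)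
         (fun k => if k == j then L k / 2 else L k) z.
        by case: hc => [/h1 ->//|/h2 ->//]; rewrite orbT.
      clear h1 h2; case: j Lj hz => /= Lj [/andP[? ?] /andP[? ?]]; rewrite /box /=.
        by have [?|?] := leP (re z) (lo true + L true / 2); [left|right]; split; apply/andP; split; lra.
      by have [?|?] := leP (im z) (lo false + L false / 2); [left|right]; split; apply/andP; split; lra.
    - move=> pt; pose z1 := Complex (pt true) (pt false).
      have [hz1|hz1] := pselect (sq z0 r z1 /\ f z1 = 0); last first.
        have [h|h] := pselect (sq z0 r z1).
          have [|e e0 he] := cont_neq0 (cdiff_cont (nr_at (df z1 h))).
            by apply/eqP => h0; apply: hz1.
          exists (e / 2) => [|lo L hl]; first lra.
          exists [::] => z [hz1' hz2'] _ fz; suff : f z != 0 by rewrite fz eqxx.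
          apply: he; rewrite distCE.
          apply: le_lt_trans (nc_le _) _; rewrite reD imD reN imN /=.
          case: (hl true) (hl false) => [? ? ? ?] [? ? ? ?].
          have : `|re z - pt true| < e / 2 by rewrite ltr_norml; lra.
          have : `|im z - pt false| < e / 2 by rewrite ltr_norml; lra.
          lra.
        have [e e0 he] : nr z1 (fun z => ~ sq z0 r z).
          apply: contrapT => hn; apply: h; rewrite /sq /in_rect.
          have cl (g : C -> R) : (forall z, `|g z - g z1| <= nc (z - z1)) ->
              (forall z, sq z0 r z -> 0 <= g z) -> 0 <= g z1.
            move=> g1 g2; rewrite leNgt; apply/negP => g3; apply: hn.
            exists (- g z1) => [|z]; first lra.
            by rewrite distCE => hz /g2; have := g1 z; rewrite ler_norml; lra.
          have A1 z : `|re z - re z1| <= nc (z - z1).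
            by have := Re_le_nc (z - z1); rewrite reD reN.
          have A2 z : `|im z - im z1| <= nc (z - z1).
            by have := Im_le_nc (z - z1); rewrite imD imN.
          have H1 := cl (fun z => re z - (re z0 - r)); have H2 := cl (fun z => re z0 + r - re z).
          have H3 := cl (fun z => im z - (im z0 - r)); have H4 := cl (fun z => im z0 + r - im z).
          have {}H1 : 0 <= re z1 - (re z0 - r).
            apply: H1 => z; last by case=> ? ?; lra.
            by rewrite (_ : _ - _ = re z - re z1) ?A1//; ring.
          have {}H2 : 0 <= re z0 + r - re z1.
            apply: H2 => z; last by case=> ? ?; lra.
            by rewrite (_ : _ - _ = - (re z - re z1)) ?normrN ?A1//; ring.
          have {}H3 : 0 <= im z1 - (im z0 - r).
            apply: H3 => z; last by case=> ? ?; lra.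
            by rewrite (_ : _ - _ = im z - im z1) ?A2//; ring.
          have {}H4 : 0 <= im z0 + r - im z1.
            apply: H4 => z; last by case=> ? ?; lra.
            by rewrite (_ : _ - _ = - (im z - im z1)) ?normrN ?A2//; ring.
          by split; apply/andP; split; lra.
        exists (e / 2) => [|lo L hl]; first lra.
        exists [::] => z [hz1' hz2'] hq _; exfalso; apply: (he z) hq; rewrite distCE.
        apply: le_lt_trans (nc_le _) _; rewrite reD imD reN imN /=.
        case: (hl true) (hl false) => [? ? ? ?] [? ? ? ?].
        have : `|re z - pt true| < e / 2 by rewrite ltr_norml; lra.
        have : `|im z - pt false| < e / 2 by rewrite ltr_norml; lra.
        lra.
      have [dg ng] := Gf _ (proj1 hz1).
      have [//|[e e0 he]] := isolated_nr dg.
      exists (e / 2) => [|lo L hl]; first lra.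
      exists [:: z1] => z [hz1' hz2'] _ fz; rewrite inE; apply/negP => /negP zz.
      suff : f z != 0 by rewrite fz eqxx.
      apply: (he z) => //; rewrite distCE; apply: le_lt_trans (nc_le _) _; rewrite reD imD reN imN /=.
      case: (hl true) (hl false) => [? ? ? ?] [? ? ? ?].
      have : `|re z - pt true| < e / 2 by rewrite ltr_norml; lra.
      have : `|im z - pt false| < e / 2 by rewrite ltr_norml; lra.
      lra.
  move=> [s hs]; exists s => z hz; apply: hs => //.
  by case: hz => ? ?; split; lra.
(* Treats the candidates in [s'] in turn; [nseq m a] records a zero of order [m], and [m = 0] is
   allowed. *)
have FL (s' : seq C) g : Good g -> exists l u, [/\ forall z, g z = (\prod_(a <- l) (z - a)) * u z,
    forall z, cdiff g z -> cdiff u z, forall a, sq z0 r a -> a \in s' -> u a != 0 &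
    forall a, a \in l -> sq z0 r a].
  elim: s' g => [|a s' IH] g Gg.
    by exists [::], g; split=> // z; rewrite big_nil mul1r.
  have [ha|ha] := pselect (sq z0 r a); last first.
    have [l [u [E du nu sl]]] := IH g Gg; exists l, u; split=> // b hb.
    by rewrite in_cons => /orP[/eqP ba|/nu]; [case: ha; rewrite -ba|apply].
  have [dg ng] := Gg a ha.
  have [//|[m [g1 [E1 d1 n1]]]] := isolated_zero dg.
  have Gg1 : Good g1.
    move=> z hz; have [dz nz] := Gg z hz; split; first exact: nrW dz.
    by move=> hu; apply: nz; apply: nrW hu => y hy; rewrite E1 hy mulr0.
  have [l [u [E du nu sl]]] := IH g1 Gg1.
  exists (nseq m a ++ l), u; split.
  - by move=> z; rewrite big_cat /= big_nseq iter_mulr_1 -mulrA -E.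
  - by move=> z /d1 /du.
  - move=> b hb; rewrite in_cons => /orP[/eqP ->|]; last exact: nu.
    by apply: contraNneq n1 => ua; rewrite E ua mulr0.
  - by move=> b; rewrite mem_cat mem_nseq => /orP[/andP[_ /eqP->]//|/sl].
have [l [u [E du nu sl]]] := FL s f Gf.
exists l, u; split=> // [z hz|a al].
  apply/eqP => uz; have fz : f z = 0 by rewrite E uz mulr0.
  by move: (nu z hz (hs z hz fz)); rewrite uz eqxx.
have [//|ab] := sqo_or_sqb (sl a al).
by move: (fb a ab); rewrite E (big_rem a al) /= subrr !mul0r eqxx.
Qed.

(** Made total by the value 0 where no derivative exists, so that derivatives are functions and can
    be iterated. *)
Definition cderiv f z : C := xget 0 [set d | cder f z d].
Lemma cderivP f z : cdiff f z -> cder f z (cderiv f z).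
Proof. by move=> [d hd]; rewrite /cderiv; apply: (@xgetPex _ 0 [set d | cder f z d]); exists d. Qed.
Lemma cderiv_cdiff f z : nr z (cdiff f) -> cdiff (cderiv f) z.
Proof.
move=> df; have [f' h1 h2] := derivative_exists df.
apply: cdiff_eq (nr_at h2); apply: nrW2 df h1 => y dy h; apply: cder_uniq h _.
exact: cderivP.
Qed.

Lemma logder (l : seq C) u z d : (forall a, a \in l -> z != a) -> u z != 0 -> cder u z d ->
  cder (fun y => (\prod_(a <- l) (y - a)) * u y) z
    ((\prod_(a <- l) (z - a)) * u z * (\sum_(a <- l) (z - a)^-1 + d / u z)).
Proof.
move=> hl uz du; elim: l hl => [|a l IH] hl.
  rewrite !big_nil mul1r add0r mulrC divfK//.
  by apply: cder_eq du; apply: nr_all => y; rewrite big_nil mul1r.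
have za : z - a != 0 by rewrite subr_eq0 hl ?mem_head.
have {}IH := IH (fun b hb => hl b (mem_behead (s := a :: l) hb)).
have := cderM (cderD (cder_id z) (cder_cst (- a) z)) IH.
rewrite addr0 mul1r => h; rewrite !big_cons.
set X := _ * _ in h; set Y := _ * (_ + _) in h *.
have -> : (z - a) * \prod_(j <- l) (z - j) * u z * ((z - a)^-1 + \sum_(j <- l) (z - j)^-1 + d / u z)
   = \prod_(a0 <- l) (z - a0) * u z + (z - a) * (\prod_(a0 <- l) (z - a0) * u z *
     (\sum_(a0 <- l) (z - a0)^-1 + d / u z)) by field; rewrite uz za.
by apply: cder_eq h; apply: nr_all => y; rewrite big_cons mulrA.
Qed.

Lemma oint_sum (I : Type) (l : seq I) (F : I -> C -> C) (a b c d : R) : a <= b -> c <= d ->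
  (forall i, cob (F i) a b c d) ->
  oint (fun z => \sum_(i <- l) F i z) a b c d = \sum_(i <- l) oint (F i) a b c d.
Proof.
move=> ab cd cF; elim: l => [|i l IH].
  rewrite big_nil -[RHS](mul0r (oint (fun _ => 0) a b c d)) -ointZ//; last by move=> z _; exact: cont_cst.
  by apply: oint_ext => z _; rewrite big_nil mulr0.
rewrite big_cons -IH -ointD//; last by move=> z hz; apply: cont_sum => j; exact: cF.
by apply: oint_ext => z _; rewrite big_cons.
Qed.

(** The weight [W] is what matters later: the weight 1 counts zeros, powers give power sums, and
    other weights evaluate a function at a single zero. The logarithmic derivative of [u] is
    holomorphic and integrates to 0, while each linear factor contributes a value of [W] by Cauchy's
    formula. *)
Lemma argument_principle f f' u (l : seq C) z0 r W : 0 < r ->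
  (forall z, sq z0 r z -> cdiff W z) ->
  (forall z, sq z0 r z -> nr z (cdiff f)) ->
  (forall z, sqb z0 r z -> cder f z (f' z)) ->
  (forall z, f z = (\prod_(a <- l) (z - a)) * u z) ->
  (forall z, cdiff f z -> cdiff u z) -> (forall z, sq z0 r z -> u z != 0) ->
  (forall a, a \in l -> sqo z0 r a) ->
  oq (fun z => W z * (f' z / f z)) z0 r = kq z0 r * \sum_(a <- l) W a.
Proof.
move=> r0 dX df df' E du nu hl; have rr := ltW r0.
have h1 : re z0 - r <= re z0 + r by lra.
have h2 : im z0 - r <= im z0 + r by lra.
have ud z : sq z0 r z -> cdiff (cderiv u) z.
  by move=> /df dz; apply: cderiv_cdiff; apply: nrW dz => y; exact: du.
have udz z : sq z0 r z -> cdiff u z by move=> /df /nr_at /du.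
have dU z : sq z0 r z -> cdiff (fun y => W y * (cderiv u y / u y)) z.
  move=> hz; apply: cdiffM; first exact: dX.
  apply: cdiffM; first exact: ud.
  by apply: cdiffV; [exact: nu|exact: udz].
have cl a : a \in l -> cob (fun y => W y * (y - a)^-1) (re z0 - r) (re z0 + r) (im z0 - r) (im z0 + r).
  by move=> al; apply: cobM; [exact: sq_cob|apply: cob_inv; exact: hl].
have -> : oq (fun z => W z * (f' z / f z)) z0 r = oq (fun z =>
    \sum_(i < size l) (W z * (z - nth 0 l i)^-1) + W z * (cderiv u z / u z)) z0 r.
  apply: oint_ext => z hz; have hq := sqb_sq rr hz.
  have zl a : a \in l -> z != a by move=> /hl ha; exact: onb_neq ha hz.
  have hld := logder zl (nu z hq) (cderivP (udz z hq)).
  have fE : f' z = f z * (\sum_(a <- l) (z - a)^-1 + cderiv u z / u z).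
    rewrite E; apply: cder_uniq (df' z hz) _; apply: cder_eq hld.
    by apply: nr_all => y; rewrite E.
  have fz : f z != 0.
    rewrite E mulf_neq0 ?nu//; elim: (l) zl => [|a s IH] zl; first by rewrite big_nil oner_neq0.
    rewrite big_cons mulf_neq0 ?subr_eq0 ?zl ?mem_head// IH// => b hb.
    by apply: zl; rewrite in_cons hb orbT.
  rewrite fE mulrAC mulfV// mul1r mulrDr; congr (_ + _).
  by rewrite (big_nth 0) big_mkord mulr_sumr.
have cn (i : 'I_(size l)) := cl _ (mem_nth 0 (ltn_ord i)).
rewrite /oq ointD//; last first.
- by move=> z hz; apply: cdiff_cont; apply: dU; apply: sqb_sq hz.
- by move=> z hz; apply: cont_sum => i; apply: cn.
rewrite [X in _ + X]goursat// addr0 oint_sum//.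
rewrite (big_nth 0) big_mkord mulr_sumr; apply: eq_bigr => i _.
by apply: cauchy_formula => //; apply: hl; apply: mem_nth.
Qed.

End Zeros.

(** * Holomorphic functions of several variables *)

Section SeveralVariables.
Context {R : realType}.
Local Notation C := R[i].
Variable n : nat.
Local Notation V := 'rV[C]_n.
Implicit Types (f g : V -> C) (x y v : V).

(* Continuous and holomorphic on complex lines; by Osgood this is joint holomorphy when it holds in a neighbourhood. *)
Definition GH f x := cont f x /\ forall v, cdiff (fun t => f (x + t *: v)) 0.
Definition gh f x := nr x (GH f).

Lemma cont_line x v (s : C) : cont (fun t : C => x + t *: v) s.
Proof. by apply: contVD; [exact: cont_cst|apply: contVZ; [exact: cont_id|exact: cont_cst]]. Qed.

Lemma GH_line f x v s : GH f (x + s *: v) -> cdiff (fun t => f (x + t *: v)) s.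
Proof.
move=> [_ /(_ v) h].
have : cdiff (fun t => f (x + s *: v + (t - s) *: v)) s.
  apply: (cdiff_comp (f := fun t => t - s) (g := fun t => f (x + s *: v + t *: v))).
    by apply: cdiffB; [exact: cdiff_id|exact: cdiff_cst].
  by rewrite subrr.
by apply: cdiff_eq; apply: nr_all => t; rewrite -addrA -scalerDl subrKC.
Qed.
Lemma gh_line f x v s : gh f (x + s *: v) -> nr s (cdiff (fun t => f (x + t *: v))).
Proof. by move=> h; apply: nrW (cont_nr (cont_line x v s) h) => t; exact: GH_line. Qed.

Lemma GH_eq f g x : nr x (fun y => f y = g y) -> GH f x -> GH g x.
Proof.
move=> h [cf df]; split=> [|v]; first exact: cont_eq h cf.
apply: cdiff_eq (df v).
by have := cont_nr (cont_line x v 0) (P := fun y => f y = g y); rewrite scale0r addr0; apply.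
Qed.
Lemma GH_cst c x : GH (fun _ => c) x.
Proof. by split=> [|v]; [exact: cont_cst|exact: cdiff_cst]. Qed.
Lemma GH_coord i x : GH (fun y => y 0 i) x.
Proof.
split=> [|v]; first exact: cont_coord.
have : cdiff (fun t => x 0 i + t * v 0 i) 0.
  by apply: cdiffD; [exact: cdiff_cst|apply: cdiffM; [exact: cdiff_id|exact: cdiff_cst]].
by apply: cdiff_eq; apply: nr_all => t; rewrite !mxE.
Qed.
Lemma GHD f g x : GH f x -> GH g x -> GH (fun y => f y + g y) x.
Proof. by move=> [? df] [? dg]; split=> [|v]; [exact: contD|exact: cdiffD (df v) (dg v)]. Qed.
Lemma GHN f x : GH f x -> GH (fun y => - f y) x.
Proof. by move=> [? df]; split=> [|v]; [exact: contN|exact: cdiffN (df v)]. Qed.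
Lemma GHM f g x : GH f x -> GH g x -> GH (fun y => f y * g y) x.
Proof. by move=> [? df] [? dg]; split=> [|v]; [exact: contM|exact: cdiffM (df v) (dg v)]. Qed.
Lemma GHV f x : f x != 0 -> GH f x -> GH (fun y => (f y)^-1) x.
Proof.
move=> fx [? df]; split=> [|v]; first exact: contV.
by apply: cdiffV (df v); rewrite scale0r addr0.
Qed.
Lemma GH_comp f (h : C -> C) x : GH f x -> cdiff h (f x) -> GH (fun y => h (f y)) x.
Proof.
move=> [cf df] dh; split=> [|v]; first exact: cont_comp cf (cdiff_cont dh).
by apply: cdiff_comp (df v) _; rewrite scale0r addr0.
Qed.
Lemma GH_affine f (k : C) (b : V) x : GH f (b + k *: x) -> GH (fun y => f (b + k *: y)) x.
Proof.
move=> [cf df]; split=> [|v].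
  apply: (cont_comp (f := fun y => b + k *: y) (g := f)) cf.
  by apply: contVD; [exact: cont_cst|apply: contVZ; [exact: cont_cst|exact: cont_id]].
apply: cdiff_eq (df (k *: v)); apply: nr_all => t.
by rewrite scalerDr addrA !scalerA mulrC.
Qed.

Lemma gh_GH f x : gh f x -> GH f x. Proof. exact: nr_at. Qed.
Lemma gh_nr f x : gh f x -> nr x (gh f). Proof. exact: nr_nr. Qed.
Lemma gh_cont f x : gh f x -> cont f x. Proof. by move=> /gh_GH []. Qed.
Lemma gh_eq f g x : nr x (fun y => f y = g y) -> gh f x -> gh g x.
Proof. by move=> /nr_nr; apply: nrW2 => y; exact: GH_eq. Qed.
Lemma gh_cst c x : gh (fun _ => c) x. Proof. by apply: nr_all => y; exact: GH_cst. Qed.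
Lemma gh_coord i x : gh (fun y => y 0 i) x. Proof. by apply: nr_all => y; exact: GH_coord. Qed.
Lemma ghD f g x : gh f x -> gh g x -> gh (fun y => f y + g y) x.
Proof. by apply: nrW2 => y; exact: GHD. Qed.
Lemma ghN f x : gh f x -> gh (fun y => - f y) x.
Proof. by apply: nrW => y; exact: GHN. Qed.
Lemma ghB f g x : gh f x -> gh g x -> gh (fun y => f y - g y) x.
Proof. by move=> hf hg; apply: ghD => //; exact: ghN. Qed.
Lemma ghM f g x : gh f x -> gh g x -> gh (fun y => f y * g y) x.
Proof. by apply: nrW2 => y; exact: GHM. Qed.
Lemma ghV f x : f x != 0 -> gh f x -> gh (fun y => (f y)^-1) x.
Proof.
move=> fx hf; apply: nrW2 hf (cont_neq0 (gh_cont hf) fx) => y hy fy; exact: GHV.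
Qed.
Lemma gh_comp f (h : C -> C) x : gh f x -> nr (f x) (cdiff h) -> gh (fun y => h (f y)) x.
Proof.
by move=> hf hh; apply: nrW2 hf (cont_nr (gh_cont hf) hh) => y; exact: GH_comp.
Qed.
Lemma gh_sum (I : Type) (s : seq I) (F : I -> V -> C) x :
  (forall i, gh (F i) x) -> gh (fun y => \sum_(i <- s) F i y) x.
Proof.
move=> h; elim: s => [|i s IH].
  by apply: gh_eq (gh_cst 0 x); apply: nr_all => y; rewrite big_nil.
by apply: gh_eq (ghD (h i) IH); apply: nr_all => y; rewrite big_cons.
Qed.
Lemma gh_prod (I : Type) (s : seq I) (F : I -> V -> C) x :
  (forall i, gh (F i) x) -> gh (fun y => \prod_(i <- s) F i y) x.
Proof.
move=> h; elim: s => [|i s IH].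
  by apply: gh_eq (gh_cst 1 x); apply: nr_all => y; rewrite big_nil.
by apply: gh_eq (ghM (h i) IH); apply: nr_all => y; rewrite big_cons.
Qed.
Lemma cont_affine (k : C) (b : V) x : cont (fun y : V => b + k *: y) x.
Proof. by apply: contVD; [exact: cont_cst|apply: contVZ; [exact: cont_cst|exact: cont_id]]. Qed.
Lemma gh_affine f (k : C) (b : V) x : gh f (b + k *: x) -> gh (fun y => f (b + k *: y)) x.
Proof.
by move=> h; apply: nrW (cont_nr (cont_affine k b x) h) => y; exact: GH_affine.
Qed.
Lemma gh_oint (a b c d : R) (g : V -> C -> C) x0 : a <= b -> c <= d ->
  nr x0 (fun x => forall z, on_rect a b c d z -> GH (g^~ z) x /\ jcont g x z) ->
  gh (fun x => oint (g x) a b c d) x0.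
Proof.
move=> ab cd h; apply: nrW (nr_nr h) => x hx; split.
  by apply: oint_cont => //; apply: nrW hx => y hy z /hy[].
move=> v; apply: oint_cdiff => //.
have := cont_nr (cont_line x v 0) (P := fun x => forall z, on_rect a b c d z -> GH (g^~ z) x /\ jcont g x z).
rewrite scale0r addr0 => /(_ hx); apply: nrW => s hs z /hs [Gz jz]; split.
  exact: (GH_line (f := g^~ z)).
apply: (jcont_comp (h := fun p : metP metC metC => x + p.1 *: v) (k := fun p => p.2) (x := (s, z)) jz).
  by apply: contVD; [exact: cont_cst|apply: contVZ; [exact: cont_fst|exact: cont_cst]].
exact: cont_snd.
Qed.

(** Every [z] near [y] ends a segment of direction [y - x] that starts near [x]; the one-variable
    theorem is applied on each of these parallel segments. *)
Lemma gh_identity f x y : (forall t : R, 0 <= t <= 1 -> gh f (x + t%:C%C *: (y - x))) ->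
  nr x (fun z => f z = 0) -> nr y (fun z => f z = 0).
Proof.
move=> hf h0; pose d := y - x.
have T : nr x (fun x' => forall t : R, 0 <= t <= 1 -> gh f (x' + t%:C%C *: d)).
  apply: (tube (Q := fun x' t => gh f (x' + t%:C%C *: d)) ler01) => t ht.
  have cp : cont (fun p : metP (metV n) metR => p.1 + p.2%:C%C *: d) ((x, t) : metP (metV n) metR).
    apply: contVD; first exact: cont_fst.
    apply: contVZ; last exact: cont_cst.
    move=> e e0; exists e => // -[x' t'] /=; rewrite gt_max => /andP[_].
    by rewrite -rmorphB nc_real.
  exact: (cont_nr (P := gh f) cp (gh_nr (hf t ht))).
have := nrI T (nr_nr h0) => -[e e0 he]; exists e => // z; rewrite distVE => hz.
have [h1 h2] : (forall t : R, 0 <= t <= 1 -> gh f (z - d + t%:C%C *: d)) /\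
    nr (z - d) (fun w => f w = 0).
  apply: he; rewrite distVE (_ : z - d - x = z - y)//.
  by rewrite /d opprB addrA addrAC addrK.
have : nr (1 : C) (fun t => f (z - d + t *: d) = 0).
  apply: (@identity_seg _ (fun t => f (z - d + t *: d)) 0 1) => [t ht|].
    by rewrite subr0 mulr1 add0r; apply: gh_line; exact: h1.
  have := cont_nr (cont_line (z - d) d 0) (P := fun w => f w = 0).
  by rewrite scale0r addr0; apply.
by move=> /nr_at; rewrite scale1r subrK.
Qed.

Definition dirder v f x : C := cderiv (fun t => f (x + t *: v)) 0.

Lemma dirder_cder v f x s : GH f (x + s *: v) ->
  cder (fun t => f (x + t *: v)) s (dirder v f (x + s *: v)).
Proof.
move=> h; have := cderivP (proj2 h v); rewrite -/(dirder v f (x + s *: v)) => H.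
have k : cder (fun t => t - s) s 1.
  by have := cderD (cder_id s) (cder_cst (- s) s); rewrite addr0.
have := cder_comp (f := fun t => t - s) (g := fun t => f (x + s *: v + t *: v)) k.
rewrite subrr => /(_ _ H); rewrite mulr1; apply: cder_eq.
by apply: nr_all => t; rewrite -addrA -scalerDl subrKC.
Qed.

Lemma nr_line v x P : nr x P -> exists2 r, 0 < r &
  nr x (fun y => forall t, sq 0 r t -> P (y + t *: v)).
Proof.
move=> [e e0 h]; have v0 := nV_ge0 v.
have w0 : 0 < nV v + 1 by lra.
exists (e / (8 * (nV v + 1))); first by rewrite divr_gt0// mulr_gt0.
exists (e / 2) => [|y]; first lra.
rewrite distVE => hy t /sq_nc ht; apply: h; rewrite distVE.
have {}ht : nc t <= 2 * (e / (8 * (nV v + 1))).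
  by have := ht; rewrite subr0; apply; rewrite divr_ge0 ?mulr_ge0//; lra.
have -> : y + t *: v - x = (y - x) + t *: v by rewrite addrAC.
apply: le_lt_trans (nVD _ _) _; have := nVZ t v.
have : nc t * nV v <= 2 * (e / (8 * (nV v + 1))) * (nV v + 1).
  by apply: ler_pM => //; [exact: nc_ge0|lra].
rewrite (_ : 2 * (e / (8 * (nV v + 1))) * (nV v + 1) = e / 4); first lra.
by field; rewrite gt_eqF.
Qed.

(** The directional derivative is a Cauchy integral along the line, in which the base point is a
    parameter. *)
Lemma gh_dirder v f x : gh f x -> gh (dirder v f) x.
Proof.
move=> /(nr_line v) [r r0 h].
have h1 : re (0 : C) - r <= re (0 : C) + r by lra.
have h2 : im (0 : C) - r <= im (0 : C) + r by lra.
have z0 := sqo0 0 r0.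
have E : nr x (fun y => (kq 0 r)^-1 * oq (fun z => f (y + z *: v) * (z - 0)^-1 ^+ 2) 0 r = dirder v f y).
  apply: nrW h => y hy.
  have dy z : sq 0 r z -> cdiff (fun t => f (y + t *: v)) z by move=> hz; apply: GH_line; exact: hy.
  have [eta eta0 [B B0 hB]] := cauchy_quad z0.
  have [M M0 hM] := sq_bounded (ltW r0) dy.
  apply: cder_uniq; last first.
    by apply: cderivP; apply: dy; apply: sqo_sq.
  apply: quad_cder eta0 (mulr_ge0 B0 M0) _ => w hw.
  exact: (hB (fun t => f (y + t *: v)) M dy hM w hw).
apply: gh_eq E _; apply: ghM; first exact: gh_cst.
apply: gh_oint => //; apply: nrW h => y hy z hz.
have zn : z - 0 != 0 by rewrite subr_eq0; exact: onb_neq z0 hz.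
have Gz : GH f (y + z *: v) by apply: hy; apply: sqb_sq hz; exact: ltW.
split.
  apply: GHM; last exact: GH_cst.
  by move: Gz; rewrite addrC -[X in _ + X]scale1r => /GH_affine; apply: GH_eq; apply: nr_all => w;
     rewrite scale1r addrC.
apply: contM.
  apply: (cont_comp (f := fun p : metP (metV n) metC => p.1 + p.2 *: v) (g := f)); last exact: (proj1 Gz).
  apply: contVD; first exact: cont_fst.
  by apply: contVZ; [exact: cont_snd|exact: cont_cst].
apply: contX; apply: contV => //.
by apply: contB; [exact: cont_snd|exact: cont_cst].
Qed.

End SeveralVariables.

(** * Hurwitz, removable singularities, Hankel determinants *)

Section Tools.
Context {R : realType}.
Local Notation C := R[i].
Implicit Types (f g u : C -> C) (z w a : C) (r : R).

Lemma cont_complex (A : @met R) (h k : A -> R) (x : A) :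
  cont h x -> cont k x -> cont (fun y => Complex (h y) (k y)) x.
Proof.
move=> ch ck e e0; have e2 : 0 < e / 2 by lra.
apply: nrW2 (ch _ e2) (ck _ e2) => y; rewrite !distRE => h1 h2.
by rewrite distCE; apply: le_lt_trans (nc_le _) _; rewrite reD imD reN imN /=; lra.
Qed.

Lemma edge_tube (A : @met R) (x0 : A) (a b c d : R) (Q : A -> C -> Prop) : a <= b -> c <= d ->
  (forall z, on_rect a b c d z -> nr ((x0, z) : metP A metC) (fun p => Q p.1 p.2)) ->
  nr x0 (fun x => forall z, on_rect a b c d z -> Q x z).
Proof.
move=> ab cd h.
have H y : (forall x, a <= x <= b -> on_rect a b c d (Complex x y)) ->
    nr x0 (fun x => forall t, a <= t <= b -> Q x (Complex t y)).
  move=> hy; apply: (tube (Q := fun x t => Q x (Complex t y)) ab) => t /hy /h [e e0 he].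
  exists e => // -[x s] /=; rewrite gt_max => /andP[h1 h2]; apply: (he (x, Complex s y)).
  by rewrite /= gt_max h1 /= hsub nc_real.
have V y : (forall x, c <= x <= d -> on_rect a b c d (Complex y x)) ->
    nr x0 (fun x => forall t, c <= t <= d -> Q x (Complex y t)).
  move=> hy; apply: (tube (Q := fun x t => Q x (Complex y t)) cd) => t /hy /h [e e0 he].
  exists e => // -[x s] /=; rewrite gt_max => /andP[h1 h2]; apply: (he (x, Complex y s)).
  by rewrite /= gt_max h1 /= vsub ncM nc_i mul1r nc_real.
have H1 : nr x0 (fun x => forall t, a <= t <= b -> Q x (Complex t c)).
  by apply: H => x hx; right; split=> //; left.
have H2 : nr x0 (fun x => forall t, a <= t <= b -> Q x (Complex t d)).
  by apply: H => x hx; right; split=> //; right.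
have V1 : nr x0 (fun x => forall t, c <= t <= d -> Q x (Complex a t)).
  by apply: V => x hx; left; split=> //; left.
have V2 : nr x0 (fun x => forall t, c <= t <= d -> Q x (Complex b t)).
  by apply: V => x hx; left; split=> //; right.
apply: nrW2 (nrI H1 H2) (nrI V1 V2) => x [h1 h2] [h3 h4] [s t].
by case=> [[[|] /= -> ht]|[[|] /= -> hs]]; [exact: h3|exact: h4|exact: h1|exact: h2].
Qed.

Lemma sq_tube (A : @met R) (x0 : A) z0 r (Q : A -> C -> Prop) : 0 <= r ->
  (forall z, sq z0 r z -> nr ((x0, z) : metP A metC) (fun p => Q p.1 p.2)) ->
  nr x0 (fun x => forall z, sq z0 r z -> Q x z).
Proof.
move=> r0 h.
have ab : re z0 - r <= re z0 + r by lra.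
have cd : im z0 - r <= im z0 + r by lra.
have : nr x0 (fun x => forall s, re z0 - r <= s <= re z0 + r ->
    forall t, im z0 - r <= t <= im z0 + r -> Q x (Complex s t)).
  apply: (tube (Q := fun x s => forall t, im z0 - r <= t <= im z0 + r -> Q x (Complex s t)) ab) => s hs.
  apply: (tube (A := metP A metR) (Q := fun p t => Q p.1 (Complex p.2 t)) cd) => t ht.
  have [|e e0 he] := h (Complex s t); first by split.
  exists (e / 2) => [|[[x s'] t'] /=]; first lra.
  rewrite !gt_max => /andP[/andP[h1 h2] h3]; apply: (he (x, Complex s' t')) => /=.
  rewrite gt_max; apply/andP; split; first lra.
  by apply: le_lt_trans (nc_le _) _; rewrite reD imD reN imN /=; lra.
by apply: nrW => x hx [s t] [h1 h2]; apply: hx.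
Qed.

(* Hurwitz *)
Lemma param_zero (A : @met R) (h : A -> C -> C) (x0 : A) z0 r : 0 < r -> h x0 z0 = 0 ->
  jcont h x0 z0 -> (forall z, sqb z0 r z -> jcont h x0 z /\ h x0 z != 0) ->
  nr x0 (fun x => forall z, sq z0 r z -> cdiff (h x) z) ->
  nr x0 (fun x => exists2 z, sq z0 r z & h x z = 0).
Proof.
move=> r0 hz j0 jb dh.
have ab : re z0 - r <= re z0 + r by lra.
have cd : im z0 - r <= im z0 + r by lra.
have [M hM] := @cob_bounded _ (fun z => (h x0 z)^-1) _ _ _ _ ab cd
  (fun z hz => contV (proj2 (jb z hz)) (jcont_snd (proj1 (jb z hz)))).
have M0 : 0 <= M.
  apply: le_trans (hM (Complex (re z0 - r) (im z0 - r)) _); first exact: nc_ge0.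
  by left; split; [left|rewrite /= lexx /=; lra].
pose m := (M + 1)^-1 / 2.
have Mi : 0 < (M + 1)^-1 by rewrite invr_gt0; lra.
have m0 : 0 < m by rewrite /m; lra.
have lo z : sqb z0 r z -> 2 * m <= nc (h x0 z).
  move=> hq; have [_ hn] := jb z hq.
  have := hM z hq; rewrite ncV => hi.
  have p0 : 0 < nc (h x0 z) by rewrite nc_gt0.
  have -> : 2 * m = (M + 1)^-1 by rewrite /m; lra.
  rewrite -[nc _]invrK lef_pV2 ?posrE ?invr_gt0//; lra.
have T : nr x0 (fun x => forall z, sqb z0 r z -> m <= nc (h x z)).
  apply: edge_tube => // z hq; have [jz _] := jb z hq.
  apply: nrW (jz m m0) => -[x w] /= hw; have := lo z hq; have := nc_sub (h x0 z) (h x w).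
  by rewrite ncB; lra.
apply: nrW2 (nrI dh T) (jcont_fst j0 m0) => x [dx bx]; rewrite distCE hz subr0 => hx.
exact: (zero_exists (sqo0 z0 r0) dx bx hx).
Qed.

Lemma line_isolated f z0 r : 0 < r -> (forall z, sq z0 r z -> nr z (cdiff f)) ->
  (exists2 w, sq z0 r w & f w != 0) -> forall z, sq z0 r z -> nr z (fun y => y != z -> f y != 0).
Proof.
move=> r0 df [w hw fw] z hz.
have [h0|//] := isolated_nr (df z hz).
have /nr_at fw0 : nr w (fun y => f y = 0).
  by apply: identity_seg h0 => t ht; apply: df; exact: sq_seg.
by move: fw; rewrite fw0 eqxx.
Qed.

(** Riemann's theorem: $(z-a)^2 s(z)$ has value and derivative 0 at $a$, so $z-a$ can be divided out
    twice. *)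
Lemma removable_pt s a M : nr a (fun z => z != a -> cdiff s z /\ nc (s z) <= M) ->
  exists g, (forall z, z != a -> g z = s z) /\ (forall z, z != a -> cdiff s z -> cdiff g z) /\ cdiff g a.
Proof.
move=> hs; pose s2 z := (z - a) ^+ 2 * s z.
have s2a : s2 a = 0 by rewrite /s2 subrr expr0n mul0r.
have M0 : 0 <= M.
  have [e e0 he] := hs; pose z := a + (e / 2)%:C%C.
  have E : z - a = (e / 2)%:C%C by rewrite /z addrC addKr.
  have nz : nc (z - a) = e / 2 by rewrite E nc_real ger0_norm; lra.
  have za : z != a by rewrite -subr_eq0 -nc_gt0 nz; lra.
  have [|_ hM] := he z _ za; first by rewrite distCE nz; lra.
  exact: le_trans (nc_ge0 _) hM.
have d2a : cder s2 a 0.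
  have [e e0 he] := hs.
  apply: (@quad_cder _ _ _ _ e M) => // z hz; rewrite s2a subr0 mul0r subr0 /s2 ncM ncX mulrC.
  have [->|za] := eqVneq z a; first by rewrite subrr nc0 expr0n !mulr0.
  by rewrite ler_wpM2r ?exprn_ge0 ?nc_ge0//; case: (he z _ za).
have dz z : z != a -> cdiff s z -> cdiff s2 z.
  move=> za ds; apply: cdiffM => //; apply: cdiffX.
  by apply: cdiffB; [exact: cdiff_id|exact: cdiff_cst].
have n2 : nr a (cdiff s2).
  apply: nrW hs => z hz; have [->|za] := eqVneq z a; first by exists 0.
  by apply: dz => //; case: (hz za).
have [g1 [E1 d1]] := cquot n2 s2a.
have g1a : g1 a = 0.
  have : cder s2 a (g1 a).
    have [d1a h1a] := d1 a (nr_at n2).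
    have := cderM (cderD (cder_id a) (cder_cst (- a) a)) h1a.
    rewrite addr0 mul1r subrr mul0r addr0; apply: cder_eq; apply: nr_all => y.
    by rewrite E1.
  by move=> /(cder_uniq d2a).
have [g [E d]] := cquot (nrW d1 n2) g1a.
exists g; split; [move=> z za|split].
- have za' : z - a != 0 by rewrite subr_eq0.
  by apply: (mulfI (expf_neq0 2 za')); rewrite expr2 -mulrA -E -E1.
- by move=> z za /(dz z za) /d1 /d.
- by apply: d; apply: d1; exact: nr_at n2.
Qed.

Lemma fin_sep (a : C) (l' : seq C) : nr a (fun z => z != a -> z \notin l').
Proof.
elim: l' => [|b l' IH]; first exact: nr_all.
have [->|ba] := eqVneq b a.
  by apply: nrW IH => z hz za; rewrite in_cons (negbTE za) /= hz.
have n0 : 0 < nc (b - a) by rewrite nc_gt0 subr_eq0.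
apply: nrW2 IH (nr_dist a n0) => z hz; rewrite distCE => zd za.
rewrite in_cons negb_or hz// andbT; apply/eqP => zb; move: zd; rewrite zb; lra.
Qed.

Lemma seq_min (I : eqType) (s : seq I) (P : I -> R -> Prop) :
  (forall i e e', 0 < e' -> e' <= e -> P i e -> P i e') ->
  (forall i, i \in s -> exists2 e, 0 < e & P i e) ->
  exists2 e, 0 < e & forall i, i \in s -> P i e.
Proof.
move=> mon; elim: s => [|i s IH] h; first by exists 1.
have [e e0 he] := IH (fun j js => h j (mem_behead (s := i :: s) js)).
have [d d0 hd] := h i (mem_head _ _).
have m0 : 0 < Num.min e d by rewrite lt_min e0.
exists (Num.min e d) => // j; rewrite in_cons => /orP[/eqP->|/he hj].
  by apply: mon hd; rewrite // ge_min lexx orbT.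
by apply: mon hj; rewrite // ge_min lexx.
Qed.

(** The points are removed one by one; in the induction [l2] lists those already treated and [l1]
    those that remain. *)
Lemma removable s (l : seq C) z0 r M : uniq l -> (forall a, a \in l -> sqo z0 r a) ->
  (forall z, sq z0 r z -> z \notin l -> cdiff s z) ->
  (forall z, sq z0 r z -> z \notin l -> nc (s z) <= M) ->
  exists2 g, forall z, sq z0 r z -> cdiff g z & forall z, z \notin l -> g z = s z.
Proof.
move=> ul hl ds hM.
suff : forall l1 l2 : seq C, l = l2 ++ l1 -> exists2 g, forall z, sq z0 r z -> z \notin l1 -> cdiff g z &
    forall z, z \notin l -> g z = s z.
  move=> /(_ [::] l); rewrite cats0 => /(_ erefl) [g h1 h2]; exists g => // z hz; exact: h1.
move=> l1 l2; elim/last_ind: l2 l1 => [|l2 a IH] l1 El; first by exists s; rewrite // El in ds *.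
have [|g h1 h2] := IH (a :: l1); first by rewrite El cat_rcons.
have al : a \in l by rewrite El mem_cat mem_rcons mem_head.
have al1 : a \notin l1.
  by move: ul; rewrite El cat_rcons cat_uniq /= => /and4P[].
have H : nr a (fun z => z != a -> cdiff g z /\ nc (g z) <= M).
  apply: nrW2 (fin_sep a l) (inro_open (hl a al)) => z hz /inro_inr hq za.
  have zl := hz za; split; last by rewrite h2// hM.
  apply: h1 => //; rewrite in_cons (negbTE za) /=.
  by apply: contra zl; rewrite El mem_cat => ->; rewrite orbT.
have [g' [e1 [e2 e3]]] := removable_pt H.
exists g' => [z hz zl1|z zl].
  have [->//|za] := eqVneq z a; apply: e2 => //; apply: h1 => //.
  by rewrite in_cons (negbTE za).
by rewrite e1 ?h2//; apply: contraNneq zl => ->.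
Qed.

Lemma divide_list f (l : seq C) : uniq l -> (forall a, a \in l -> nr a (cdiff f) /\ f a = 0) ->
  exists2 g, forall z, f z = (\prod_(a <- l) (z - a)) * g z & forall z, cdiff f z -> cdiff g z.
Proof.
elim: l => [|a l IH] /=; first by move=> _ _; exists f => // z; rewrite big_nil mul1r.
move=> /andP[al ul] h.
have [b bl|g E dg] := IH ul; first by apply: h; rewrite in_cons bl orbT.
have [da fa] := h a (mem_head _ _).
have ga : g a = 0.
  have /eqP := fa; rewrite E mulf_eq0 prodf_seq_eq0 => /orP[/hasP[b bl /=]|/eqP//].
  by rewrite subr_eq0 => /eqP ab; move: al; rewrite ab bl.
have [g1 [E1 d1]] := cquot (nrW dg da) ga.
exists g1 => z; last by move=> /dg /d1.
by rewrite E E1 big_cons; ring.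
Qed.

(** A Vandermonde matrix times its transpose, weighted by multiplicities. The entries are symmetric
    in the zeros, hence holomorphic in parameters; among lists with at most [k] distinct entries the
    determinant singles out those with exactly [k], whatever the multiplicities. *)
Definition hankel (l : seq C) k : 'M[C]_k := \matrix_(i, j) \sum_(a <- l) a ^+ (i + j).

Lemma hankel_row (l : seq C) k (c : 'rV[C]_k) (j : 'I_k) :
  (c *m hankel l k) 0 j = \sum_(a <- l) a ^+ j * (rVpoly c).[a].
Proof.
rewrite mxE; under eq_bigr do rewrite mxE mulr_sumr.
rewrite exchange_big /=; apply: eq_bigr => a _.
rewrite (horner_coef_wide a (size_poly _ _)) mulr_sumr; apply: eq_bigr => i _.
by rewrite coef_rVpoly_ord exprD; ring.
Qed.

(** The coefficients of the monic polynomial with the distinct entries as roots form a nonzero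
    kernel vector. *)
Lemma hankel_det_eq0 (l : seq C) k : (size (undup l) < k)%N -> \det (hankel l k) = 0.
Proof.
move=> sl; apply/eqP/det0P; pose p := \prod_(a <- undup l) ('X - a%:P).
have sp : size p = (size (undup l)).+1 by rewrite /p size_prod_XsubC.
have p0 : p != 0 by rewrite -size_poly_eq0 sp.
have pK : rVpoly (poly_rV p : 'rV[C]_k) = p by apply: poly_rV_K; rewrite sp.
exists (poly_rV p).
  by apply: contraNneq p0 => E; rewrite -pK E linear0.
apply/rowP => j; rewrite hankel_row pK mxE big1_seq// => a /andP[_ al].
have /rootP -> : root p a by rewrite root_prod_XsubC mem_undup.
by rewrite mulr0.
Qed.

(** A kernel vector, read as a polynomial [p], is orthogonal to all polynomials of degree below [k].
    Testing with the one that vanishes at all entries but [b] gives $p(b)=0$, since multiplicities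
    are nonzero in characteristic 0; so [p], of degree below [k], has [k] roots. *)
Lemma hankel_det_neq0 (l : seq C) k : size (undup l) = k -> \det (hankel l k) != 0.
Proof.
move=> sl; apply/negP => /det0P[c c0 cH].
pose p := rVpoly c.
have H (q : {poly C}) : (size q <= k)%N -> \sum_(a <- l) q.[a] * p.[a] = 0.
  move=> sq; under eq_bigr do rewrite (horner_coef_wide _ sq) mulr_suml.
  rewrite exchange_big big1//= => j _.
  have := congr1 (fun M : 'rV[C]_k => M 0 j) cH; rewrite hankel_row mxE => h.
  under eq_bigr do rewrite -mulrA.
  by rewrite -mulr_sumr h mulr0.
have pr b : b \in undup l -> p.[b] = 0.
  move=> bl; pose q := \prod_(a <- rem b (undup l)) ('X - a%:P).
  have sq : (size q <= k)%N.
    by rewrite size_prod_XsubC size_rem// sl; case: (k) sl => // E; move: bl; rewrite (size0nil E).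
  have qa a : a \in l -> a != b -> q.[a] = 0.
    move=> al ab; apply/rootP; rewrite root_prod_XsubC.
    by rewrite mem_rem_uniq ?undup_uniq// inE ab mem_undup.
  have qb : q.[b] != 0.
    suff : ~~ root q b by [].
    by rewrite root_prod_XsubC mem_rem_uniq ?undup_uniq// inE eqxx.
  have := H q sq; rewrite (bigID (pred1 b)) /= [X in _ + X]big1_seq ?addr0; last first.
    by move=> a /andP[ab al]; rewrite qa// mul0r.
  rewrite (eq_bigr (fun=> q.[b] * p.[b])); last by move=> a /eqP->.
  rewrite big_const_seq iter_addr addr0 => /eqP; rewrite mulrn_eq0 mulf_eq0 (negbTE qb) /=.
  move=> /orP[|/eqP//]; rewrite -leqn0 leqNgt -has_count => /negP[]; apply/hasP; exists b => //=.
  by rewrite mem_undup in bl.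
have : p == 0.
  apply/negPn/negP => p0; have := max_poly_roots (p := p) (rs := undup l) p0 _ (undup_uniq l).
  have -> : all (root p) (undup l) by apply/allP => b /pr /rootP.
  by move=> /(_ isT); rewrite sl ltnNge size_poly.
move=> /eqP E; move: c0; have : poly_rV p = c by exact: rVpolyK.
by rewrite E linear0 => <-; rewrite eqxx.
Qed.

End Tools.

(** * Local generator of the ideal of a hypersurface *)

Section LocalGenerator.
Context {R : realType}.
Local Notation C := R[i].
Variable n : nat.
Local Notation V := 'rV[C]_n.
(** What is used of a hypersurface: local equations, density of the points near which a single
    function cuts it out as a set, and empty interior. *)
Variable Vs : V -> Prop.
Hypothesis hA1 : forall p, exists (m : nat) (fs : 'I_m -> V -> C),
  (forall i, gh (fs i) p) /\ nr p (fun y => Vs y <-> forall i, fs i y = 0).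
Hypothesis hA2 : forall x P, Vs x -> nr x P -> exists w,
  [/\ P w, Vs w & exists2 g, gh g w & nr w (fun y => Vs y <-> g y = 0)].
Hypothesis hA3 : forall x, ~ nr x Vs.

(* F generates the ideal of germs at q vanishing on Vs. *)
Definition generates (F : V -> C) q := [/\ gh F q, nr q (fun y => Vs y -> F y = 0) &
  forall G, gh G q -> nr q (fun y => Vs y -> G y = 0) ->
  exists2 H, gh H q & nr q (fun y => G y = H y * F y)].

Lemma Vs_closed x : ~ Vs x -> nr x (fun y => ~ Vs y).
Proof.
move=> nx; have [m [fs [hf E]]] := hA1 x.
have [i fi] : exists i, fs i x != 0.
  apply: contrapT => H; apply: nx; apply/(nr_at E) => i.
  by apply/eqP/negP => /negP h; apply: H; exists i.
apply: nrW2 E (cont_neq0 (gh_cont (hf i)) fi) => y E fy /E /(_ i) h.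
by move: fy; rewrite h eqxx.
Qed.

Lemma cont_add_line (v : V) (x : V) (t : C) :
  cont (fun q : metP (metV n) metC => q.1 + q.2 *: v) ((x, t) : metP (metV n) metC).
Proof.
apply: contVD; first exact: cont_fst.
by apply: contVZ; [exact: cont_snd|exact: cont_cst].
Qed.

Lemma jcont_line (v : V) (f : V -> C) (x : V) (t : C) : cont f (x + t *: v) ->
  jcont (fun (x : V) (t : C) => f (x + t *: v)) x t.
Proof. by move=> cf; apply: (cont_comp (g := f) (cont_add_line v x t)). Qed.

Lemma nr_add_line (v : V) P x t : nr (x + t *: v) P ->
  nr ((x, t) : metP (metV n) metC) (fun q => P (q.1 + q.2 *: v)).
Proof. by move=> h; apply: (cont_nr (P := P) (cont_add_line v x t)). Qed.

Lemma GH_shift f (b : V) x : GH f (x + b) -> GH (fun y => f (y + b)) x.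
Proof.
rewrite addrC -[X in b + X]scale1r => /GH_affine; apply: GH_eq.
by apply: nr_all => y; rewrite scale1r addrC.
Qed.

(** * Zeros of one equation along a family of parallel lines *)

Section Fibre.
(** The zeros of [phi] on lines of direction [v] near [p] stay in the square of half side [r]. They
    are factored over [2 * r], so that contours avoid them, and [3 * r] leaves room for moving the
    base point along [v]. *)
Variables (p v : V) (phi : V -> C) (m : nat) (fs : 'I_m -> V -> C) (r be : R).
Hypotheses (r0 : 0 < r) (be0 : 0 < be).
Local Notation inB x := (dist p x < be).
Hypothesis H1 : forall x t, inB x -> sq 0 (3 * r) t ->
  [/\ gh phi (x + t *: v), forall i, gh (fs i) (x + t *: v),
      Vs (x + t *: v) <-> (forall i, fs i (x + t *: v) = 0) &
      Vs (x + t *: v) -> phi (x + t *: v) = 0].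
Hypothesis H2 : forall x t, inB x -> sq 0 (3 * r) t -> ~ sqo 0 r t -> phi (x + t *: v) != 0.

Lemma sqW (s s' : R) (t : C) : s <= s' -> sq 0 s t -> sq 0 s' t.
Proof. by move=> h [? ?]; split; lra. Qed.

Definition ph x t := phi (x + t *: v).

(** Lists of zeros with multiplicity. The order of a chosen list is arbitrary, so only its symmetric
    functions can be expected to depend holomorphically on [x]. *)
Definition zset x : set (seq C) := [set l | exists u, [/\ forall t, ph x t = (\prod_(a <- l) (t - a)) * u t,
   forall t, cdiff (ph x) t -> cdiff u t, forall t, sq 0 (2 * r) t -> u t != 0 &
   forall a, a \in l -> sqo 0 (2 * r) a]].
Definition root_list x : seq C := xget [::] (zset x).

Lemma ph_cdiff x t : inB x -> sq 0 (3 * r) t -> nr t (cdiff (ph x)).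
Proof. by move=> hx ht; apply: gh_line; case: (H1 hx ht). Qed.

Lemma zlP x : inB x -> zset x (root_list x).
Proof.
have rr := r0.
move=> hx; apply: (@xgetPex _ [::] (zset x)).
have r2 : 0 < 2 * r by lra.
have [] := @factor_sq _ (ph x) 0 (2 * r) r2.
- by move=> t ht; apply: ph_cdiff => //; apply: sqW ht; lra.
- move=> t ht; apply: H2 => //.
    by apply: sqW (sqb_sq (ltW r2) ht); lra.
  move=> [h3 h4]; move: h3 h4; rewrite /= => /andP[? ?] /andP[? ?].
  by case: ht => [[[|] E _]|[[|] E _]]; move: E; rewrite /= => E; lra.
by move=> l [u hu]; exists l, u.
Qed.

Lemma root_list_iff x t : inB x -> (t \in root_list x) <-> (sq 0 (3 * r) t /\ ph x t = 0).
Proof.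
have rr := r0.
move=> hx; have [u [E _ hu hl]] := zlP hx; split.
  move=> tl; split; first by apply: sqW (sqo_sq (hl t tl)); lra.
  by rewrite E (big_rem t tl) /= subrr !mul0r.
move=> [ht h0].
have t1 : sqo 0 r t.
  by apply: contrapT => hn; move: (H2 hx ht hn); rewrite -/(ph x t) h0 eqxx.
have t2 : sq 0 (2 * r) t by apply: sqW (sqo_sq t1); lra.
move: h0; rewrite E => /eqP; rewrite mulf_eq0 (negbTE (hu t t2)) orbF prodf_seq_eq0.
by move=> /hasP[a al /=]; rewrite subr_eq0 => /eqP ->.
Qed.

Lemma root_list_sqo x t : inB x -> t \in root_list x -> sqo 0 r t.
Proof.
have rr := r0.
move=> hx /root_list_iff - /(_ hx)[ht h0]; apply: contrapT => hn.
by move: (H2 hx ht hn); rewrite -/(ph x t) h0 eqxx.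
Qed.

(* By the argument principle this is the sum of W over the zeros of phi along the line, up to the factor kq. *)
Definition argi (W : V -> C -> C) ze rho x : C :=
  oq (fun t => W x t * (dirder v phi (x + t *: v) / phi (x + t *: v))) ze rho.

Lemma gh_argi W ze rho x0 : 0 <= rho ->
  nr x0 (fun x => forall t, sqb ze rho t -> GH (W^~ t) x /\ jcont W x t) ->
  (forall t, sqb ze rho t -> gh phi (x0 + t *: v) /\ phi (x0 + t *: v) != 0) ->
  gh (argi W ze rho) x0.
Proof.
have rr := r0.
move=> rho0 hW hp.
have T : nr x0 (fun x => forall t, sqb ze rho t -> gh phi (x + t *: v) /\ phi (x + t *: v) != 0).
  apply: edge_tube; [lra|lra|] => t ht; have [hg hn] := hp t ht.
  apply: (nr_add_line (P := fun y => gh phi y /\ phi y != 0)).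
  exact: nrI (gh_nr hg) (cont_neq0 (gh_cont hg) hn).
apply: gh_oint; [lra|lra|]; apply: nrW2 hW T => x hx hT t ht.
have [Gw jw] := hx t ht; have [hg hn] := hT t ht.
have hd := gh_dirder v hg.
split.
  apply: GHM => //; apply: GHM; first by apply: GH_shift; exact: gh_GH.
  by apply: GHV => //; apply: GH_shift; exact: gh_GH.
apply: contM; first exact: jw.
apply: contM; first by apply: jcont_line; exact: gh_cont.
by apply: contV => //; apply: jcont_line; exact: gh_cont.
Qed.

Lemma argiE W ze rho x (l : seq C) u : 0 < rho ->
  (forall t, sq ze rho t -> cdiff (W x) t) ->
  (forall t, sq ze rho t -> gh phi (x + t *: v)) ->
  (forall t, ph x t = (\prod_(a <- l) (t - a)) * u t) ->
  (forall t, cdiff (ph x) t -> cdiff u t) -> (forall t, sq ze rho t -> u t != 0) ->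
  (forall a, a \in l -> sqo ze rho a) ->
  argi W ze rho x = kq ze rho * \sum_(a <- l) W x a.
Proof.
have rr := r0.
move=> rho0 dW hg E du nu hl.
apply: (@argument_principle _ (ph x) (fun t => dirder v phi (x + t *: v)) u) => //.
  by move=> t /hg; apply: gh_line.
by move=> t /(sqb_sq (ltW rho0)) /hg /gh_GH; apply: dirder_cder.
Qed.

Lemma W_pow (k : nat) (x : V) (t : C) :
  GH (fun _ : V => t ^+ k) x /\ jcont (fun (_ : V) (t : C) => t ^+ k) x t.
Proof. by split; [exact: GH_cst|apply: contX; exact: cont_snd]. Qed.

Lemma power_sum k x : inB x ->
  argi (fun _ t => t ^+ k) 0 (2 * r) x = kq 0 (2 * r) * \sum_(a <- root_list x) a ^+ k.
Proof.
have rr := r0.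
move=> hx; have [u [E du hu hl]] := zlP hx.
apply: (argiE (W := fun _ t => t ^+ k) (u := u)) => //; first lra.
  by move=> t _; apply: cdiffX; exact: cdiff_id.
by move=> t ht; have [|//] := @H1 x t hx; apply: sqW ht; lra.
Qed.

Lemma inB_nr x : inB x -> nr x (fun y => inB y).
Proof.
have rr := r0.
move=> hx; exists (be - dist p x) => [|y hy]; first lra.
by have := dist_tri p x y; lra.
Qed.

Lemma gh_power_sum k x0 : inB x0 -> gh (fun x => \sum_(a <- root_list x) a ^+ k) x0.
Proof.
have rr := r0.
move=> hx0; have K0 : kq 0 (2 * r) != 0 by apply: kq_neq0; lra.
apply: (@gh_eq _ _ (fun x => (kq 0 (2 * r))^-1 * argi (fun _ t => t ^+ k) 0 (2 * r) x)).
  by apply: nrW (inB_nr hx0) => x hx; rewrite power_sum// mulKf.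
apply: ghM; first exact: gh_cst.
apply: gh_argi; first lra.
  by apply: nr_all => x t _; exact: W_pow.
move=> t ht; have [|h _ _ _] := @H1 x0 t hx0.
  by apply: sqW (sqb_sq _ ht); lra.
split=> //; apply: H2 => //; first by apply: sqW (sqb_sq _ ht); lra.
move=> [h3 h4]; move: h3 h4; rewrite /= => /andP[? ?] /andP[? ?].
by case: ht => [[[|] E _]|[[|] E _]]; move: E; rewrite /= => E; lra.
Qed.

(** The zeroth power sum counts zeros with multiplicity; it is continuous with integer values, so it
    cannot jump. This makes the maximal number of distinct zeros exist. *)
Lemma size_zl_near : nr p (fun x => (size (root_list x) <= size (root_list p))%N).
Proof.
have rr := r0.
have hp : inB p by rewrite dist0.
have c0 := gh_cont (gh_power_sum 0 hp).
have S0 x : \sum_(a <- root_list x) a ^+ 0 = (size (root_list x))%:R :> C.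
  by under eq_bigr do rewrite expr0; rewrite big_const_seq count_predT iter_addr_0.
apply: nrW (c0 1 ltr01) => x; rewrite distCE !S0 => h.
rewrite leqNgt; apply/negP => lt.
move: h; rewrite -(subnKC (ltnW lt)) natrD addrC addKr nc_nat -[1]/(1%:R) ltr_nat ltnS leqn0 subn_eq0.
by rewrite leqNgt lt.
Qed.

Definition distinct_roots x := undup (root_list x).

Lemma distinct_roots_iff x t : inB x -> (t \in distinct_roots x) <-> (sq 0 (3 * r) t /\ ph x t = 0).
Proof. by rewrite mem_undup; exact: root_list_iff. Qed.

(** Base points on one line see the same zeros up to translation, so the number of distinct zeros is
    the same for both. *)
Lemma distinct_roots_shift x s t : inB x -> inB (x + s *: v) -> sqo 0 r s ->
  (t \in distinct_roots (x + s *: v)) <-> (t + s \in distinct_roots x).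
Proof.
have rr := r0.
move=> hx hxs hs.
have aux a b : sqo 0 r a -> sqo 0 r b -> sq 0 (3 * r) (a + b).
  by move=> [/andP[? ?] /andP[? ?]] [/andP[? ?] /andP[? ?]]; split; rewrite ?reD ?imD; lra.
have auxN a : sqo 0 r a -> sqo 0 r (- a).
  by move=> [/andP[? ?] /andP[? ?]]; split; rewrite ?reN ?imN; lra.
have E : ph (x + s *: v) t = ph x (t + s).
  by rewrite /ph -addrA -scalerDl [s + t]addrC.
split=> ht.
  have h1 : sqo 0 r t by apply: (@root_list_sqo (x + s *: v)) => //; rewrite mem_undup in ht.
  by apply/distinct_roots_iff => //; split; [exact: aux|rewrite -E; case/distinct_roots_iff: ht].
have h1 : sqo 0 r (t + s) by apply: (@root_list_sqo x) => //; rewrite mem_undup in ht.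
apply/distinct_roots_iff => //; split; last by rewrite E; case/distinct_roots_iff: ht.
by rewrite -(addrK s t); apply: aux => //; exact: auxN.
Qed.

Lemma size_Z_shift x s : inB x -> inB (x + s *: v) -> sqo 0 r s ->
  size (distinct_roots (x + s *: v)) = size (distinct_roots x).
Proof.
have rr := r0.
move=> hx hxs hs; rewrite -(size_map (fun t => t + s)).
apply: perm_size; apply: uniq_perm.
- by rewrite map_inj_uniq ?undup_uniq//; exact: addIr.
- exact: undup_uniq.
move=> t; apply/mapP/idP => [[a /distinct_roots_shift h ->]|ht]; first exact: h.
by exists (t - s); rewrite ?subrK//; apply/distinct_roots_shift => //; rewrite subrK.
Qed.

Lemma line_nonzero x s : inB x -> sq 0 (2 * r) s -> nr s (fun t => t != s -> ph x t != 0).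
Proof.
have rr := r0.
move=> hx hs; have r2 : 0 < 2 * r by lra.
apply: (@line_isolated _ (ph x) 0 (2 * r)) => //.
- by move=> z hz; apply: ph_cdiff => //; apply: sqW hz; lra.
- pose w : C := Complex (2 * r) 0.
  have hw : sq 0 (2 * r) w by split=> /=; lra.
  exists w => //; apply: H2 => //; first by apply: sqW hw; lra.
  by move=> [/=]; lra.
Qed.

(* At a point where [Vs] is cut out by one function, nearby [v]-lines meet [Vs] by Hurwitz. *)
Lemma open_proj x s g e : inB x -> sqo 0 (2 * r) s -> Vs (x + s *: v) -> gh g (x + s *: v) ->
  nr (x + s *: v) (fun y => Vs y <-> g y = 0) -> 0 < e ->
  nr x (fun x' => exists2 t, nc (t - s) < e & Vs (x' + t *: v)).
Proof.
have rr := r0.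
move=> hx hs Vw hg Eg e0.
have nP := nr_add_line (P := fun y => GH g y /\ (Vs y <-> g y = 0)) (nrI hg Eg).
have [d d0 hd] := nP.
have h0 : nr s (fun t => t != s -> g (x + t *: v) != 0).
  have gl : nr s (cdiff (fun t => g (x + t *: v))) by exact: gh_line.
  have [hz|//] := isolated_nr gl; exfalso.
  apply: (@nr_not_single _ s s).
  apply: nrW2 (nrI hz (line_nonzero hx (sqo_sq hs))) (nrI (inro_open hs) (nr_dist s d0)).
  move=> t [gt pt] [/inro_inr ht td].
  apply/eqP/negP => /negP t0; have := pt t0; rewrite /ph.
  have Vt : Vs (x + t *: v).
    have [] := hd (x, t); last by move=> _ /= Et; apply/Et.
    by rewrite /= gt_max subrr nV0 d0.
  have [|_ _ _ /(_ Vt) ->] := @H1 x t hx; last by rewrite eqxx.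
  by apply: sqW ht; lra.
have [eta eta0 he] := nr_sq (nrI h0 (nrI (nr_dist s d0) (nr_dist s e0))).
have nx : nr x (fun x' => forall t, sq s eta t -> GH g (x' + t *: v) /\ (Vs (x' + t *: v) <-> g (x' + t *: v) = 0)).
  exists d => // x' hx' t /he [_ [td _]]; apply: (hd (x', t)).
  by rewrite /= gt_max; apply/andP; split.
have gx t : sq s eta t -> GH g (x + t *: v) by move=> /(nr_at nx) [].
have ss : sq s eta s := sqo_sq (sqo0 s eta0).
have := @param_zero _ (metV n) (fun x' t => g (x' + t *: v)) x s eta eta0.
case=> //.
- by case: (nr_at Eg) => h _; apply: h.
- by apply: jcont_line; case: (gx s ss).
- move=> t ht; have hq := sqb_sq (ltW eta0) ht.
  split; first by apply: jcont_line; case: (gx t hq).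
  have [h _] := he t hq; apply: h; apply/eqP => E.
  by have := sqb_ge ht; rewrite E subrr nc0; lra.
- by apply: nrW nx => x' hx' t /hx' [Gt _]; apply: GH_line.
move=> d1 d10 hd1; have [d2 d20 hd2] := nx.
exists (Num.min d1 d2) => [|x']; first by rewrite lt_min d10.
rewrite lt_min => /andP[/hd1 [t ht gt] /hd2 hx']; exists t.
  by have [_ [_]] := he t ht.
by apply/(proj2 (hx' t ht)).
Qed.

(** Put a small square around each of the [nu] zeros at [x0]. For nearby [x], Hurwitz keeps a zero
    in each square, and maximality of [nu] leaves no room for two distinct ones. The only zero in a
    square, possibly multiple, is the mean of $t$ over the zeros there, a quotient of two
    argument-principle integrals and hence holomorphic; [h] is the same mean for [fs i]. *)
Lemma roots_local x0 nu : inB x0 -> size (distinct_roots x0) = nu ->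
  (forall x, inB x -> (size (distinct_roots x) <= nu)%N) ->
  exists (rho : R) (T : C -> V -> C) (h : C -> 'I_m -> V -> C), [/\ 0 < rho,
    forall ze, ze \in distinct_roots x0 -> [/\ gh (T ze) x0, forall i, gh (h ze i) x0, T ze x0 = ze &
       forall t, sq ze rho t -> sq 0 (3 * r) t] &
    nr x0 (fun x => [/\ inB x, uniq (map (T^~ x) (distinct_roots x0)), distinct_roots x =i map (T^~ x) (distinct_roots x0) &
      forall ze, ze \in distinct_roots x0 -> [/\ sq ze rho (T ze x),
         forall t, sq ze rho t -> ph x t = 0 -> t = T ze x &
         forall i, h ze i x = fs i (x + T ze x *: v)]])].
Proof.
have rr := r0.
move=> hx0 snu hnu.
have [e e0 he] : exists2 e, 0 < e & forall ze, ze \in distinct_roots x0 -> forall t, nc (t - ze) < e ->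
    (t != ze -> t \notin distinct_roots x0) /\ sqo 0 r t.
  apply: seq_min => [ze d d' _ dd h t ht|ze hz]; first by apply: h; apply: lt_le_trans ht dd.
  have hs : sqo 0 r ze by apply: root_list_sqo hx0 _; rewrite mem_undup in hz.
  have [d d0 hd] := nrI (fin_sep ze (distinct_roots x0)) (inro_open hs).
  by exists d => // t ht; have [] := hd t ht.
(* Small enough that squares around different zeros are disjoint, have no zero on their boundary and
   stay where the functions are holomorphic. *)
pose rho := e / 8; have rho0 : 0 < rho by rewrite /rho; lra.
have near ze t : sq ze rho t -> nc (t - ze) < e / 3.
  by move=> /(sq_nc (ltW rho0)); rewrite /rho; lra.
have in3 ze t : ze \in distinct_roots x0 -> sq ze rho t -> sq 0 (3 * r) t.
  move=> hz /near ht; have [|_ hs] := he ze hz t; first lra.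
  by apply: sqW (sqo_sq hs); lra.
have sep ze ze' t : ze \in distinct_roots x0 -> ze' \in distinct_roots x0 -> sq ze rho t -> sq ze' rho t -> ze' = ze.
  move=> hz hz' /near h1 /near h2; apply/eqP/negP => /negP ne.
  have [|/(_ ne)] := he ze hz ze'; last by rewrite hz'.
  by have := nc_tri t ze ze'; rewrite (ncB ze' t); lra.
have nz0 ze t : ze \in distinct_roots x0 -> sqb ze rho t -> ph x0 t != 0.
  move=> hz hb; have hq := sqb_sq (ltW rho0) hb.
  have tz : t != ze by apply/eqP => E; have := sqb_ge hb; rewrite E subrr nc0; lra.
  have [|/(_ tz) tn _] := he ze hz t; first by have := near _ _ hq; lra.
  apply: contra tn => /eqP h0; apply/distinct_roots_iff => //; split=> //; exact: in3 hz hq.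
pose W1 := fun (_ : V) (t : C) => t ^+ 0.
pose W2 := fun (_ : V) (t : C) => t ^+ 1.
pose W3 := fun i (x : V) (t : C) => fs i (x + t *: v).
(* Dividing by the integral of weight 1 cancels both the multiplicity and the factor [kq]. *)
pose T ze x := argi W2 ze rho x / argi W1 ze rho x.
pose h ze i x := argi (W3 i) ze rho x / argi W1 ze rho x.
have G : nr x0 (fun x => inB x /\ forall ze, ze \in distinct_roots x0 ->
    (forall t, sqb ze rho t -> ph x t != 0) /\ (exists2 t, sq ze rho t & ph x t = 0)).
  apply: nrI; first exact: inB_nr.
  apply: nrI_seq => ze hz; apply: nrI.
    apply: edge_tube; [lra|lra|] => t ht; apply: (nr_add_line (P := fun y => phi y != 0)).
    apply: cont_neq0; last exact: (nz0 ze t hz ht).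
    have [|hg _ _ _] := @H1 x0 t hx0; last exact: gh_cont.
    by apply: in3 hz _; apply: sqb_sq ht; exact: ltW.
  apply: param_zero => //.
  - by case/distinct_roots_iff: hz.
  - apply: jcont_line; have [|hg _ _ _] := @H1 x0 ze hx0; last exact: gh_cont.
    by apply: in3 hz _; apply: sqo_sq; exact: sqo0.
  - move=> t ht; split; last exact: nz0 hz ht.
    apply: jcont_line; have [|hg _ _ _] := @H1 x0 t hx0; last exact: gh_cont.
    by apply: in3 hz _; apply: sqb_sq ht; exact: ltW.
  - apply: nrW (inB_nr hx0) => x hx t ht; apply: nr_at (ph_cdiff hx _); exact: in3 hz ht.
have key x : inB x -> (forall ze, ze \in distinct_roots x0 ->
    (forall t, sqb ze rho t -> ph x t != 0) /\ (exists2 t, sq ze rho t & ph x t = 0)) ->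
    exists tau : C -> C, [/\ uniq (map tau (distinct_roots x0)), distinct_roots x =i map tau (distinct_roots x0) &
      forall ze, ze \in distinct_roots x0 -> [/\ sq ze rho (tau ze), forall t, sq ze rho t -> ph x t = 0 -> t = tau ze,
        argi W1 ze rho x != 0 &
        forall W, (forall t, sq ze rho t -> cdiff (W x) t) ->
          argi W ze rho x / argi W1 ze rho x = W x (tau ze)]].
  move=> hx hN.
  pose tau ze : C := xget 0 [set t | sq ze rho t /\ ph x t = 0].
  have tauP ze : ze \in distinct_roots x0 -> sq ze rho (tau ze) /\ ph x (tau ze) = 0.
    move=> hz; have [_ [t ht h0]] := hN ze hz.
    by apply: (@xgetPex _ 0 [set t | sq ze rho t /\ ph x t = 0]); exists t.
  have tinj : {in distinct_roots x0 &, injective tau}.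
    move=> ze ze' hz hz' E; have [h1 _] := tauP ze hz; have [h2 _] := tauP ze' hz'.
    by apply: (sep ze' ze (tau ze')) => //; rewrite -E.
  have ut : uniq (map tau (distinct_roots x0)) by rewrite map_inj_in_uniq// undup_uniq.
  have sub : {subset map tau (distinct_roots x0) <= distinct_roots x}.
    move=> _ /mapP[ze hz ->]; have [h1 h2] := tauP ze hz.
    by apply/distinct_roots_iff => //; split=> //; exact: in3 hz h1.
  (* Pigeonhole: one zero in each of the [nu] squares already exhausts the at most [nu] distinct
     zeros. *)
  have [|_ Ei] := uniq_min_size ut sub; first by rewrite size_map snu hnu.
  have uq ze : ze \in distinct_roots x0 -> forall t, sq ze rho t -> ph x t = 0 -> t = tau ze.
    move=> hz t ht h0; have : t \in distinct_roots x by apply/distinct_roots_iff => //; split=> //; exact: in3 hz ht.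
    rewrite -Ei => /mapP[ze' hz' E]; rewrite E; congr tau.
    by apply: (sep ze ze' t) => //; rewrite E; case: (tauP ze' hz').
  exists tau; split; [exact: ut|by move=> t; rewrite Ei|move=> ze hz].
  have [h1 h2] := tauP ze hz.
  have hgq t : sq ze rho t -> gh phi (x + t *: v).
    by move=> ht; have [|] := @H1 x t hx; first exact: in3 hz ht.
  have [l [u [E du nu' hl]]] := @factor_sq _ (ph x) ze rho rho0
     (fun t ht => gh_line (hgq t ht)) (proj1 (hN ze hz)).
  have al a : a \in l -> a = tau ze.
    move=> al; apply: uq => //; first by apply: sqo_sq; exact: hl.
    by rewrite E (big_rem a al) /= subrr !mul0r.
  have l0 : (0 < size l)%N.
    rewrite lt0n; apply/negP => /eqP/size0nil l0.
    by move: h2; rewrite E l0 big_nil mul1r => /eqP; rewrite (negbTE (nu' _ h1)).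
  have AE W : (forall t, sq ze rho t -> cdiff (W x) t) ->
      argi W ze rho x = kq ze rho * ((size l)%:R * W x (tau ze)).
    move=> dW; rewrite (argiE (l := l) (u := u))//; congr (_ * _).
    rewrite (eq_big_seq (fun=> W x (tau ze))); last by move=> a /al ->.
    by rewrite big_const_seq count_predT iter_addr_0 mulr_natl.
  have dW1 t : sq ze rho t -> cdiff (W1 x) t by move=> _; exact: cdiff_cst.
  have A1 : argi W1 ze rho x = kq ze rho * (size l)%:R by rewrite (AE _ dW1) /W1 expr0 mulr1.
  have k0 := kq_neq0 ze rho0.
  have s0 : (size l)%:R != 0 :> C by rewrite pnatr_eq0 -lt0n.
  split=> //; [exact: uq|by rewrite A1 mulf_neq0|].
  by move=> W dW; rewrite (AE _ dW) A1; field; rewrite k0 s0.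
have dW2 x ze t : sq ze rho t -> cdiff (W2 x) t by move=> _; apply: cdiffX; exact: cdiff_id.
have dW3 i x ze t : inB x -> ze \in distinct_roots x0 -> sq ze rho t -> cdiff (W3 i x) t.
  move=> hx hz ht; apply: GH_line; apply: gh_GH.
  by have [|_ hg _ _] := @H1 x t hx; first exact: in3 hz ht.
exists rho, T, h; split=> //.
  move=> ze hz; have [_ hN] := nr_at G.
  have [tau [_ _ /(_ ze hz) [h1 h2 h3 h4]]] := key x0 hx0 hN.
  have hphi t : sqb ze rho t -> gh phi (x0 + t *: v) /\ phi (x0 + t *: v) != 0.
    move=> ht; split; last exact: nz0 hz ht.
    by have [|] := @H1 x0 t hx0; first by apply: in3 hz _; apply: sqb_sq ht; exact: ltW.
  have g1 : gh (argi W1 ze rho) x0.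
    by apply: gh_argi (ltW rho0) _ hphi; apply: nr_all => x t _; exact: W_pow.
  have tz : tau ze = ze.
    symmetry; apply: h2; first by apply: sqo_sq; exact: sqo0.
    by case/distinct_roots_iff: hz.
  split.
  - apply: ghM; last exact: ghV.
    by apply: gh_argi (ltW rho0) _ hphi; apply: nr_all => x t _; exact: W_pow.
  - move=> i; apply: ghM; last exact: ghV.
    apply: gh_argi (ltW rho0) _ hphi; apply: nrW (inB_nr hx0) => x hx t ht.
    have [|_ hg _ _] := @H1 x t hx; first by apply: in3 hz _; apply: sqb_sq ht; exact: ltW.
    split; first by apply: GH_shift; exact: gh_GH.
    by apply: jcont_line; exact: gh_cont.
  - by rewrite /T (h4 W2)// /W2 ?expr1// => t; exact: dW2.
  - by move=> t; exact: in3.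
apply: nrW G => x [hx hN]; have [tau [ut Ei hk]] := key x hx hN.
have TE ze : ze \in distinct_roots x0 -> T ze x = tau ze.
  move=> hz; have [h1 h2 h3 h4] := hk ze hz.
  by rewrite /T (h4 W2)// /W2 ?expr1// => t; exact: dW2.
have mE : map (T^~ x) (distinct_roots x0) = map tau (distinct_roots x0) by apply/eq_in_map => ze; exact: TE.
rewrite mE; split=> // ze hz; have [h1 h2 h3 h4] := hk ze hz; rewrite TE//; split=> // i.
by rewrite /h (h4 (W3 i))// => t ht; exact: dW3 hx hz ht.
Qed.

(** Value at $t=0$ of the monic polynomial whose simple roots are the zeros lying on [Vs].
    Discarding multiplicities and the zeros of [phi] off [Vs] makes it a candidate for a reduced
    equation. *)
Definition fibre_prod x : C := \prod_(t <- distinct_roots x | `[< Vs (x + t *: v) >]) (- t).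

(** Since the zeros are locally holomorphic functions [T ze], it remains to see that lying on [Vs]
    is a locally constant condition for each of them. *)
Lemma fibre_prod_gh x0 nu : inB x0 -> size (distinct_roots x0) = nu ->
  (forall x, inB x -> (size (distinct_roots x) <= nu)%N) -> gh fibre_prod x0.
Proof.
have rr := r0.
move=> hx0 snu hnu.
have [rho [T [h [rho0 hT G]]]] := roots_local hx0 snu hnu.
have Z3 x t : inB x -> t \in distinct_roots x -> sq 0 (3 * r) t by move=> hx /distinct_roots_iff - /(_ hx)[].
(* Off [Vs] this is closedness. On [Vs], a nearby point where one function cuts out [Vs] yields an
   open set of base points whose zero in the given square lies on [Vs]; the functions [h ze i]
   vanish there, hence near [x0] by the identity theorem. *)
have loc ze : ze \in distinct_roots x0 -> nr x0 (fun x => Vs (x + T ze x *: v) <-> Vs (x0 + ze *: v)).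
  move=> hz; have [gT gh_ Tx0 in3] := hT ze hz.
  have [Vz|nVz] := pselect (Vs (x0 + ze *: v)); last first.
    have cT : cont (fun x : V => x + T ze x *: v) x0.
      apply: contVD; first exact: cont_id.
      by apply: contVZ; [exact: gh_cont|exact: cont_cst].
    have := cont_nr (P := fun y => ~ Vs y) cT; rewrite Tx0 => /(_ (Vs_closed nVz)).
    by apply: nrW => x; tauto.
  have hs : sqo 0 (2 * r) ze.
    have : sqo 0 r ze by apply: root_list_sqo hx0 _; rewrite mem_undup in hz.
    by move=> [? ?]; split; lra.
  suff H i : nr x0 (fun x => h ze i x = 0).
    apply: nrW2 (nrI_fin H) G => x hi [hx _ Ei /(_ ze hz) [h1 h2 h3]]; split=> // _.
    have TZ : T ze x \in distinct_roots x by rewrite Ei; apply: map_f.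
    have [|_ _ [_ hV] _] := @H1 x (T ze x) hx; first exact: Z3 hx TZ.
    by apply: hV => j; rewrite -h3.
  have [e e0 he] := nrI G (gh_nr (gh_ i)).
  have hP : nr (x0 + ze *: v) (fun w => dist x0 (w - ze *: v) < e).
    exists e => // w; rewrite !distVE (_ : w - ze *: v - x0 = w - (x0 + ze *: v))//.
    by rewrite opprD addrA addrAC.
  have [w [Pw Vw [g hg Eg]]] := hA2 Vz hP.
  pose x1 := w - ze *: v; have wE : w = x1 + ze *: v by rewrite /x1 subrK.
  have [[hx1 _ _ _] _] := he x1 Pw.
  rewrite wE in Vw hg Eg.
  have O := open_proj hx1 hs Vw hg Eg rho0.
  apply: (@gh_identity _ _ _ x1).
    move=> t /andP[t0 t1].
    have [] // := he (x1 + t%:C%C *: (x0 - x1)); rewrite distVE.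
    have -> : x1 + t%:C%C *: (x0 - x1) - x0 = (1 - t)%:C%C *: (x1 - x0).
      rewrite rmorphB rmorph1 scalerBl scale1r -(opprB x1 x0) scalerN.
      by rewrite addrAC.
    apply: le_lt_trans (nVZ _ _) _; rewrite nc_real ger0_norm; last lra.
    by have := Pw; rewrite -/x1 distVE; have := nV_ge0 (x1 - x0); nra.
  have Px : nr x1 (fun y => dist x0 y < e).
    exists (e - dist x0 x1) => [|y hy]; first by have := Pw; rewrite -/x1; lra.
    by have := dist_tri x0 x1 y; lra.
  apply: nrW2 O Px => y [t ht Vt] /he [[hy _ _ /(_ ze hz) [h1 h2 h3]] _].
  have tq : sq ze rho t by apply: sqo_sq; apply: nc_sqo.
  have t3 := in3 t tq.
  have [_ _ hV hp] := H1 hy t3.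
  have tT := h2 t tq (hp Vt).
  by rewrite h3 -tT; exact: (proj1 hV Vt).
have L : nr x0 (fun x => forall ze, ze \in distinct_roots x0 -> (Vs (x + T ze x *: v) <-> Vs (x0 + ze *: v))).
  exact: nrI_seq loc.
pose s0 := [seq ze <- distinct_roots x0 | `[< Vs (x0 + ze *: v) >]].
apply: (@gh_eq _ _ (fun x => \prod_(ze <- s0) (- T ze x))).
  apply: nrW2 L G => x hL [hx ut Ei hk]; rewrite /fibre_prod.
  have pE : perm_eq (distinct_roots x) (map (T^~ x) (distinct_roots x0)) by apply: uniq_perm; rewrite ?undup_uniq.
  rewrite (perm_big _ pE) /= big_map /s0 big_filter.
  rewrite -big_filter -[RHS]big_filter; congr bigop.body; apply: eq_in_filter => ze hz.
  by apply/asboolP/asboolP => /hL; apply.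
have : forall ze, ze \in s0 -> gh (fun x => - T ze x) x0.
  by move=> ze; rewrite mem_filter => /andP[_ /hT [g1 _ _ _]]; exact: ghN.
elim: s0 => [|ze s0 IH] H.
  by apply: gh_eq (gh_cst 1 x0); apply: nr_all => y; rewrite big_nil.
apply: (@gh_eq _ _ (fun x => - T ze x * \prod_(ze <- s0) (- T ze x))).
  by apply: nr_all => y; rewrite big_cons.
apply: ghM; first by apply: H; exact: mem_head.
by apply: IH => z hz; apply: H; rewrite in_cons hz orbT.
Qed.

Variables (nu : nat) (xm : V).
Hypotheses (hnu : forall x, inB x -> (size (distinct_roots x) <= nu)%N) (hxm : inB xm) (sxm : size (distinct_roots xm) = nu).

(* The Hankel determinant of the power sums detects the points whose fibre has the maximal number of distinct roots. *)
Definition discr x : C := \det (hankel (root_list x) nu).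

Lemma discr_iff x : inB x -> discr x != 0 <-> size (distinct_roots x) = nu.
Proof.
move=> hx; split=> [Dx|]; last exact: hankel_det_neq0.
apply/eqP; rewrite eqn_leq hnu//= leqNgt; apply: contra Dx => h.
by rewrite /discr hankel_det_eq0.
Qed.

Lemma discr_gh x : inB x -> gh discr x.
Proof.
move=> hx.
have E (i j : 'I_nu) : gh (fun y => hankel (root_list y) nu i j) x.
  have := gh_power_sum (i + j) hx.
  by apply: (@gh_eq _ _ _ (fun y => hankel (root_list y) nu i j)); apply: nr_all => y; rewrite mxE.
rewrite /discr /determinant; apply: gh_sum => s; apply: ghM; first exact: gh_cst.
by apply: gh_prod => i; exact: E.
Qed.

Lemma inB_seg x y (t : R) : inB x -> inB y -> 0 <= t <= 1 -> inB (x + t%:C%C *: (y - x)).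
Proof.
rewrite !distVE => hx hy /andP[t0 t1].
have -> : x + t%:C%C *: (y - x) - p = (1 - t)%:C%C *: (x - p) + t%:C%C *: (y - p).
  rewrite rmorphB rmorph1 !scalerBr !scalerBl !scale1r.
  by apply/rowP => i; rewrite !mxE; ring.
apply: le_lt_trans (nVD _ _) _.
apply: le_lt_trans (lerD (nVZ _ _) (nVZ _ _)) _; rewrite !nc_real !ger0_norm; [|lra|lra].
exact: seg_gt.
Qed.

(** [discr] is nonzero at [xm], and the ball is convex, so the identity theorem forbids vanishing on
    an open subset. *)
Lemma discr_dense x P : inB x -> nr x P -> exists y, [/\ P y, inB y & discr y != 0].
Proof.
move=> hx hP; apply: contrapT => H.
have D0 : nr x (fun y => discr y = 0).
  apply: nrW2 hP (inB_nr hx) => y Py hy; apply/eqP/negP => /negP Dy.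
  by apply: H; exists y.
have /nr_at : nr xm (fun y => discr y = 0).
  by apply: gh_identity D0 => t ht; apply: discr_gh; exact: inB_seg.
by apply/eqP; apply/discr_iff.
Qed.

Lemma fibre_prod_gh' x : inB x -> discr x != 0 -> gh fibre_prod x.
Proof. by move=> hx /discr_iff - /(_ hx) E; exact: fibre_prod_gh E hnu. Qed.

(** Boundedness is the input of Riemann's theorem. Adding 1 makes the base at least 1, so that fewer
    than [nu] factors are covered as well. *)
Lemma fibre_prod_bound x : inB x -> nc (fibre_prod x) <= (2 * r + 1) ^+ nu.
Proof.
have rr := r0.
move=> hx; rewrite /fibre_prod nc_prod -big_filter.
set s := [seq _ <- _ | _].
have ss : (size s <= nu)%N by rewrite (leq_trans _ (hnu hx))// size_filter count_size.
have hs t : t \in s -> nc (- t) <= 2 * r + 1.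
  rewrite mem_filter mem_undup => /andP[_ /(root_list_sqo hx) /sqo_sq /(sq_nc (ltW rr))].
  by rewrite subr0 ncN; lra.
have c1 : 1 <= 2 * r + 1 by lra.
apply: (@le_trans _ _ ((2 * r + 1) ^+ size s)); last exact: ler_weXn2l.
elim: s hs {ss} => [|t s IH] hs; first by rewrite big_nil expr0.
rewrite big_cons exprS; apply: ler_pM; rewrite ?nc_ge0//.
- by apply: prodr_ge0 => ? _; exact: nc_ge0.
- by apply: hs; exact: mem_head.
- by apply: IH => u us; apply: hs; rewrite in_cons us orbT.
Qed.

Variable r2 : R.
Local Notation v2 := (xm - p).
Hypotheses (r20 : 0 < r2) (hr2 : forall t, sq 0 r2 t -> inB (p + t *: v2) /\
  (t != 0 -> discr (p + t *: v2) != 0)).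

Definition Good2 x := [/\ inB x, forall t, sq 0 r2 t -> inB (x + t *: v2) &
  forall t, sqb 0 r2 t -> discr (x + t *: v2) != 0].

Lemma sqb_neq0 (s : R) (t : C) : 0 < s -> sqb 0 s t -> t != 0.
Proof. by move=> s0 /sqb_ge h; apply/eqP => E; move: h; rewrite E subrr nc0; lra. Qed.

Lemma Good2_p : nr p Good2.
Proof.
have rr := r20.
have hp : inB p by rewrite dist0.
have A : nr p (fun x => forall t, sq 0 r2 t -> inB (x + t *: v2)).
  apply: sq_tube => [|t ht]; first exact: ltW.
  by apply: (nr_add_line (P := fun y => inB y)); apply: inB_nr; case: (hr2 ht).
have B : nr p (fun x => forall t, sqb 0 r2 t -> discr (x + t *: v2) != 0).
  apply: edge_tube; [lra|lra|] => t ht.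
  have [h1 h2] := hr2 (sqb_sq (ltW rr) ht).
  apply: (nr_add_line (P := fun y => discr y != 0)); apply: cont_neq0.
    by apply: gh_cont; exact: discr_gh.
  by apply: h2; exact: sqb_neq0 ht.
by apply: nrW2 (nrI (inB_nr hp) A) B => x [h1 h2] h3; split.
Qed.

(* The Cauchy integral in the direction v2, along which discr is not identically 0, extends fibre_prod across {discr = 0}. *)
Definition fibre_ext x : C := (kq 0 r2)^-1 * oq (fun t => fibre_prod (x + t *: v2) * (t - 0)^-1) 0 r2.

Lemma fibre_ext_gh x : nr x Good2 -> gh fibre_ext x.
Proof.
have rr := r20.
move=> hx; apply: ghM; first exact: gh_cst.
apply: gh_oint; [lra|lra|]; apply: nrW hx => y [h1 h2 h3] t ht.
have hq := sqb_sq (ltW rr) ht.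
have hF : gh fibre_prod (y + t *: v2) by apply: fibre_prod_gh'; [exact: h2|exact: h3].
split; first by apply: GHM; [apply: GH_shift; exact: gh_GH|exact: GH_cst].
apply: contM; first by apply: jcont_line; exact: gh_cont.
apply: contV; first by rewrite subr0; exact: sqb_neq0 ht.
by apply: contB; [exact: cont_snd|exact: cont_cst].
Qed.

(** On the line of direction [v2] through [x] the zeros of [discr] are finitely many removable
    singularities of the bounded function [fibre_prod]; Cauchy's formula then returns the value at
    0, which is not one of them. *)
Lemma fibre_ext_eq x : Good2 x -> discr x != 0 -> fibre_ext x = fibre_prod x.
Proof.
have rr := r20.
move=> [h1 h2 h3] Dx.
have [l [u [E du nu' hl]]] : exists l u, [/\ forall z, discr (x + z *: v2) = (\prod_(a <- l) (z - a)) * u z,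
    forall z, cdiff (fun z => discr (x + z *: v2)) z -> cdiff u z, forall z, sq 0 r2 z -> u z != 0 &
    forall a, a \in l -> sqo 0 r2 a].
  apply: factor_sq => // t ht.
  by apply: (gh_line (f := discr)); apply: discr_gh; exact: h2.
have Dl t : sq 0 r2 t -> t \notin undup l -> discr (x + t *: v2) != 0.
  move=> ht tl; rewrite E mulf_neq0 ?nu'// prodf_seq_neq0; apply/allP => a al /=.
  by rewrite subr_eq0; apply: contraNneq tl => ->; rewrite mem_undup.
have lD t : discr (x + t *: v2) != 0 -> t \notin undup l.
  rewrite mem_undup; apply: contra => tl.
  by rewrite E (big_rem t tl) /= subrr !mul0r.
have [|||g dg gE] := @removable _ (fun t => fibre_prod (x + t *: v2)) (undup l) 0 r2 ((2 * r + 1) ^+ nu) (undup_uniq l).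
- by move=> a; rewrite mem_undup; exact: hl.
- move=> t ht tl; apply: (GH_line (f := fibre_prod)); apply: gh_GH; apply: fibre_prod_gh'; first exact: h2.
  exact: Dl.
- by move=> t ht _; apply: fibre_prod_bound; exact: h2.
rewrite /fibre_ext.
have -> : oq (fun t => fibre_prod (x + t *: v2) * (t - 0)^-1) 0 r2 = oq (fun t => g t / (t - 0)) 0 r2.
  by apply: oint_ext => t ht; rewrite gE//; apply: lD; exact: h3.
rewrite /oq (cauchy_formula (sqo0 0 rr) dg) -/(kq 0 r2) mulKf ?kq_neq0//.
by rewrite gE ?scale0r ?addr0//; apply: lD; rewrite scale0r addr0.
Qed.

Lemma fibre_ext_zero x : nr x Good2 -> Vs x -> fibre_ext x = 0.
Proof.
have rr := r0.
move=> hG Vx; apply/eqP/negP => /negP Fx.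
have N := nrI hG (cont_neq0 (gh_cont (fibre_ext_gh hG)) Fx).
have [w [Pw Vw [g hg Eg]]] := hA2 Vx (nr_nr N).
have [[hw _ _] _] := nr_at Pw.
have := nr_add_line (v := v) (x := w) (t := 0) (P := fun y => Good2 y /\ fibre_ext y != 0).
rewrite scale0r addr0 => /(_ Pw) [d d0 hd].
have e0 : 0 < Num.min d r by rewrite lt_min d0.
have s0 : sqo 0 (2 * r) 0 by apply: sqo0; lra.
have := @open_proj w 0 g (Num.min d r) hw s0; rewrite scale0r addr0 => /(_ Vw hg Eg e0) O.
have [w' [[[t ht Vt] dw] hw' Dw']] := discr_dense hw (nrI O (nr_dist w d0)).
move: ht; rewrite lt_min subr0 => /andP[td tr].
have [G2y Fy] : Good2 (w' + t *: v) /\ fibre_ext (w' + t *: v) != 0.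
  by apply: (hd (w', t)); rewrite /= gt_max subr0; apply/andP; split.
have hy : inB (w' + t *: v) by case: G2y.
have ts : sqo 0 r t by apply: nc_sqo; rewrite subr0.
have Dy : discr (w' + t *: v) != 0.
  by apply/discr_iff => //; rewrite size_Z_shift//; apply/discr_iff.
move: Fy; rewrite fibre_ext_eq//; set y := w' + t *: v in hy Vt *.
have z3 : sq 0 (3 * r) 0 by apply: sqo_sq; apply: sqo0; lra.
have y0 : y + 0 *: v = y by rewrite scale0r addr0.
have Z0 : 0 \in distinct_roots y.
  apply/distinct_roots_iff => //; split=> //; rewrite /ph y0.
  by have [_ _ _] := H1 hy z3; rewrite y0; apply.
rewrite /fibre_prod -big_filter (big_rem 0) /=; first by rewrite oppr0 mul0r eqxx.
by rewrite mem_filter Z0 andbT; apply/asboolP; rewrite y0.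
Qed.

(** If [phi] is nonzero at [x], the zeros on nearby lines stay away from $t=0$ by at least [eta]. So
    the product has modulus at least [eta ^+ nu] at generic points, and by continuity the extension
    cannot vanish at [x]. *)
Lemma fibre_ext_neq0 x : nr x Good2 -> phi x != 0 -> fibre_ext x != 0.
Proof.
move=> hG px; have [hx _ _] := nr_at hG.
have z3 : sq 0 (3 * r) 0 by apply: sqo_sq; apply: sqo0; have := r0; lra.
have cp : cont phi x.
  by have [h _ _ _] := H1 hx z3; rewrite scale0r addr0 in h; exact: gh_cont.
have [d d0 hd] := cont_neq0 cp px.
have v0 := nV_ge0 v.
(* Kept at most 1, so that [eta ^+ nu] bounds products with fewer than [nu] factors too. *)
pose eta := Num.min 1 (d / (2 * (nV v + 1))).
have w0 : 0 < 2 * (nV v + 1) by lra.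
have eta0 : 0 < eta by rewrite lt_min ltr01 divr_gt0.
have eta1 : eta <= 1 by rewrite ge_min lexx.
have bnd y : Good2 y -> discr y != 0 -> dist x y < d / 2 -> eta ^+ nu <= nc (fibre_ext y).
  move=> G2y Dy dy; rewrite fibre_ext_eq//; have [hy _ _] := G2y.
  rewrite /fibre_prod nc_prod -big_filter; set s := [seq _ <- _ | _].
  have ss : (size s <= nu)%N by rewrite (leq_trans _ (hnu hy))// size_filter count_size.
  have hs t : t \in s -> eta <= nc (- t).
    rewrite mem_filter ncN => /andP[_ /(distinct_roots_iff _ hy) [_ h0]].
    rewrite leNgt; apply/negP => lt.
    have : phi (y + t *: v) != 0.
      apply: hd; rewrite distVE (_ : _ - x = (y - x) + t *: v); last by rewrite addrAC.
      apply: le_lt_trans (nVD _ _) _; have := nVZ t v; rewrite distVE in dy.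
      have : nc t * (2 * (nV v + 1)) <= d.
        rewrite -ler_pdivlMr//; apply: le_trans (ltW lt) _.
        by rewrite ge_min lexx orbT.
      have := nc_ge0 t; nra.
    by rewrite -/(ph y t) h0 eqxx.
  apply: (@le_trans _ _ (eta ^+ size s)).
    by apply: ler_wiXn2l => //; exact: ltW.
  elim: s hs {ss} => [|t s IH] hs; first by rewrite big_nil expr0.
  rewrite big_cons exprS; apply: ler_pM; rewrite ?exprn_ge0 ?(ltW eta0)//.
    by apply: hs; exact: mem_head.
  by apply: IH => u us; apply: hs; rewrite in_cons us orbT.
apply/eqP => F0.
have e0 : 0 < eta ^+ nu by rewrite exprn_gt0.
have d2 : 0 < d / 2 by lra.
have N := nrI (nrI (gh_cont (fibre_ext_gh hG) e0) hG) (nr_dist x d2).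
have [y [[[Fy G2y] dy] hy Dy]] := discr_dense hx N.
by have := bnd y G2y Dy dy; move: Fy; rewrite distCE F0 subr0; lra.
Qed.

(** Along a generic line the extension is a Weierstrass polynomial with simple roots: translating
    the base point turns the constant term into the value at [t]. *)
Lemma fibre_ext_factor x t : discr x != 0 -> inB x -> sqo 0 r t -> Good2 (x + t *: v) ->
  fibre_ext (x + t *: v) = \prod_(b <- [seq b <- distinct_roots x | `[< Vs (x + b *: v) >]]) (t - b).
Proof.
move=> Dx hx ts G2; have [hy _ _] := G2.
have Dy : discr (x + t *: v) != 0.
  by apply/discr_iff => //; rewrite size_Z_shift//; apply/discr_iff.
rewrite fibre_ext_eq// /fibre_prod.
have pE : perm_eq (distinct_roots x) (map (fun a => a + t) (distinct_roots (x + t *: v))).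
  apply: uniq_perm; rewrite ?undup_uniq//.
    by rewrite map_inj_uniq ?undup_uniq//; exact: addIr.
  move=> b; apply/idP/mapP => [hb|[a /distinct_roots_shift h ->]]; last exact: h.
  by exists (b - t); rewrite ?subrK//; apply/distinct_roots_shift => //; rewrite subrK.
rewrite big_filter (perm_big _ pE) /= big_map.
have E a : x + t *: v + a *: v = x + (a + t) *: v by rewrite -addrA -scalerDl [t + a]addrC.
apply: eq_big => [a|a _]; first by rewrite E.
by rewrite opprD addrCA subrr addr0.
Qed.

(** The quotient is defined by a Cauchy integral along [v] over a contour where [fibre_ext] has no
    zeros, so it is holomorphic without any divisibility. On generic lines the roots are simple and
    lie on [Vs], where [G] vanishes, so the integral is the true quotient; density and continuity do
    the rest. *)
Lemma fibre_ext_divides q G : nr q Good2 -> gh G q -> nr q (fun y => Vs y -> G y = 0) ->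
  exists2 H, gh H q & nr q (fun y => G y = H y * fibre_ext y).
Proof.
have rr := r0.
move=> hq hG GV; have [hqB _ _] := nr_at hq.
pose N y := [/\ gh G y, Vs y -> G y = 0 & nr y Good2].
have nN : nr q N by apply: nrW2 (nrI (gh_nr hG) GV) (nr_nr hq) => y [h1 h2] h3; split.
have s2 : sq 0 (2 * r) 0 by apply: sqo_sq; apply: sqo0; lra.
have c0 : nr (0 : C) (fun t => nr (q + t *: v) N).
  by apply: (cont_nr (P := fun y => nr y N) (cont_line q v 0)); rewrite scale0r addr0; exact: nr_nr.
have Fz : nr (0 : C) (fun t => t != 0 -> fibre_ext (q + t *: v) != 0).
  apply: nrW2 c0 (line_nonzero hqB s2) => t /nr_at [_ _ h3] pt t0.
  by apply: fibre_ext_neq0 => //; exact: pt.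
have [eta eta0 he] := nr_sq (nrI (nrI c0 Fz) (inro_open (sqo0 0 rr))).
have A : nr q (fun x => forall t, sq 0 eta t -> N (x + t *: v)).
  apply: sq_tube => [|t ht]; first exact: ltW.
  by apply: nr_add_line; have [[]] := he t ht.
have B : nr q (fun x => forall t, sqb 0 eta t -> fibre_ext (x + t *: v) != 0).
  apply: edge_tube; [lra|lra|] => t ht; have [[h1 h2] _] := he t (sqb_sq (ltW eta0) ht).
  apply: (nr_add_line (P := fun y => fibre_ext y != 0)); apply: cont_neq0.
    by apply: gh_cont; apply: fibre_ext_gh; case: (nr_at h1).
  by apply: h2; exact: sqb_neq0 ht.
pose H x := (kq 0 eta)^-1 * oq (fun t => G (x + t *: v) * (fibre_ext (x + t *: v))^-1 * (t - 0)^-1) 0 eta.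
have hH : gh H q.
  apply: ghM; first exact: gh_cst.
  apply: gh_oint; [lra|lra|]; apply: nrW2 A B => x hA hB t ht.
  have [g1 _ g3] := hA t (sqb_sq (ltW eta0) ht); have Fn := hB t ht.
  have gF := fibre_ext_gh g3.
  split.
    apply: GHM; last exact: GH_cst.
    apply: GHM; first by apply: GH_shift; exact: gh_GH.
    by apply: GHV => //; apply: GH_shift; exact: gh_GH.
  apply: contM.
    apply: contM; first by apply: jcont_line; exact: gh_cont.
    by apply: contV => //; apply: jcont_line; exact: gh_cont.
  apply: contV; first by rewrite subr0; exact: sqb_neq0 ht.
  by apply: contB; [exact: cont_snd|exact: cont_cst].
exists H => //.
have s0 := sqo_sq (sqo0 (0 : C) eta0).
have key x : inB x -> discr x != 0 -> (forall t, sq 0 eta t -> N (x + t *: v)) ->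
    (forall t, sqb 0 eta t -> fibre_ext (x + t *: v) != 0) -> G x = H x * fibre_ext x.
  move=> hx Dx hN hB.
  pose L := [seq b <- distinct_roots x | `[< Vs (x + b *: v) >]].
  have FE t : sq 0 eta t -> fibre_ext (x + t *: v) = \prod_(b <- L) (t - b).
    move=> ht; apply: fibre_ext_factor => //; first by have [_] := he t ht.
    by have [_ _ /nr_at] := hN t ht.
  pose L1 := [seq b <- L | `[< sq 0 eta b >]].
  have L1P b : b \in L1 -> sq 0 eta b /\ Vs (x + b *: v).
    by rewrite !mem_filter => /andP[/asboolP h1 /andP[/asboolP h2 _]].
  have uL1 : uniq L1 by rewrite !filter_uniq// undup_uniq.
  have [|g gE dg] := @divide_list _ (fun t => G (x + t *: v)) L1 uL1.
    move=> b /L1P [hb Vb]; have [h1 h2 _] := hN b hb.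
    by split; [exact: gh_line|exact: h2].
  (* The roots outside the closed square give a factor without zeros on it. *)
  pose P2 (t : C) := \prod_(b <- [seq b <- L | ~~ `[< sq 0 eta b >]]) (t - b).
  have P2n t : sq 0 eta t -> P2 t != 0.
    move=> ht; rewrite /P2 prodf_seq_neq0; apply/allP => b.
    rewrite mem_filter => /andP[/asboolP nb _] /=; rewrite subr_eq0.
    by apply/eqP => E; apply: nb; rewrite -E.
  have LE t : \prod_(b <- L) (t - b) = (\prod_(b <- L1) (t - b)) * P2 t.
    by rewrite /L1 /P2 ![in RHS]big_filter [LHS](bigID (fun b => `[< sq 0 eta b >])).
  have dQ t : sq 0 eta t -> cdiff (fun t => g t / P2 t) t.
    move=> ht; apply: cdiffM.
      by apply: dg; have [h1 _ _] := hN t ht; apply: nr_at (gh_line h1).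
    apply: cdiffV; first exact: P2n.
    by apply: cdiff_prod => b; apply: cdiffB; [exact: cdiff_id|exact: cdiff_cst].
  have HE : H x = g 0 / P2 0.
    rewrite /H.
    have -> : oq (fun t => G (x + t *: v) * (fibre_ext (x + t *: v))^-1 * (t - 0)^-1) 0 eta =
        oq (fun t => g t / P2 t / (t - 0)) 0 eta.
      apply: oint_ext => t ht; have hs := sqb_sq (ltW eta0) ht.
      congr (_ * _); have := hB t ht; rewrite FE// LE gE => /[dup].
      rewrite mulf_eq0 negb_or => /andP[n1 n2] n3.
      by field; rewrite n1 n2.
    by rewrite /oq (cauchy_formula (sqo0 0 eta0) dQ) -/(kq 0 eta) mulKf ?kq_neq0.
  have := FE 0 s0; rewrite scale0r addr0 => ->; rewrite LE HE.
  have := gE 0; rewrite scale0r addr0 => ->.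
  by field; exact: P2n.
apply: nrW2 (nrI (nr_nr A) (nr_nr B)) (nrI (nr_nr (inB_nr hqB)) (nrI (gh_nr hH) (nr_nr hq))) =>
  x [hA hB] [hx [hHx hGx]].
apply/eqP; rewrite -subr_eq0; apply/negP => /negP ne.
have [gx _ _] := nr_at hA 0 s0; rewrite scale0r addr0 in gx.
have cE : cont (fun y => G y - H y * fibre_ext y) x.
  apply: contB; first exact: gh_cont.
  by apply: contM; [exact: gh_cont|apply: gh_cont; exact: fibre_ext_gh].
have [y [[n1 [n2 n3]] hy Dy]] := discr_dense (nr_at hx) (nrI (cont_neq0 cE ne) (nrI hA hB)).
by move: n1; rewrite (key y hy Dy n2 n3) subrr eqxx.
Qed.

Lemma fibre_ext_gen q : nr q Good2 -> generates fibre_ext q.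
Proof.
move=> hq; split; first exact: fibre_ext_gh.
  by apply: nrW (nr_nr hq) => y; exact: fibre_ext_zero.
by move=> G; exact: fibre_ext_divides.
Qed.

End Fibre.
(** Off [Vs] the constant 1 generates. At a point of [Vs], some local equation [phi] is not
    identically zero, and [v] points to a place where it is nonzero; the second direction points to
    a base point with the largest number of distinct zeros. *)
Lemma generator_exists p : exists F, nr p (generates F).
Proof.
have [Vp|nVp] := pselect (Vs p); last first.
  exists (fun _ => 1); apply: nrW (nr_nr (Vs_closed nVp)) => q hq; split.
  - exact: gh_cst.
  - by apply: nrW hq.
  - by move=> G hG _; exists G => //; apply: nr_all => y; rewrite mulr1.
have [m [fs [hfs E]]] := hA1 p.
have [i hi] : exists i, ~ nr p (fun y => fs i y = 0).
  apply: contrapT => H; apply: (hA3 (x := p)).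
  have H' j : nr p (fun y => fs j y = 0) by apply: contrapT => h; apply: H; exists j.
  by apply: nrW2 E (nrI_fin H') => y E hy; apply/E.
pose phi := fs i.
pose N y := (forall j, gh (fs j) y) /\ (Vs y <-> forall j, fs j y = 0).
have nN : nr p N by apply: nrI E; apply: nrI_fin => j; exact: gh_nr.
have [e e0 he] := nN.
have [y dy py] : exists2 y, dist p y < e & phi y != 0.
  apply: contrapT => H; apply: hi; exists e => // y dy.
  by apply/eqP/negP => /negP h; apply: H; exists y.
pose v := y - p.
have cN t : nr (p + t *: v) N -> nr t (fun s => nr (p + s *: v) N).
  by move=> h; apply: (cont_nr (P := fun y => nr y N) (cont_line p v t)); exact: nr_nr.
have N0 : nr (0 : C) (fun s => nr (p + s *: v) N) by apply: cN; rewrite scale0r addr0.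
have L0 : nr (0 : C) (fun t => t != 0 -> phi (p + t *: v) != 0).
  have gl : nr (0 : C) (cdiff (fun t => phi (p + t *: v))).
    by apply: gh_line; rewrite scale0r addr0; exact: hfs.
  have [hz|//] := isolated_nr gl; exfalso.
  have /nr_at : nr (1 : C) (fun t => phi (p + t *: v) = 0).
    apply: identity_seg hz => t /andP[t0 t1]; rewrite subr0 mulr1 add0r.
    apply: gh_line; have [|h1 _] := he (p + t%:C%C *: v); last exact: h1.
    rewrite distVE addrC addKr; apply: le_lt_trans (nVZ _ _) _.
    by rewrite nc_real ger0_norm//; rewrite distVE in dy; have := nV_ge0 v; rewrite /v in dy *; nra.
  by rewrite /= scale1r /v subrKC; apply/eqP.
have [R0 R00 hR] := nr_sq (nrI N0 L0).
pose r := R0 / 3; have r0 : 0 < r by rewrite /r; lra.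
have r3 : 3 * r = R0 by rewrite /r; lra.
have A : nr p (fun x => forall t, sq 0 (3 * r) t -> N (x + t *: v)).
  apply: sq_tube => [|t]; first lra.
  by rewrite r3 => /hR [h _]; exact: nr_add_line.
have B : nr p (fun x => forall t, sq 0 (3 * r) t -> ~ sqo 0 r t -> phi (x + t *: v) != 0).
  have r30 : 0 <= 3 * r by lra.
  apply: (sq_tube (A := metV n) (x0 := p) (Q := fun (x : V) (t : C) => ~ sqo 0 r t -> phi (x + t *: v) != 0) r30) => t.
  rewrite r3 => /hR [h1 h2].
  have [ht|ht] := pselect (sqo 0 r t).
    have := cont_nr (P := sqo 0 r) (cont_snd ((p, t) : metP (metV n) metC)) (inro_open ht).
    by apply: nrW => q hq nq; case: nq.
  have t0 : t != 0 by apply/eqP => t0; apply: ht; rewrite t0; exact: sqo0.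
  have cp : cont phi (p + t *: v) by apply: gh_cont; case: (nr_at h1) => h _; exact: h.
  apply: nrW (nr_add_line (cont_neq0 cp (h2 t0))) => q hq _; exact: hq.
have [be be0 hbe] := nrI A B.
have H1 x t : dist p x < be -> sq 0 (3 * r) t ->
  [/\ gh phi (x + t *: v), forall i, gh (fs i) (x + t *: v),
      Vs (x + t *: v) <-> (forall i, fs i (x + t *: v) = 0) &
      Vs (x + t *: v) -> phi (x + t *: v) = 0].
  move=> /hbe [h _] /h [h1 h2]; split=> //; first exact: h1.
  by move=> /h2 h3; exact: h3.
have H2 x t : dist p x < be -> sq 0 (3 * r) t -> ~ sqo 0 r t -> phi (x + t *: v) != 0.
  by move=> /hbe [_ h]; exact: h.
have [be1 be10 hbe1] := size_zl_near r0 be0 H1 H2.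
pose be2 := Num.min be be1; have be20 : 0 < be2 by rewrite lt_min be0.
have sub x : dist p x < be2 -> dist p x < be by rewrite lt_min => /andP[].
have {}H1 x t (hx : dist p x < be2) := H1 x t (sub x hx).
have {}H2 x t (hx : dist p x < be2) := H2 x t (sub x hx).
pose Zx := distinct_roots v phi r.
(* The numbers of distinct zeros that occur over the ball; they are bounded by the number of zeros
   at [p] with multiplicity, so a largest one exists. *)
pose K := fun k : nat => `[< exists2 x, dist p x < be2 & size (Zx x) = k >].
have exK : exists k, K k by exists (size (Zx p)); apply/asboolP; exists p => //; rewrite dist0.
have bK k : K k -> (k <= size (root_list v phi r p))%N.
  move=> /asboolP [x hx <-]; apply: leq_trans (size_undup _) _; apply: hbe1.
  by move: hx; rewrite lt_min => /andP[].
case: (ex_maxnP exK bK) => nu /asboolP [xm hxm sxm] maxnu.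
have hnu x : dist p x < be2 -> (size (Zx x) <= nu)%N.
  by move=> hx; apply: maxnu; apply/asboolP; exists x.
pose v2 := xm - p.
pose Dx := discr v phi r nu.
have gD x : dist p x < be2 -> gh Dx x by move=> hx; apply: (discr_gh r0 H1 H2).
have hp : dist p p < be2 by rewrite dist0.
have L2 : nr (0 : C) (fun t => t != 0 -> Dx (p + t *: v2) != 0).
  have gl : nr (0 : C) (cdiff (fun t => Dx (p + t *: v2))).
    by apply: gh_line; rewrite scale0r addr0; exact: gD.
  have [hz|//] := isolated_nr gl; exfalso.
  have /nr_at : nr (1 : C) (fun t => Dx (p + t *: v2) = 0).
    apply: identity_seg hz => t ht; rewrite subr0 mulr1 add0r.
    by apply: gh_line; apply: gD; apply: inB_seg.
  by rewrite /= scale1r /v2 subrKC; apply/eqP; apply/(discr_iff hnu hxm).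
have B2 : nr (0 : C) (fun t => dist p (p + t *: v2) < be2).
  apply: (cont_nr (P := fun y => dist p y < be2) (cont_line p v2 0)).
  by rewrite scale0r addr0; apply: inB_nr.
have [r2 r20 hr2] := nr_sq (nrI B2 L2).
exists (fibre_ext p v phi r xm r2).
apply: nrW (nr_nr (Good2_p r0 be20 H1 H2 r20 hr2)) => q hq.
exact: (fibre_ext_gen r0 H1 H2 hnu hxm sxm r20).
Qed.

End LocalGenerator.

(** * Complex exponential and principal logarithm *)

Section ExpLog.
Context {R : realType}.
Local Notation C := R[i].

Lemma cont_of_continuous (f : R -> R) (x : R) : {for x, continuous f} -> cont f x.
Proof.
move=> /cvgrPdist_lt h e /h /nbhs_ballP [d d0 hd]; exists d => // y hy.
rewrite distRE distrC; apply: hd; rewrite /ball /= distrC; exact: hy.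
Qed.

Lemma deriv_eps (f : R -> R) (x d : R) : is_derive x 1 f d -> forall e, 0 < e ->
  exists2 dl, 0 < dl & forall h, `|h| < dl -> `|f (x + h) - f x - d * h| <= e * `|h|.
Proof.
move=> [df dv] e e0.
have /cvgrPdist_lt /(_ e e0) := df; rewrite -/(derive f x 1) dv.
move=> /nbhs_ballP [dl dl0 hd]; exists dl => // h hh.
have [->|h0] := eqVneq h 0; first by rewrite addr0 subrr mulr0 subrr normr0 mulr0.
have := hd h; rewrite /ball /= sub0r normrN => /(_ hh h0).
rewrite /GRing.scale /= mulr1 (addrC h x) distrC => H.
have -> : f (x + h) - f x - d * h = (h^-1 * (f (x + h) - f x) - d) * h by field.
by rewrite normrM ler_wpM2r// ltW.
Qed.

Definition cexp (z : C) : C := Complex (expR (re z) * cos (im z)) (expR (re z) * sin (im z)).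

Lemma cexpD z w : cexp (z + w) = cexp z * cexp w.
Proof.
apply: c_eq; rewrite ?reM ?imM /cexp /= reD imD expRD ?cosD ?sinD; ring.
Qed.
Lemma cexp0 : cexp 0 = 1.
Proof. by rewrite /cexp /= expR0 cos0 sin0 !mul1r. Qed.
Lemma cexp_neq0 z : cexp z != 0.
Proof.
have : cexp z * cexp (- z) = 1 by rewrite -cexpD subrr cexp0.
by move=> h; apply/eqP => E; move: h; rewrite E mul0r => /eqP; rewrite eq_sym oner_eq0.
Qed.
Lemma cexpN z : cexp (- z) = (cexp z)^-1.
Proof.
have h : cexp z * cexp (- z) = 1 by rewrite -cexpD subrr cexp0.
by apply: (mulfI (cexp_neq0 z)); rewrite h mulfV// cexp_neq0.
Qed.

Lemma cder_cexp0 : cder cexp 0 1.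
Proof.
apply: eps_cder => e e0; pose e' := Num.min (e / 12) 1.
have e'0 : 0 < e' by rewrite lt_min ltr01 andbT; lra.
have e'1 : e' <= 1 by rewrite ge_min lexx orbT.
have e'2 : e' <= e / 12 by rewrite ge_min lexx.
have [d1 d10 h1] := deriv_eps (is_derive_expR (0 : R)) e'0.
have [d2 d20 h2] := deriv_eps (is_derive_cos (0 : R)) e'0.
have [d3 d30 h3] := deriv_eps (is_derive_sin (0 : R)) e'0.
exists (Num.min (Num.min d1 d2) (Num.min d3 (e' / 2))).
  by rewrite !lt_min d10 d20 d30; lra.
move=> h; rewrite distCE !subr0 cexp0 mul1r !lt_min => /andP[/andP[n1 n2] /andP[n3 n4]].
have ha := Re_le_nc h; have hb := Im_le_nc h.
set a := re h in ha *; set b := im h in hb *.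
have g1 : `|expR a - 1 - a| <= e' * `|a|.
  by have := h1 a (le_lt_trans ha n1); rewrite add0r expR0 mul1r.
have g2 : `|cos b - 1| <= e' * `|b|.
  by have := h2 b (le_lt_trans hb n2); rewrite add0r cos0 sin0 oppr0 mul0r subr0.
have g3 : `|sin b - b| <= e' * `|b|.
  by have := h3 b (le_lt_trans hb n3); rewrite add0r cos0 sin0 mul1r subr0.
have ea : `|expR a - 1| <= e'.
  have : `|expR a - 1| <= `|expR a - 1 - a| + `|a|.
    by have := ler_normD (expR a - 1 - a) a; rewrite subrK.
  have : e' * `|a| <= 1 * `|a| by rewrite ler_wpM2r.
  lra.
have ea2 : `|expR a| <= 2.
  by have := ler_normD (expR a - 1) 1; rewrite subrK normr1; lra.
have -> : cexp h - 1 - h = Complex ((expR a - 1 - a) + expR a * (cos b - 1))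
    (expR a * (sin b - b) + b * (expR a - 1)).
  apply: c_eq; rewrite !(reD, imD, reN, imN) /cexp /= -/a -/b; ring.
apply: le_trans (nc_le _) _ => /=.
have t1 : `|expR a * (cos b - 1)| <= 2 * (e' * `|b|) by rewrite normrM ler_pM.
have t2 : `|expR a * (sin b - b)| <= 2 * (e' * `|b|) by rewrite normrM ler_pM.
have t3 : `|b * (expR a - 1)| <= `|b| * e' by rewrite normrM ler_wpM2l.
have t4 := ler_normD (expR a - 1 - a) (expR a * (cos b - 1)).
have t5 := ler_normD (expR a * (sin b - b)) (b * (expR a - 1)).
have t6 : e' * `|a| <= e' * nc h by rewrite ler_wpM2l// ltW.
have t7 : e' * `|b| <= e' * nc h by rewrite ler_wpM2l// ltW.
have t8 : e' * nc h <= e / 12 * nc h by rewrite ler_wpM2r ?nc_ge0.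
have t9 : 0 <= e / 12 * nc h by rewrite mulr_ge0 ?nc_ge0//; lra.
lra.
Qed.

Lemma cder_cexp z : cder cexp z (cexp z).
Proof.
have k : cder (fun w => w - z) z 1.
  by have := cderD (cder_id z) (cder_cst (- z) z); rewrite addr0.
have h : cder cexp (z - z) 1 by rewrite subrr; exact: cder_cexp0.
have := cderM (cder_cst (cexp z) z) (cder_comp (f := fun w => w - z) (g := cexp) k h).
rewrite !mulr1 mul0r add0r; apply: cder_eq; apply: nr_all => w.
by rewrite -cexpD subrKC.
Qed.
Lemma cdiff_cexp z : cdiff cexp z. Proof. by exists (cexp z); exact: cder_cexp. Qed.

(** Meant for the right half-plane only, where the arctangent of the slope is the argument. *)
Definition clog (w : C) : C := Complex (ln (nc w)) (atan (im w / re w)).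

Lemma clogK w : 0 < re w -> cexp (clog w) = w.
Proof.
case: w => x y /= x0; have n0 : 0 < nc (Complex x y).
  by rewrite nc_gt0; apply/eqP => -[E _]; rewrite E ltxx in x0.
rewrite /cexp /clog /= lnK//.
have s0 : 0 < Num.sqrt (1 + (y / x) ^+ 2) by rewrite sqrtr_gt0 ltr_pwDl// sqr_ge0.
have nE : nc (Complex x y) = x * Num.sqrt (1 + (y / x) ^+ 2).
  rewrite /nc /= -{2}(ger0_norm (ltW x0)) -sqrtr_sqr -sqrtrM ?sqr_ge0//.
  by congr Num.sqrt; field; rewrite gt_eqF.
have c0 : cos (atan (y / x)) = (Num.sqrt (1 + (y / x) ^+ 2))^-1 by exact: cos_atan.
have si : sin (atan (y / x)) = (y / x) * (Num.sqrt (1 + (y / x) ^+ 2))^-1.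
  rewrite -c0 -{2}(atanK (y / x)) /tan divfK// c0 invr_eq0 gt_eqF//.
by rewrite c0 si nE; congr Complex; field; rewrite ?gt_eqF.
Qed.

Lemma cont_re (z : C) : cont (fun w : C => re w) z.
Proof.
move=> e e0; exists e => // w; rewrite distCE distRE; apply: le_lt_trans.
by have := Re_le_nc (w - z); rewrite reD reN.
Qed.
Lemma cont_im (z : C) : cont (fun w : C => im w) z.
Proof.
move=> e e0; exists e => // w; rewrite distCE distRE; apply: le_lt_trans.
by have := Im_le_nc (w - z); rewrite imD imN.
Qed.
Lemma cont_nc (z : C) : cont (fun w : C => nc w) z.
Proof.
move=> e e0; exists e => // w; rewrite distCE distRE => h; rewrite ltr_norml.
by have := nc_sub w z; have := nc_sub z w; rewrite (ncB z w); lra.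
Qed.
Lemma cont_real (x : R) : cont (fun t : R => t%:C%C) x.
Proof. by move=> e e0; exists e => // y; rewrite distCE -rmorphB nc_real. Qed.

Lemma cont_clog w : 0 < re w -> cont clog w.
Proof.
move=> w0; have n0 : 0 < nc w.
  by rewrite nc_gt0; apply/eqP => E; move: w0; rewrite E ltxx.
apply: cont_complex.
  apply: (cont_comp (f := fun w : C => nc w) (g := @ln R) (cont_nc w)).
  by apply: cont_of_continuous; exact: continuous_ln.
have cq : cont (fun w : C => im w / re w) w.
  have : cont (fun w : C => (im w)%:C%C * ((re w)%:C%C)^-1) w.
    apply: contM; first exact: (cont_comp (g := fun t : R => t%:C%C) (cont_im w) (cont_real _)).
    apply: contV; first by apply/eqP => -[E]; rewrite E ltxx in w0.
    exact: (cont_comp (g := fun t : R => t%:C%C) (cont_re w) (cont_real _)).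
  move=> h; have := cont_comp (g := fun z : C => re z) h (cont_re _).
  apply: cont_eq; apply: nr_all => y.
  by rewrite -fmorphV -rmorphM.
apply: (cont_comp (g := @atan R) cq).
by apply: cont_of_continuous; exact: continuous_atan.
Qed.

Lemma re_pos_nr (w : C) : 0 < re w -> nr w (fun y => 0 < re y).
Proof.
move=> w0; exists (re w) => // y; rewrite distCE => h.
by have := le_lt_trans (Re_le_nc _) h; rewrite reD reN ltr_norml; lra.
Qed.

(** Inverse function rule in Caratheodory form: the slope function of [cexp], composed with [clog],
    is inverted. *)
Lemma cdiff_clog w : 0 < re w -> cdiff clog w.
Proof.
move=> w0; have [psi [cp pw hp]] := cder_cexp (clog w).
have cl := cont_clog w0.
have cpl : cont (fun y => psi (clog y)) w by exact: cont_comp cl cp.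
have pn : psi (clog w) != 0 by rewrite pw cexp_neq0.
exists (psi (clog w))^-1, (fun y => (psi (clog y))^-1); split=> //; first exact: contV.
apply: nrW2 (nrI (cont_nr cl hp) (cont_neq0 cpl pn)) (re_pos_nr w0) => y [E n] y0.
move: E; rewrite !clogK// => E.
have := congr1 (fun t => t - w) E; rewrite [RHS]addrC addKr => ->.
by field.
Qed.

Lemma nc_lt1_re (w : C) : nc (w - 1) < 1 -> 0 < re w.
Proof. by move=> h; have := le_lt_trans (Re_le_nc _) h; rewrite reD reN /= ltr_norml; lra. Qed.

End ExpLog.

(** * Cousin patching on boxes *)

Section Boxes.
Context {R : realType}.
Local Notation C := R[i].
Variable n : nat.
Local Notation V := 'rV[C]_n.
Local Notation JJ := ('I_n * bool)%type.
Implicit Types (lo hi : JJ -> R) (x y : V).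

(** Real coordinates: a box has $2n$ sides, indexed by a variable and the choice of real or
    imaginary part. *)
Definition xi (j : JJ) (x : V) : R := if j.2 then re (x 0 j.1) else im (x 0 j.1).
(** The fattening by [e] makes even a degenerate box an open set and gives two boxes with a common
    face an overlap. *)
Definition bx lo hi e x := forall j, lo j - e < xi j x < hi j + e.
Definition pt_of (p : JJ -> R) : V := \row_i Complex (p (i, true)) (p (i, false)).

Lemma xi_pt p j : xi j (pt_of p) = p j.
Proof. by case: j => i []; rewrite /xi /= mxE. Qed.
Lemma xi_dist j x y : `|xi j y - xi j x| <= dist x y.
Proof.
rewrite distVE; apply: le_trans (nV_coord (y - x) j.1); rewrite !mxE /xi.
case: j.2; first by have := Re_le_nc (y 0 j.1 - x 0 j.1); rewrite reD reN.
by have := Im_le_nc (y 0 j.1 - x 0 j.1); rewrite imD imN.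
Qed.
Lemma dist_xi x y e : 0 < e -> (forall j, `|xi j y - xi j x| < e) -> dist x y < 2 * e.
Proof.
move=> e0 h; rewrite distVE; apply: nV_lt => [|i]; first lra.
rewrite !mxE; apply: le_lt_trans (nc_le _) _; rewrite reD imD reN imN.
by have := h (i, true); have := h (i, false); rewrite /xi /=; lra.
Qed.
Lemma bx_open lo hi e x : bx lo hi e x -> nr x (bx lo hi e).
Proof.
move=> h; apply: nrI_fin => j; have /andP[h1 h2] := h j.
exists (Num.min (xi j x - (lo j - e)) (hi j + e - xi j x)); first by rewrite lt_min; lra.
move=> y; rewrite lt_min => /andP[d1 d2]; have := xi_dist j x y; rewrite ler_norml; lra.
Qed.
Lemma bx_sub lo hi lo' hi' e e' x : (forall j, lo' j - e' <= lo j - e) ->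
  (forall j, hi j + e <= hi' j + e') -> bx lo hi e x -> bx lo' hi' e' x.
Proof. by move=> h1 h2 h j; have := h j; have := h1 j; have := h2 j; lra. Qed.
Lemma xiD j x y : xi j (x + y) = xi j x + xi j y.
Proof. by rewrite /xi mxE; case: j.2; rewrite ?reD ?imD. Qed.
Lemma xiZ j (t : R) x : xi j (t%:C%C *: x) = t * xi j x.
Proof. by rewrite /xi mxE; case: j.2; rewrite ?reM ?imM /=; ring. Qed.
Lemma xiN j x : xi j (- x) = - xi j x.
Proof. by rewrite /xi mxE; case: j.2; rewrite ?reN ?imN. Qed.
Lemma bx_seg lo hi e x y (t : R) : bx lo hi e x -> bx lo hi e y -> 0 <= t <= 1 ->
  bx lo hi e (x + t%:C%C *: (y - x)).
Proof.
move=> hx hy /andP[t0 t1] j; rewrite xiD xiZ xiD xiN.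
have /andP[a1 a2] := hx j; have /andP[b1 b2] := hy j.
rewrite (_ : xi j x + t * (xi j y - xi j x) = (1 - t) * xi j x + t * xi j y); last by ring.
by rewrite seg_lt// seg_gt.
Qed.

(* Lebesgue number argument *)
Lemma unif_box lo hi e (Q : V -> V -> Prop) : 0 < e -> (forall j, lo j <= hi j) ->
  (forall x, bx lo hi e x -> exists2 d, 0 < d & forall y z, dist x y < d -> dist x z < d -> Q y z) ->
  exists2 d, 0 < d & forall y z, bx lo hi (e / 2) y -> dist y z < d -> Q y z.
Proof.
move=> e0 lohi h.
pose P (l L : JJ -> R) := exists2 d, 0 < d & forall y z, (forall j, l j <= xi j y <= l j + L j) ->
   bx lo hi (e / 2) y -> dist y z < d -> Q y z.
have : P (fun j => lo j - e / 2) (fun j => hi j - lo j + e).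
  apply: box_cut_ind.
  - by move=> j; have := lohi j; lra.
  - move=> l L j L0 [d1 d10 h1] [d2 d20 h2]; exists (Num.min d1 d2); first by rewrite lt_min d10.
    move=> y z hy hb; rewrite lt_min => /andP[z1 z2].
    have Lj := L0 j; have hj := hy j.
    have [c|c] := leP (xi j y) (l j + L j / 2); [apply: h1 z1|apply: h2 z2] => // k.
      by case: eqP => [->|_]; [lra|exact: hy].
    by case: eqP => [->|_]; [lra|exact: hy].
  - move=> p; have [hp|hp] := pselect (bx lo hi e (pt_of p)).
      have [d d0 hd] := h _ hp; exists (d / 8) => [|l L hl]; first lra.
      exists (d / 4) => [|y z hy hb hz]; first lra.
      have dy : dist (pt_of p) y < d / 2.
        have -> : d / 2 = 2 * (d / 4) by lra.
        apply: dist_xi => [|j]; first lra.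
        by rewrite xi_pt ltr_norml; have := hl j; have := hy j => ? [? ? ? ?]; lra.
      by apply: hd; [lra|have := dist_tri (pt_of p) y z; lra].
    exists (e / 2) => [|l L hl]; first lra.
    exists 1 => // y z hy hb; exfalso; apply: hp => j; rewrite xi_pt.
    by have := hy j; have := hb j; have := hl j => -[? ? ? ?] /andP[? ?] /andP[? ?]; apply/andP; split; lra.
move=> [d d0 hd]; exists d => // y z hy; apply: hd => // j.
by have := hy j; lra.
Qed.

(** The segment from the corner [x0] to [x] is cut into [m] steps so fine that the ratio of
    successive values of [u] is within 1 of 1. The principal logarithms of these ratios are
    holomorphic in [x], and the exponential of their sum telescopes to $u(x)/u(x_0)$. *)
Lemma log_exists lo hi e (u : V -> C) : 0 < e -> (forall j, lo j <= hi j) ->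
  (forall x, bx lo hi e x -> gh u x /\ u x != 0) ->
  exists (h : V -> C) (c : C), c != 0 /\ forall x, bx lo hi (e / 2) x -> gh h x /\ u x = c * cexp (h x).
Proof.
move=> e0 lohi hu.
have [d d0 hd] : exists2 d, 0 < d & forall y z, bx lo hi (e / 2) y -> dist y z < d -> nc (u z / u y - 1) < 1.
  apply: unif_box => // x hx; have [gu ux] := hu x hx.
  have c : cont (fun q : metP (metV n) (metV n) => u q.2 / u q.1) ((x, x) : metP (metV n) (metV n)).
    apply: contM; first by apply: cont_sndf; exact: gh_cont.
    by apply: contV => //; apply: cont_fstf; exact: gh_cont.
  have [d d0 hd] := c 1 ltr01; exists d => // y z h1 h2.
  by have := hd (y, z); rewrite distCE /= divff// gt_max h1 h2; apply.
pose x0 : V := pt_of lo.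
have hx0 : bx lo hi (e / 2) x0 by move=> j; rewrite xi_pt; have := lohi j; lra.
pose M := \sum_j (hi j - lo j) + e.
have M0 : 0 < M by rewrite /M ltr_wpDl// sumr_ge0// => j _; rewrite subr_ge0.
have hM x : bx lo hi (e / 2) x -> dist x0 x < 2 * M.
  move=> hx; apply: dist_xi => // j; rewrite xi_pt ltr_norml.
  have : hi j - lo j <= \sum_j (hi j - lo j).
    by rewrite (bigD1 j)//= lerDl sumr_ge0// => k _; rewrite subr_ge0.
  by have := hx j; have := lohi j; rewrite /M; lra.
pose m := (Num.bound (2 * M / d)).+1.
have hm : 2 * M < m%:R * d.
  rewrite -ltr_pdivrMr//; apply: lt_le_trans (archi_boundP _) _; first by rewrite divr_ge0//; lra.
  by rewrite ler_nat.
have mp : 0 < m%:R :> R by rewrite ltr0n.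
pose q (k : nat) : R := k%:R / m%:R.
pose X k x : V := (1 - q k)%:C%C *: x0 + (q k)%:C%C *: x.
have XE k x : X k x = x0 + (q k)%:C%C *: (x - x0).
  by rewrite /X rmorphB rmorph1 scalerBl scale1r scalerBr addrAC addrA.
have qin k : (k <= m)%N -> 0 <= q k <= 1.
  by move=> km; rewrite /q divr_ge0//= ler_pdivrMr// mul1r ler_nat.
have Xin k x : (k <= m)%N -> bx lo hi (e / 2) x -> bx lo hi (e / 2) (X k x).
  by move=> km hx; rewrite XE; apply: bx_seg => //; exact: qin.
have big y : bx lo hi (e / 2) y -> bx lo hi e y by apply: bx_sub => j; lra.
have close k x : (k < m)%N -> bx lo hi (e / 2) x -> nc (u (X k.+1 x) / u (X k x) - 1) < 1.
  move=> km hx; apply: hd; first by apply: Xin => //; exact: ltnW.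
  rewrite distVE !XE opprD addrACA subrr add0r -scalerBl -rmorphB.
  apply: le_lt_trans (nVZ _ _) _.
  have -> : q k.+1 - q k = m%:R^-1 by rewrite /q -mulrBl -natrB// subSnn mul1r.
  rewrite nc_real ger0_norm ?invr_ge0 ?ler0n// mulrC ltr_pdivrMr// mulrC.
  by apply: lt_trans hm; have := hM x hx; rewrite distVE.
exists (fun x => \sum_(k < m) clog (u (X k.+1 x) / u (X k x))), (u x0); split.
  by case: (hu x0 (big _ hx0)).
move=> x hx; split.
  apply: gh_sum => k.
  have g j : (j <= m)%N -> gh (fun y => u (X j y)) x /\ u (X j x) != 0.
    move=> jm; have [g1 g2] := hu _ (big _ (Xin j x jm hx)); split=> //.
    exact: gh_affine.
  have [g1 g2] := g k (ltnW (ltn_ord k)); have [g3 g4] := g k.+1 (ltn_ord k).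
  apply: (gh_comp (f := fun y => u (X k.+1 y) / u (X k y))).
    by apply: ghM => //; exact: ghV.
  apply: nrW (re_pos_nr (nc_lt1_re (close k x (ltn_ord k) hx))) => y; exact: cdiff_clog.
have tel (l : nat) : (l <= m)%N -> cexp (\sum_(k < l) clog (u (X k.+1 x) / u (X k x))) = u (X l x) / u x0.
  elim: l => [_|l IH lm].
    rewrite big_ord0 cexp0; have -> : X 0%N x = x0 by rewrite XE /q mul0r rmorph0 scale0r addr0.
    by rewrite divff//; case: (hu x0 (big _ hx0)).
  rewrite big_ord_recr /= cexpD IH ?(ltnW lm)// clogK; last exact: nc_lt1_re (close l x lm hx).
  have [_ g2] := hu _ (big _ (Xin l x (ltnW lm) hx)).
  by have [_ g3] := hu _ (big _ hx0); field; rewrite g2 g3.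
rewrite tel//; have -> : X m x = x by rewrite XE /q divff ?gt_eqF// rmorph1 scale1r subrKC.
by have [_ g3] := hu _ (big _ hx0); rewrite mulrC divfK.
Qed.

Lemma gh_J (a b : R) (g : V -> R -> C) x0 : a <= b ->
  nr x0 (fun x => forall t, a <= t <= b -> GH (g^~ t) x /\ jcont g x t) ->
  gh (fun x => J (g x) a b) x0.
Proof.
move=> ab h; apply: nrW (nr_nr h) => x hx; have hx0 := nr_at hx; split.
  apply: J_cont => //; first by move=> t /hx0 [].
  by apply: nrW hx => y hy t /hy [_ /jcont_snd].
move=> v; apply: J_cdiff => //.
have := cont_nr (cont_line x v 0) (P := fun x => forall t, a <= t <= b -> GH (g^~ t) x /\ jcont g x t).
rewrite scale0r addr0 => /(_ hx); apply: nrW => s hs t /hs [Gt jt]; split.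
  exact: (GH_line (f := g^~ t)).
apply: (jcont_comp (h := fun p : metP metC metR => x + p.1 *: v) (k := fun p => p.2) (x := (s, t)) jt).
  by apply: contVD; [exact: cont_cst|apply: contVZ; [exact: cont_fst|exact: cont_cst]].
exact: cont_snd.
Qed.

Definition upd (i : 'I_n) (x : V) (z : C) : V := \row_k (if k == i then z else x 0 k).

Lemma GH_upd (f : V -> C) i x z : GH f (upd i x z) -> GH (fun y => f (upd i y z)) x.
Proof.
move=> [cf df]; split.
  apply: (cont_comp (f := fun y => upd i y z) (g := f)) cf.
  apply: cont_row => k; have [->|ki] := eqVneq k i.
    apply: (cont_eq (f := fun _ : V => z)); last exact: cont_cst.
    by apply: nr_all => y; rewrite mxE eqxx.
  apply: (cont_eq (f := fun y : V => y 0 k)); last exact: cont_coord.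
  by apply: nr_all => y; rewrite mxE (negbTE ki).
move=> v; apply: cdiff_eq (df (upd i v 0)); apply: nr_all => t; congr f.
by apply/rowP => k; rewrite !mxE; case: eqP => // _; rewrite mulr0 addr0.
Qed.

Lemma cont_upd (A : @met R) i (h : A -> V) (k : A -> C) (x : A) :
  cont h x -> cont k x -> cont (fun y : A => upd i (h y) (k y)) x.
Proof.
move=> ch ck; apply: cont_row => l; have [->|li] := eqVneq l i.
  by apply: (cont_eq _ ck); apply: nr_all => y; rewrite mxE eqxx.
have := cont_comp (g := fun y : V => y 0 l) ch (cont_coord _ l).
by apply: cont_eq; apply: nr_all => y; rewrite mxE (negbTE li).
Qed.

(** A single side of a Cauchy integral is holomorphic also outside the rectangle, as long as the
    coordinate stays off that side; the splitting below depends on this. *)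
Lemma edge_gh (h : V -> C) i (a b : R) (ze : R -> C) x0 : a <= b -> (forall t, cont ze t) ->
  (forall t, a <= t <= b -> gh h (upd i x0 (ze t)) /\ ze t != x0 0 i) ->
  gh (fun x => J (fun t => h (upd i x (ze t)) * (ze t - x 0 i)^-1) a b) x0.
Proof.
move=> ab cz hz; apply: gh_J => //.
have cu (x : V) (t : R) : cont (fun q : metP (metV n) metR => upd i q.1 (ze q.2)) ((x, t) : metP (metV n) metR).
  apply: cont_upd; first exact: cont_fst.
  by apply: (cont_sndf (h := ze)); exact: cz.
have cd (x : V) (t : R) : cont (fun q : metP (metV n) metR => ze q.2 - q.1 0 i) ((x, t) : metP (metV n) metR).
  apply: contB; first by apply: (cont_sndf (h := ze)); exact: cz.
  by apply: (cont_fstf (h := fun y : V => y 0 i)); exact: cont_coord.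
have : nr x0 (fun x => forall t, a <= t <= b -> gh h (upd i x (ze t)) /\ ze t - x 0 i != 0).
  apply: (tube (A := metV n) (Q := fun (x : V) t => gh h (upd i x (ze t)) /\ ze t - x 0 i != 0)) => // t ht.
  have [g1 g2] := hz t ht; apply: nrI.
    exact: (cont_nr (P := gh h) (cu x0 t) (gh_nr g1)).
  by apply: cont_neq0 (cd x0 t) _; rewrite subr_eq0.
apply: nrW => x hx t /hx [g1 g2]; split.
  apply: GHM; first by apply: GH_upd; exact: gh_GH.
  apply: GHV => //; apply: GHD; first exact: GH_cst.
  by apply: GHN; exact: GH_coord.
apply: contM; last by apply: contV => //; exact: cd.
exact: (cont_comp (g := h) (cu x t) (gh_cont g1)).
Qed.

End Boxes.

(** * Additive splitting and patching of generators *)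

Section Cousin.
Context {R : realType}.
Local Notation C := R[i].
Variable n : nat.
Local Notation V := 'rV[C]_n.
Local Notation JJ := ('I_n * bool)%type.
Implicit Types (lo hi : JJ -> R) (x y : V).

Definition set1f (f : JJ -> R) (j : JJ) (c : R) k := if k == j then c else f k.

Lemma cdiff_upd (h : V -> C) i x z : GH h (upd i x z) -> cdiff (fun t => h (upd i x t)) z.
Proof.
have E t : upd i x t = upd i x 0 + t *: upd i 0 1.
  by apply/rowP => k; rewrite !mxE; case: eqP => _; rewrite ?mulr1 ?mulr0 ?add0r ?addr0.
rewrite E => /GH_line; apply: cdiff_eq; apply: nr_all => t.
by rewrite -E.
Qed.
Lemma upd_id i x : upd i x (x 0 i) = x.
Proof. by apply/rowP => k; rewrite !mxE; case: eqP => // ->. Qed.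

(** Cauchy's formula in the cut variable, over a rectangle in the overlap. The side beyond the cut
    is holomorphic on the whole lower box, the other three sides on the whole upper box, and
    together they give [K * h x] on the overlap. *)
Lemma cousin_split lo hi j c e (h : V -> C) : 0 < e -> (forall k, lo k <= hi k) ->
  lo j <= c <= hi j -> (forall x, bx (set1f lo j c) (set1f hi j c) e x -> gh h x) ->
  exists h1 h2 : V -> C, [/\ forall x, bx lo (set1f hi j c) (e / 4) x -> gh h1 x,
    forall x, bx (set1f lo j c) hi (e / 4) x -> gh h2 x &
    forall x, bx (set1f lo j c) (set1f hi j c) (e / 4) x -> h x = h1 x - h2 x].
Proof.
move=> e0 lohi /andP[c1 c2] gh_h.
set Ol := set1f lo j c in gh_h *; set Oh := set1f hi j c in gh_h *.
case: j c1 c2 @Ol @Oh gh_h => i b c1 c2; set j := (i, b) => Ol Oh gh_h.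
(* The contour sits at [e / 2]: inside the domain of [h], which reaches [e], and beyond the final
   boxes, which reach [e / 4]. *)
pose A := Ol (i, true) - e / 2; pose B := Oh (i, true) + e / 2.
pose D1 := Ol (i, false) - e / 2; pose D2 := Oh (i, false) + e / 2.
have Olh k : Ol k <= Oh k by rewrite /Ol /Oh /set1f; case: ifP.
have AB : A < B by rewrite /A /B; have := Olh (i, true); lra.
have DD : D1 < D2 by rewrite /D1 /D2; have := Olh (i, false); lra.
have K0 := cK_neq0 AB DD; set K := cK A B D1 D2 in K0.
have reg x z : (forall k, k.1 != i -> lo k - e / 4 < xi k x < hi k + e / 4) -> in_rect A B D1 D2 z ->
    gh h (upd i x z).
  move=> hx [hz1 hz2]; apply: gh_h => -[k1 kb].
  have [->|ki] := eqVneq k1 i.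
    rewrite /xi /= mxE eqxx; case: kb; rewrite -/Ol -/Oh.
      by move: hz1; rewrite /A /B; lra.
    by move: hz2; rewrite /D1 /D2; lra.
  have := hx (k1, kb) ki; rewrite /xi /= mxE (negbTE ki).
  rewrite /Ol /Oh /set1f /j (_ : (k1, kb) == (i, b) = false); first lra.
  by apply/negbTE; apply: contra ki => /eqP [->].
pose eb x := J (fun t => h (upd i x (Complex t D1)) * (Complex t D1 - x 0 i)^-1) A B.
pose et x := J (fun t => h (upd i x (Complex t D2)) * (Complex t D2 - x 0 i)^-1) A B.
pose er x := J (fun t => h (upd i x (Complex B t)) * (Complex B t - x 0 i)^-1) D1 D2.
pose el x := J (fun t => h (upd i x (Complex A t)) * (Complex A t - x 0 i)^-1) D1 D2.
pose ok x := forall k : JJ, k.1 != i -> lo k - e / 4 < xi k x < hi k + e / 4.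
have geb x : ok x -> D1 != im (x 0 i) -> gh eb x.
  move=> hx nx; apply: edge_gh; [exact: ltW|move=> t; exact: cont_h|move=> t ht].
  split; first by apply: reg => //; split=> //=; rewrite lexx ltW.
  by apply: contraNneq nx => <-.
have get x : ok x -> D2 != im (x 0 i) -> gh et x.
  move=> hx nx; apply: edge_gh; [exact: ltW|move=> t; exact: cont_h|move=> t ht].
  split; first by apply: reg => //; split=> //=; rewrite lexx ltW.
  by apply: contraNneq nx => <-.
have ger x : ok x -> B != re (x 0 i) -> gh er x.
  move=> hx nx; apply: edge_gh; [exact: ltW|move=> t; exact: cont_v|move=> t ht].
  split; first by apply: reg => //; split=> //=; rewrite lexx ltW.
  by apply: contraNneq nx => <-.
have gel x : ok x -> A != re (x 0 i) -> gh el x.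
  move=> hx nx; apply: edge_gh; [exact: ltW|move=> t; exact: cont_v|move=> t ht].
  split; first by apply: reg => //; split=> //=; rewrite lexx ltW.
  by apply: contraNneq nx => <-.
have main x : bx Ol Oh (e / 4) x -> K * h x = eb x + 'i%C * er x - et x - 'i%C * el x.
  move=> hx; have hok : ok x.
    move=> [k1 kb] /= ki; have := hx (k1, kb); rewrite /Ol /Oh /set1f /j.
    rewrite (_ : (k1, kb) == (i, b) = false)//.
    by apply/negbTE; apply: contra ki => /eqP [->].
  have hw : in_rect_open A B D1 D2 (x 0 i).
    have := hx (i, true); have := hx (i, false); rewrite /xi /= => h1 h2.
    by split; rewrite /A /B /D1 /D2; lra.
  have dh z : in_rect A B D1 D2 z -> cdiff (fun t => h (upd i x t)) z.
    by move=> hz; apply: cdiff_upd; apply: gh_GH; exact: reg.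
  by have := cauchy_formula hw dh; rewrite upd_id => <-.
have gK (f : V -> C) x : gh f x -> gh (fun y => K^-1 * f y) x by apply: ghM; exact: gh_cst.
have gI (f : V -> C) x : gh f x -> gh (fun y => 'i%C * f y) x by apply: ghM; exact: gh_cst.
have ok1 x : bx lo Oh (e / 4) x -> ok x.
  move=> hx [k1 kb] /= ki; have := hx (k1, kb); rewrite /Oh /set1f /j.
  rewrite (_ : (k1, kb) == (i, b) = false)//.
  by apply/negbTE; apply: contra ki => /eqP [->].
have ok2 x : bx Ol hi (e / 4) x -> ok x.
  move=> hx [k1 kb] /= ki; have := hx (k1, kb); rewrite /Ol /set1f /j.
  rewrite (_ : (k1, kb) == (i, b) = false)//.
  by apply/negbTE; apply: contra ki => /eqP [->].
(* For a cut in a real part [h1] is the right side of the contour; for a cut in an imaginary part it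
   is the top side. *)
case: b @j c1 c2 @Ol @Oh @A @B @D1 @D2 gh_h Olh AB DD K K0 reg eb et er el geb get ger gel main gK ok1 ok2.
  move=> j c1 c2 Ol Oh A B D1 D2 gh_h Olh AB DD K K0 reg eb et er el geb get ger gel main gK ok1 ok2.
  have BE : B = c + e / 2 by rewrite /B /Oh /set1f eqxx.
  have AE : A = c - e / 2 by rewrite /A /Ol /set1f eqxx.
  have D1E : D1 = lo (i, false) - e / 2 by rewrite /D1 /Ol /set1f /j xpair_eqE andbF.
  have D2E : D2 = hi (i, false) + e / 2 by rewrite /D2 /Oh /set1f /j xpair_eqE andbF.
  exists (fun x => K^-1 * ('i%C * er x)), (fun x => - (K^-1 * (eb x - et x - 'i%C * el x))); split.
  - move=> x hx; apply: gK; apply: gI; apply: ger; first exact: ok1.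
    have := hx (i, true); rewrite /Oh /set1f eqxx /xi /= => hh.
    by apply/eqP => E; rewrite -E BE in hh; lra.
  - move=> x hx; have := hx (i, true); have := hx (i, false).
    rewrite /Ol /set1f eqxx /xi /= /j xpair_eqE andbF => hh1 hh2.
    have hok := ok2 x hx.
    apply: ghN; apply: gK; apply: ghB; [apply: ghB|apply: gI].
    + by apply: geb => //; apply/eqP => E; rewrite -E D1E in hh1; lra.
    + by apply: get => //; apply/eqP => E; rewrite -E D2E in hh1; lra.
    + by apply: gel => //; apply/eqP => E; rewrite -E AE in hh2; lra.
  - by move=> x hx; apply: (mulfI K0); rewrite main//; field.
move=> j c1 c2 Ol Oh A B D1 D2 gh_h Olh AB DD K K0 reg eb et er el geb get ger gel main gK ok1 ok2.
have BE : B = hi (i, true) + e / 2 by rewrite /B /Oh /set1f /j xpair_eqE andbF.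
have AE : A = lo (i, true) - e / 2 by rewrite /A /Ol /set1f /j xpair_eqE andbF.
have D1E : D1 = c - e / 2 by rewrite /D1 /Ol /set1f eqxx.
have D2E : D2 = c + e / 2 by rewrite /D2 /Oh /set1f eqxx.
exists (fun x => - (K^-1 * et x)), (fun x => - (K^-1 * (eb x + 'i%C * er x - 'i%C * el x))); split.
- move=> x hx; apply: ghN; apply: gK; apply: get; first exact: ok1.
  have := hx (i, false); rewrite /Oh /set1f eqxx /xi /= => hh.
  by apply/eqP => E; rewrite -E D2E in hh; lra.
- move=> x hx; have := hx (i, true); have := hx (i, false).
  rewrite /Ol /set1f eqxx /xi /= /j xpair_eqE andbF => hh1 hh2.
  have hok := ok2 x hx.
  apply: ghN; apply: gK; apply: ghB; [apply: ghD|]; last apply: gI.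
  + by apply: geb => //; apply/eqP => E; rewrite -E D1E in hh1; lra.
  + by apply: gI; apply: ger => //; apply/eqP => E; rewrite -E BE in hh2; lra.
  + by apply: gel => //; apply/eqP => E; rewrite -E AE in hh2; lra.
- by move=> x hx; apply: (mulfI K0); rewrite main//; field.
Qed.

Variable Vs : V -> Prop.
Hypothesis hA1 : forall p, exists (m : nat) (fs : 'I_m -> V -> C),
  (forall i, gh (fs i) p) /\ nr p (fun y => Vs y <-> forall i, fs i y = 0).
Hypothesis hA2 : forall x P, Vs x -> nr x P -> exists w,
  [/\ P w, Vs w & exists2 g, gh g w & nr w (fun y => Vs y <-> g y = 0)].
Hypothesis hA3 : forall x, ~ nr x Vs.

(** Near a point off [Vs] the constant 1 vanishes on [Vs] vacuously, so [F] divides it. *)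
Lemma generates_neq0 F x : generates Vs F x -> ~ Vs x -> F x != 0.
Proof.
move=> [_ _ hF] nx; have [|H _ /nr_at /= E] := hF (fun _ => 1) (gh_cst 1 x).
  by apply: nrW (Vs_closed hA1 nx) => y ny /ny.
by apply/eqP => F0; move: E; rewrite F0 mulr0 => /eqP; rewrite oner_eq0.
Qed.
Lemma generates_eq0 F x : generates Vs F x -> Vs x -> F x = 0.
Proof. by move=> [_ h _]; exact: (nr_at h). Qed.

(** A generator is nonzero off [Vs], which has empty interior; so it cancels on a dense set, and at
    [x] by continuity. *)
Lemma generates_cancel F x (a b : V -> C) : nr x (generates Vs F) -> cont a x -> cont b x ->
  nr x (fun y => a y * F y = b y * F y) -> a x = b x.
Proof.
move=> hF ca cb E; apply/eqP; rewrite -subr_eq0; apply/negP => /negP ne.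
apply: (hA3 (x := x)); apply: nrW2 (nrI hF E) (cont_neq0 (contB ca cb) ne) => y [gF Ey] ny.
apply: contrapT => nVy; have Fy := generates_neq0 gF nVy.
by move: ny; rewrite (mulIf Fy Ey) subrr eqxx.
Qed.

(** Two generators divide each other locally. Local quotients are unique by cancellation, so the
    diagonal choice [Hx x x] agrees near each point with one of them; it is a unit because the
    quotients in the two directions multiply to 1. *)
Lemma generates_quot (U : V -> Prop) F1 F2 : (forall x, U x -> nr x U) ->
  (forall x, U x -> generates Vs F1 x) -> (forall x, U x -> generates Vs F2 x) ->
  exists u : V -> C, forall x, U x -> [/\ gh u x, u x != 0 & F1 x = u x * F2 x].
Proof.
move=> Uo g1 g2.
pose P x (H : V -> C) := gh H x /\ nr x (fun y => F1 y = H y * F2 y).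
have exH x : exists H, U x -> P x H.
  have [Ux|nU] := pselect (U x); last by exists (fun _ => 0).
  have [_ _ h2] := g2 x Ux; have [k1 k2 _] := g1 x Ux.
  by have [H hH E] := h2 F1 k1 k2; exists H.
pose Hx x := projT1 (cid (exH x)).
have HxP x : U x -> P x (Hx x) by exact: projT2 (cid (exH x)).
exists (fun x => Hx x x) => x Ux; have [gH EH] := HxP x Ux.
have near : nr x (fun y => Hx x y = Hx y y).
  apply: nrW2 (nrI (Uo x Ux) (gh_nr gH)) (nr_nr EH) => y [Uy gHy] Ey.
  have [gHy' Ey'] := HxP y Uy.
  apply: (@generates_cancel F2 y).
  - by apply: nrW (Uo y Uy) => z /g2.
  - exact: gh_cont.
  - exact: gh_cont.
  - by apply: nrW2 Ey Ey' => z <- <-.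
split; [exact: gh_eq near gH| |exact: (nr_at EH)].
have [_ _ h1] := g1 x Ux; have [k1 k2 _] := g2 x Ux.
have [H' gH' E'] := h1 F2 k1 k2.
have : 1 = H' x * Hx x x.
  apply: (@generates_cancel F2 x (fun _ => 1) (fun y => H' y * Hx x y)).
  - by apply: nrW (Uo x Ux) => z /g2.
  - exact: cont_cst.
  - by apply: contM; exact: gh_cont.
  - by apply: nrW2 EH E' => y e1 e2; rewrite mul1r -mulrA -e1.
by move=> E; apply/eqP => h0; move: E; rewrite h0 mulr0 => /eqP; rewrite oner_eq0.
Qed.

Lemma generates_mul F F' (w : V -> C) x : generates Vs F x -> gh w x -> w x != 0 ->
  nr x (fun y => F' y = F y * w y) -> generates Vs F' x.
Proof.
move=> [h1 h2 h3] hw wx E; split.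
- by apply: gh_eq (ghM h1 hw); apply: nrW E => y ->.
- by apply: nrW2 h2 E => y h -> /h ->; rewrite mul0r.
move=> G hG GV; have [H hH EH] := h3 G hG GV.
exists (fun y => H y * (w y)^-1); first by apply: ghM => //; exact: ghV.
apply: nrW2 (nrI EH E) (cont_neq0 (gh_cont hw) wx) => y [-> ->] wy.
by field.
Qed.

Definition has_generator lo hi := exists (F : V -> C) (e : R), 0 < e /\ forall x, bx lo hi e x -> generates Vs F x.

(** On the overlap $F_1 = c_0 e^{h} F_2$ with $h = h_1 - h_2$, so $c_0^{-1} F_1 e^{-h_1}$ and $F_2
    e^{-h_2}$ agree there and form one function, which differs from each generator by a unit. *)
Lemma has_generator_patch lo hi j c : (forall k, lo k <= hi k) -> lo j <= c <= hi j ->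
  has_generator lo (set1f hi j c) -> has_generator (set1f lo j c) hi -> has_generator lo hi.
Proof.
move=> lohi cc [F1 [e1 [e10 g1]]] [F2 [e2 [e20 g2]]].
have /andP[c1 c2] := cc.
pose e := Num.min e1 e2.
have e0 : 0 < e by rewrite lt_min e10.
have ee1 : e <= e1 by rewrite ge_min lexx.
have ee2 : e <= e2 by rewrite ge_min lexx orbT.
set Ol := set1f lo j c in g2 *; set Oh := set1f hi j c in g1 *.
have Oll k : lo k <= Ol k by rewrite /Ol /set1f; case: eqP => // ->.
have Ohh k : Oh k <= hi k by rewrite /Oh /set1f; case: eqP => // ->.
have Olh k : Ol k <= Oh k by rewrite /Ol /Oh /set1f; case: ifP.
have [|x Ux|x Ux|u hu] := @generates_quot (bx Ol Oh e) F1 F2.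
- exact: bx_open.
- by apply: g1; apply: bx_sub Ux => k; have := Oll k; lra.
- by apply: g2; apply: bx_sub Ux => k; have := Ohh k; lra.
have [|h [c0 [c00 hh]]] := @log_exists _ _ Ol Oh e u e0 Olh.
  by move=> x /hu [].
have e20' : 0 < e / 2 by lra.
have [|h1 [h2 [gh1 gh2 E12]]] := @cousin_split lo hi j c (e / 2) h e20' lohi cc.
  by move=> x /hh [].
have e8 : e / 2 / 4 = e / 8 by lra.
rewrite -/Ol -/Oh e8 in gh1 gh2 E12.
pose A x := F1 x * (c0^-1 * cexp (- h1 x)); pose B x := F2 x * cexp (- h2 x).
pose F x := if xi j x <= c then A x else B x.
have gexp (f : V -> C) x : gh f x -> gh (fun y => cexp (- f y)) x.
  move=> gf; apply: (gh_comp (f := fun y => - f y)); first exact: ghN.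
  by apply: nr_all => z; exact: cdiff_cexp.
have genA x : bx lo Oh (e / 8) x -> forall F', nr x (fun y => F' y = A y) -> generates Vs F' x.
  move=> hx F' E; apply: (generates_mul (F := F1) (w := fun y => c0^-1 * cexp (- h1 y))) E.
  - by apply: g1; apply: bx_sub hx => k; lra.
  - by apply: ghM; [exact: gh_cst|apply: gexp; exact: gh1].
  - by rewrite mulf_neq0 ?invr_eq0 ?cexp_neq0.
have genB x : bx Ol hi (e / 8) x -> forall F', nr x (fun y => F' y = B y) -> generates Vs F' x.
  move=> hx F' E; apply: (generates_mul (F := F2) (w := fun y => cexp (- h2 y))) E.
  - by apply: g2; apply: bx_sub hx => k; lra.
  - by apply: gexp; exact: gh2.
  - exact: cexp_neq0.
exists F, (e / 8); split; first lra.
move=> x hx.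
have hxj := hx j.
have cxi : forall d, 0 < d -> nr x (fun y => `|xi j y - xi j x| < d).
  by move=> d d0; exists d => // y; apply: le_lt_trans; exact: xi_dist.
case: (ltgtP (xi j x) c) => hc.
- apply: genA.
    by move=> k; have := hx k; rewrite /Oh /set1f; case: eqP => [->|_]; lra.
  have d0 : 0 < c - xi j x by lra.
  apply: nrW (cxi _ d0) => y; rewrite ltr_norml /F => hy.
  by case: leP => // ?; exfalso; lra.
- apply: genB.
    by move=> k; have := hx k; rewrite /Ol /set1f; case: eqP => [->|_]; lra.
  have d0 : 0 < xi j x - c by lra.
  apply: nrW (cxi _ d0) => y; rewrite ltr_norml /F => hy.
  by case: leP => // ?; exfalso; lra.
have hxO : bx Ol Oh (e / 8) x.
  by move=> k; have := hx k; rewrite /Ol /Oh /set1f; case: eqP => [->|_]; lra.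
(* At a point of the cut face both formulas are valid nearby and agree, so [F] is [B] on either
   side. *)
apply: genB; first by apply: bx_sub hxO => k; have := Ohh k; lra.
apply: nrW (bx_open hxO) => y hy; rewrite /F; case: ifP => // _.
have hy1 : bx Ol Oh e y by apply: bx_sub hy => k; lra.
have hy2 : bx Ol Oh (e / 2) y by apply: bx_sub hy => k; lra.
have [_ _ Eu] := hu y hy1; have [_ Eh] := hh y hy2.
rewrite /A /B Eu Eh E12// !cexpD !cexpN.
by field; rewrite c00 !cexp_neq0.
Qed.

(** Bisection down to boxes that fit into the domain of a local generator; each patching step may
    shrink the fattening, but finitely many steps leave it positive. *)
Lemma has_generator_all lo hi : (forall k, lo k <= hi k) -> has_generator lo hi.
Proof.
move=> lohi.
pose P (l L : JJ -> R) := has_generator l (fun k => l k + L k).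
have : P lo (fun k => hi k - lo k).
  apply: box_cut_ind.
  - by move=> k; rewrite subr_ge0.
  - move=> l L j L0 h1 h2; have Lj := L0 j.
    apply: (@has_generator_patch l _ j (l j + L j / 2)).
    + by move=> k; rewrite lerDl.
    + by lra.
    + move: h1; rewrite /P (_ : (fun k => _) = set1f (fun k => l k + L k) j (l j + L j / 2))//.
      by apply/funext => k; rewrite /set1f; case: eqP => // ->.
    + move: h2; rewrite /P (_ : (fun k => (if k == j then l k + L k / 2 else l k) + _) = (fun k => l k + L k)); last first.
        by apply/funext => k; case: eqP => // _; lra.
      rewrite (_ : (fun k => if k == j then _ else _) = set1f l j (l j + L j / 2))//.
      by apply/funext => k; rewrite /set1f; case: eqP => // ->.
  - move=> p; have [F [e e0 he]] := generator_exists hA1 hA2 hA3 (pt_of p).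
    exists (e / 8) => [|l L hl]; first lra.
    exists F, (e / 8); split; first lra.
    move=> x hx; apply: he.
    have -> : e = 2 * (e / 2) by lra.
    apply: dist_xi => [|j]; first lra.
    rewrite xi_pt ltr_norml; have := hx j; have [? ? ? ?] := hl j => /andP[? ?].
    by apply/andP; split; lra.
rewrite /P (_ : (fun k => lo k + (hi k - lo k)) = hi)//.
by apply/funext => k; rewrite subrKC.
Qed.

End Cousin.

(** * Polynomial approximation on polydiscs *)

Section PolyApprox.
Context {R : realType}.
Local Notation C := R[i].
Variable n : nat.
Local Notation V := 'rV[C]_n.
Local Notation JJ := ('I_n * bool)%type.

Lemma box_bounded (lo hi : JJ -> R) e (F : V -> C) : 0 < e -> (forall j, lo j <= hi j) ->
  (forall x, bx lo hi e x -> gh F x) ->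
  exists2 M : R, 0 <= M & forall x, bx lo hi (e / 2) x -> nc (F x) <= M.
Proof.
move=> e0 lohi h.
pose P (l L : JJ -> R) := exists2 M, 0 <= M & forall y, (forall j, l j <= xi j y <= l j + L j) ->
   bx lo hi (e / 2) y -> nc (F y) <= M.
have : P (fun j => lo j - e / 2) (fun j => hi j - lo j + e).
  apply: box_cut_ind.
  - by move=> j; have := lohi j; lra.
  - move=> l L j L0 [d1 d10 h1] [d2 d20 h2]; exists (Num.max d1 d2); first by rewrite le_max d10.
    move=> y hy hb; rewrite le_max.
    have Lj := L0 j; have hj := hy j.
    have [c|c] := leP (xi j y) (l j + L j / 2).
      by rewrite h1// => k; case: eqP => [->|_]; [lra|exact: hy].
    by rewrite h2 ?orbT// => k; case: eqP => [->|_]; [lra|exact: hy].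
  - move=> p; have [hp|hp] := pselect (bx lo hi e (pt_of p)).
      have [d d0 hd] := cont_bound (gh_cont (h _ hp)); exists (d / 4) => [|l L hl]; first lra.
      exists (nc (F (pt_of p)) + 1) => [|y hy hb]; first by have := nc_ge0 (F (pt_of p)); lra.
      apply: hd; have -> : d = 2 * (d / 2) by lra.
      apply: dist_xi => [|j]; first lra.
      by rewrite xi_pt ltr_norml; have := hl j; have := hy j => ? [? ? ? ?]; lra.
    exists (e / 2) => [|l L hl]; first lra.
    exists 1 => // y hy hb; exfalso; apply: hp => j; rewrite xi_pt.
    by have := hy j; have := hb j; have := hl j => -[? ? ? ?] /andP[? ?] /andP[? ?]; apply/andP; split; lra.
move=> [d d0 hd]; exists d => // y hy; apply: hd => // j.
by have := hy j; lra.
Qed.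

Lemma poly_pow (p : V -> C) k : @poly_fun R n p -> @poly_fun R n (fun x => p x ^+ k).
Proof.
move=> hp; elim: k => [|k IH]; first exact: poly_cst.
rewrite (_ : (fun x => p x ^+ k.+1) = (fun x => p x * p x ^+ k)); first exact: poly_mul.
by apply/funext => x; rewrite exprS.
Qed.
Lemma poly_sum k (p : nat -> V -> C) : (forall m, (m < k)%N -> @poly_fun R n (p m)) ->
  @poly_fun R n (fun x => \sum_(m < k) p m x).
Proof.
elim: k => [|k IH] h.
  rewrite (_ : (fun x => _) = (fun _ => 0)); first exact: poly_cst.
  by apply/funext => x; rewrite big_ord0.
rewrite (_ : (fun x => _) = (fun x => \sum_(m < k) p m x + p k x)).
  by apply: poly_add; [apply: IH => m mk; apply: h; exact: ltnW|exact: h].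
by apply/funext => x; rewrite big_ord_recr.
Qed.

Section Cube.
Variables (rho e : R).
Hypotheses (rho0 : 0 < rho) (e0 : 0 < e).
Local Notation cube := (bx (fun _ : JJ => - rho) (fun _ : JJ => rho)).

Lemma cube_upd (i : 'I_n) (x : V) z d : 0 < d -> cube d x -> sq 0 rho z -> cube d (upd i x z).
Proof.
move=> d0 hx [h1 h2] [k b]; rewrite /xi /= mxE.
have [_|_] := eqVneq k i; last exact: (hx (k, b)).
by move: h1 h2; rewrite /= => /andP[? ?] /andP[? ?]; case: b; apply/andP; split; lra.
Qed.

Lemma small_cube (x : V) : (forall k, nc (x 0 k) <= rho / 2) -> forall d, 0 < d -> cube d x.
Proof.
have rr := rho0.
move=> hx d d0 [k b]; rewrite /xi /=; have := hx k.
have := Re_le_nc (x 0 k); have := Im_le_nc (x 0 k); rewrite !ler_norml.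
by case: b => /andP[? ?] /andP[? ?] ?; apply/andP; split; lra.
Qed.

Lemma poly_approx_on (s : seq 'I_n) (F : V -> C) : (forall x, cube e x -> gh F x) ->
  (forall x y : V, (forall k, k \in s -> x 0 k = y 0 k) -> F x = F y) ->
  forall eps : R, 0 < eps -> exists2 p, @poly_fun R n p &
    forall x : V, (forall k, nc (x 0 k) <= rho / 2) -> nc (F x - p x) <= eps.
Proof.
have rr := rho0; have ee := e0.
elim: s F => [|i s IH] F gF dF eps eps0.
  exists (fun _ => F 0); first exact: poly_cst.
  by move=> x _; rewrite (dF x 0)// subrr nc0 ltW.
have lohi (j : JJ) : - rho <= rho by lra.
have [M M0 hM] := box_bounded ee lohi gF; clear lohi.
pose K := kq 0 rho; have K0 : K != 0 := kq_neq0 0 rr.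
have hh (c : R) : c - rho <= c + rho by lra.
have h1 := hh (re (0 : C)).
have h2 := hh (im (0 : C)).
pose A m (x : V) := K^-1 * oq (fun z => F (upd i x z) * (z^-1) ^+ m.+1) 0 rho.
have zn z : sqb 0 rho z -> z != 0 /\ rho <= nc z.
  by move=> /sqb_ge; rewrite subr0 => hz; split=> //; rewrite -nc_gt0; lra.
have gA m x : cube e x -> gh (A m) x.
  move=> hx; apply: ghM; first exact: gh_cst.
  apply: gh_oint => //; apply: nrW (bx_open hx) => y hy z hz.
  have [z0 _] := zn z hz.
  have hu : gh F (upd i y z) by apply: gF; apply: cube_upd => //; apply: sqb_sq hz; exact: ltW.
  split; first by apply: GHM; [apply: GH_upd; exact: gh_GH|exact: GH_cst].
  apply: contM.
    apply: (cont_comp (f := fun q : metP (metV n) metC => upd i q.1 q.2) (g := F)); last exact: gh_cont.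
    by apply: cont_upd; [exact: cont_fst|exact: cont_snd].
  by apply: contX; apply: contV => //; exact: cont_snd.
have dA m (x y : V) : (forall k, k \in s -> x 0 k = y 0 k) -> A m x = A m y.
  move=> E; congr (_ * _); apply: oint_ext => z hz; congr (_ * _); apply: dF => k.
  rewrite in_cons => /orP[/eqP->|ks]; rewrite !mxE ?eqxx//.
  by case: eqP => // _; exact: E.
(* Constant of the remainder estimate: [M] bounds [F], [2 / rho] the kernel, [4 * rho] is half the
   perimeter, and the factor 4 is that of [oint_bound]. *)
pose B := (nc K)^-1 * (4 * (M * (2 / rho)) * (4 * rho)).
have B0 : 0 <= B by rewrite !mulr_ge0 ?invr_ge0 ?nc_ge0 ?divr_ge0//; lra.
have [m0 hm0] : exists m : nat, B * (1 / 2) ^+ m <= eps / 2.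
  apply: contrapT => H.
  have H' m : eps / 2 < B * (1 / 2) ^+ m by rewrite ltNge; apply/negP => h; apply: H; exists m.
  suff : 1 <= 1 / 2 :> R by lra.
  apply: (@pow_bound _ _ _ (B / (eps / 2))); [lra|lra|move=> m].
  by rewrite expr1n mulrAC ler_pdivlMr; [have := H' m; lra|lra].
(* Bounds the total weight of the powers that multiply the approximated coefficients; the added 1
   keeps it positive when [m0] is 0. *)
pose T := \sum_(m < m0) rho ^+ m + 1.
have T0 : 0 < T by rewrite ltr_wpDl// sumr_ge0// => m _; rewrite exprn_ge0// ltW.
have eps'0 : 0 < eps / (2 * T) by rewrite divr_gt0// mulr_gt0.
have exq m : exists2 p, @poly_fun R n p &
    forall x : V, (forall k, nc (x 0 k) <= rho / 2) -> nc (A m x - p x) <= eps / (2 * T).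
  by apply: IH (dA m) _ eps'0; exact: gA.
have [q hq] : exists q : nat -> V -> C, forall m, @poly_fun R n (q m) /\
    forall x : V, (forall k, nc (x 0 k) <= rho / 2) -> nc (A m x - q m x) <= eps / (2 * T).
  exists (fun m => projT1 (cid2 (exq m))) => m.
  by case: (cid2 (exq m)) => p h3 h4 /=.
exists (fun x : V => \sum_(m < m0) (x 0 i ^+ m * q m x)).
  apply: (poly_sum (p := fun m (x : V) => x 0 i ^+ m * q m x)) => m _; apply: poly_mul.
    by apply: (poly_pow (p := fun x : V => x 0 i)); exact: poly_coord.
  by case: (hq m).
move=> x hx; have hxe := small_cube hx ee; have hxe2 : cube (e / 2) x by apply: small_cube => //; lra.
have wi : sqo 0 rho (x 0 i) by apply: nc_sqo; rewrite subr0; have := hx i; lra.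
have dz z : sq 0 rho z -> cdiff (fun t => F (upd i x t)) z.
  by move=> hz; apply: cdiff_upd; apply: gh_GH; apply: gF; exact: cube_upd.
have := cauchy_formula wi dz; rewrite upd_id -/(kq 0 rho) -/K => CF.
have cF : cob (fun z => F (upd i x z)) (re 0 - rho) (re 0 + rho) (im 0 - rho) (im 0 + rho) := sq_cob (ltW rr) dz.
have cV : cob (fun z : C => z^-1) (re 0 - rho) (re 0 + rho) (im 0 - rho) (im 0 + rho).
  by move=> z /zn [z0 _]; apply: contV => //; exact: cont_id.
have cX k : cob (fun z : C => z^-1 ^+ k) (re 0 - rho) (re 0 + rho) (im 0 - rho) (im 0 + rho).
  by move=> z hz; apply: contX; exact: cV.
have ci := cob_inv wi.
pose rem := oq (fun z => F (upd i x z) * ((x 0 i) ^+ m0 * z^-1 ^+ m0 * (z - x 0 i)^-1)) 0 rho.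
have crem : cob (fun z => F (upd i x z) * ((x 0 i) ^+ m0 * z^-1 ^+ m0 * (z - x 0 i)^-1))
   (re 0 - rho) (re 0 + rho) (im 0 - rho) (im 0 + rho).
  apply: cobM => //; apply: cobM => //; apply: cobM => //; by move=> z _; exact: cont_cst.
have E : F x = \sum_(m < m0) (x 0 i ^+ m * A m x) + K^-1 * rem.
  apply: (mulfI K0); rewrite -CF mulrDr mulVKf// mulr_sumr.
  have cm (m : 'I_m0) : cob (fun z => x 0 i ^+ m * (F (upd i x z) * z^-1 ^+ m.+1))
      (re 0 - rho) (re 0 + rho) (im 0 - rho) (im 0 + rho).
    by apply: cobM; [move=> z _; exact: cont_cst|exact: cobM].
  rewrite (eq_bigr (fun m : 'I_m0 => oq (fun z => x 0 i ^+ m * (F (upd i x z) * z^-1 ^+ m.+1)) 0 rho)); last first.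
    by move=> m _; rewrite /oq ointZ//; [rewrite /A /oq mulrCA mulVKf|exact: cobM].
  rewrite /rem /oq -oint_sum// -ointD//; last by move=> z hz; apply: cont_sum => m; exact: cm.
  apply: oint_ext => z hz; have [z0 _] := zn z hz; have zx := onb_neq wi hz.
  rewrite (eq_bigr (fun m : 'I_m0 => F (upd i x z) * z^-1 * (x 0 i * z^-1) ^+ m)); last first.
    by move=> m _; rewrite exprMn exprS; ring.
  rewrite -mulr_sumr -exprMn.
  have := subrX1 (x 0 i * z^-1) m0; set S := \sum_(m < m0) _ => ES.
  have xz : x 0 i * z^-1 - 1 != 0.
    by rewrite subr_eq0; apply: contra zx => /eqP E1; rewrite -[z]mul1r -E1 divfK.
  have -> : S = ((x 0 i * z^-1) ^+ m0 - 1) / (x 0 i * z^-1 - 1) by rewrite ES mulrC mulKf.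
  have zx' : z - x 0 i != 0 by rewrite subr_eq0.
  have -> : x 0 i * z^-1 - 1 = - ((z - x 0 i) / z) by field.
  by field; rewrite z0 zx'.
have remB : nc (K^-1 * rem) <= eps / 2.
  apply: le_trans hm0; rewrite ncM ncV /B -mulrA ler_wpM2l ?invr_ge0 ?nc_ge0//.
  have -> : 4 * (M * (2 / rho)) * (4 * rho) * (1 / 2) ^+ m0 =
     4 * (M * ((1 / 2) ^+ m0 * (2 / rho))) * (re (0 : C) + rho - (re (0 : C) - rho) + (im (0 : C) + rho - (im (0 : C) - rho))).
    by rewrite /=; ring.
  apply: oint_bound => // z hz; have [z0 nz] := zn z hz.
  have hx1 := hx i.
  rewrite ncM; apply: ler_pM; rewrite ?nc_ge0//.
    by apply: hM; apply: cube_upd => //; [lra|apply: sqb_sq hz; exact: ltW].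
  rewrite ncM; apply: ler_pM; rewrite ?nc_ge0//.
    rewrite -exprMn ncX; apply: lerXn2r; rewrite ?nnegrE ?nc_ge0 ?divr_ge0//.
    by rewrite ncM ncV ler_pdivrMr; lra.
  rewrite ncV -[2 / rho]invf_div lef_pV2 ?posrE ?divr_gt0//.
    by have := nc_sub z (x 0 i); lra.
  by have := nc_sub z (x 0 i); lra.
rewrite E addrAC -sumrB.
apply: le_trans (ncD _ _) _.
have : nc (\sum_(m < m0) (x 0 i ^+ m * A m x - x 0 i ^+ m * q m x)) <= eps / 2.
  apply: le_trans (nc_sum _ _ _) _.
  apply: (@le_trans _ _ (\sum_(m < m0) rho ^+ m * (eps / (2 * T)))).
    apply: ler_sum => m _; rewrite -mulrBr ncM ncX; apply: ler_pM; rewrite ?exprn_ge0 ?nc_ge0//.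
      by apply: lerXn2r; rewrite ?nnegrE ?nc_ge0 ?(ltW rr)//; have := hx i; lra.
    by case: (hq m) => _; exact.
  rewrite -mulr_suml -/T.
  have : \sum_(m < m0) rho ^+ m <= T by rewrite /T lerDl.
  move=> hT; apply: (@le_trans _ _ (T * (eps / (2 * T)))).
    by rewrite ler_wpM2r// ltW.
  rewrite le_eqVlt; apply/orP; left; apply/eqP; field; rewrite gt_eqF//.
lra.
Qed.

End Cube.

Lemma poly_approx rho e (F : V -> C) : 0 < rho -> 0 < e ->
  (forall x, bx (fun _ : JJ => - rho) (fun _ : JJ => rho) e x -> gh F x) ->
  forall eps : R, 0 < eps -> exists2 p, @poly_fun R n p &
    forall x : V, (forall k, nc (x 0 k) <= rho / 2) -> nc (F x - p x) <= eps.
Proof.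
move=> r0 e0 gF; apply: (poly_approx_on r0 e0 (s := enum 'I_n)) => // x y E.
by congr F; apply/rowP => k; apply: E; rewrite mem_enum.
Qed.

End PolyApprox.

(** * Analytic subvarieties *)

Section Conversion.
Context {R : realType}.
Local Notation C := R[i].
Local Notation Cf := (Num.NumField.sort (complex_complex__canonical__Num_NumField R)).

Lemma posC (e : C) : 0 < e -> exists2 d : R, 0 < d & e = d%:C%C.
Proof.
rewrite ltcE => /andP[/eqP h1 h2]; exists (re e) => //.
by apply: c_eq => //=; rewrite h1.
Qed.

Lemma nbhsC (x : Cf) (P : set Cf) : nbhs x P <-> nr (x : C) P.
Proof.
split.
  move=> /nbhs_ballP[e /= /posC[d d0 ->] h]; exists d => // y hy; apply: h.
  by rewrite /ball /= lt_norm_nc ncB.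
move=> [d d0 h]; apply/nbhs_ballP; exists d%:C%C; first by rewrite /= ltcR.
by move=> y; rewrite /ball /= lt_norm_nc ncB => hy; exact: h.
Qed.

Lemma nbhsV n (x : CN R n) (P : set (CN R n)) : nbhs x P <-> nr (x : 'rV[C]_n) P.
Proof.
split.
  move=> /nbhs_ballP[e /= /posC[d d0 ->] h]; exists d => // y hy; apply: h; split=> [|i j]; first by rewrite ltcR.
  rewrite ord1 /ball /= lt_norm_nc ncB.
  by apply: le_lt_trans hy; rewrite distVE; have := nV_coord (y - x) j; rewrite !mxE.
move=> [d d0 h]; apply/nbhs_ballP; exists d%:C%C; first by rewrite /= ltcR.
move=> y hy; apply: h; rewrite distVE; apply: nV_lt => // i.
by have := hy.2 0 i; rewrite /ball /= lt_norm_nc ncB !mxE.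
Qed.

Lemma open_nr n (U : set (CN R n)) x : open U -> U x -> nr (x : 'rV[C]_n) U.
Proof. by move=> oU Ux; apply/nbhsV; apply: open_nbhs_nbhs. Qed.

Lemma nr_open n (P : 'rV[C]_n -> Prop) : open ([set y | nr y P] : set (CN R n)).
Proof. by rewrite openE => y /= hy; apply/nbhsV; exact: nr_nr. Qed.

Lemma cont_closed n (P : 'rV[C]_n -> Prop) : (forall x, ~ P x -> nr x (fun y => ~ P y)) ->
  closed ([set y | P y] : set (CN R n)).
Proof.
move=> h; rewrite -[X in closed X]setCK; apply: open_closedC.
rewrite openE => y /= hy; apply/nbhsV; exact: h.
Qed.

(** The bridge from differentials to derivatives along complex lines; it turns [holo_on] into [gh]
    and serves the discs as well. *)
Lemma diff_cder (U : normedModType C) m (f : U -> CN R m) (w v : U) j :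
  differentiable f w ->
  cder (fun t : C => (f (w + t *: v) : 'rV[C]_m) 0 j) 0 (('d f w v : 'rV[C]_m) 0 j).
Proof.
move=> df; apply: eps_cder => e e0.
have h := diff_derivable (v := v) df.
have : nbhs ('D_v f w)
    [set y : CN R m | nc ((y : 'rV[C]_m) 0 j - ('d f w v : 'rV[C]_m) 0 j) < e].
  rewrite deriveE//; apply/nbhsV.
  exists e => // y hy; apply: le_lt_trans hy; rewrite distVE.
  by have := nV_coord (y - 'd f w v) j; rewrite !mxE.
move=> /h; rewrite /nbhs /= => /nbhsC; apply: nrW => t /= ht.
have [->|t0] := eqVneq t 0; first by rewrite scale0r addr0 subr0 mulr0 subrr subr0 nc0 mulr0.
have := ht t0; rewrite /= !mxE => hh; rewrite scale0r addr0 subr0 [w + _]addrC.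
set a := (f (t *: v + w) : 'rV[C]_m) 0 j in hh *; set b := (f w : 'rV[C]_m) 0 j in hh *.
set d := ('d f w v : 'rV[C]_m) 0 j in hh *.
have -> : a - b - d * t = (t^-1 * (a - b) - d) * t by field.
by rewrite ncM ler_wpM2r ?nc_ge0// ltW.
Qed.

Lemma diff_contV n m (f : CN R n -> CN R m) w : differentiable f w ->
  cont (f : 'rV[C]_n -> 'rV[C]_m) w.
Proof.
move=> /differentiable_continuous h e e0.
have /h : nbhs (f w) [set y : CN R m | dist (f w : 'rV[C]_m) y < e] by apply/nbhsV; exact: nr_dist.
by move=> /nbhsV.
Qed.

Lemma holo_gh n m (U : set (CN R n)) (f : CN R n -> CN R m) w j : open U -> holo_on U f -> U w ->
  gh (fun x : 'rV[C]_n => (f x : 'rV[C]_m) 0 j) w.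
Proof.
move=> oU hf Uw; apply: nrW (open_nr oU Uw) => x Ux.
have df := hf _ Ux; split.
  apply: (cont_comp (f := (f : 'rV[C]_n -> 'rV[C]_m)) (g := fun y : 'rV[C]_m => y 0 j)).
    exact: diff_contV.
  exact: cont_coord.
by move=> v; eexists; exact: (diff_cder v j df).
Qed.

(** Compactness in filter form, with [e] tending to 0 from the right. [P] is not assumed monotone in
    [e], so the local premise speaks of all small [e]. *)
Lemma compact_unif n (K : set (CN R n)) (P : R -> 'rV[C]_n -> Prop) : compact K ->
  (forall x : 'rV[C]_n, K x ->
     exists2 e0, 0 < e0 & nr x (fun y => forall e, 0 < e -> e <= e0 -> P e y)) ->
  exists2 e, 0 < e & forall x : 'rV[C]_n, K x -> P e x.
Proof.
move=> /compact_near_coveringP cK h.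
have := @cK R (0 : R)^'+ (fun e x => 0 < e -> P e x) _.
case=> [x Kx|].
- have [e0 e00 hx] := h _ Kx.
  exists ([set y : CN R n | forall e, 0 < e -> e <= e0 -> P e y], [set e | e <= e0]).
    split; first by apply/nbhsV.
    exact: nbhs_right_le.
  by move=> [y e] /= [h1 h2] e1; exact: h1.
move=> d /= d0 hd; exists (d / 2); first by rewrite divr_gt0.
move=> x Kx; apply: (hd (d / 2)) => //; rewrite ?divr_gt0//=.
  by rewrite sub0r normrN gtr0_norm ?divr_gt0// ltr_pdivrMr//; lra.
Qed.

End Conversion.

Section Subvarieties.
Context {R : realType}.
Local Notation C := R[i].
Variable N : nat.
Local Notation V := 'rV[C]_N.

Lemma zero_locusP m (A U : set (CN R N)) (f : CN R N -> CN R m) (y : V) :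
  A `&` U = U `&` f @^-1` [set 0] -> U y -> A y <-> forall j, (f y : 'rV[C]_m) 0 j = 0.
Proof.
move=> E Uy; split=> [Ay j|h].
  have : (A `&` U) y by [].
  by rewrite E => -[_ /= ->]; rewrite mxE.
have : (U `&` f @^-1` [set 0]) y by split=> //=; apply/rowP => j; rewrite h mxE.
by rewrite -E => -[].
Qed.

Lemma analytic_local (A : set (CN R N)) : analytic_set A -> forall p : V,
  exists m (fs : 'I_m -> V -> C), (forall i, gh (fs i) p) /\
    nr p (fun y => A y <-> forall i, fs i y = 0).
Proof.
move=> h p; have [U [m [f [oU Up hf E]]]] := h p.
exists m, (fun j (x : V) => (f x : 'rV[C]_m) 0 j); split.
  by move=> j; exact: holo_gh hf Up.
by apply: nrW (open_nr oU Up) => y Uy; exact: zero_locusP E Uy.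
Qed.

(** At a regular point of dimension $N-1$ the defining map has $N-(N-1)=1$ coordinate; this is the
    single function. *)
Lemma hypersurface_regular (A : set (CN R N)) : (0 < N)%N -> subvariety_codim A 1 ->
  forall (x : V) P, A x -> nr x P -> exists w : V, [/\ P w, A w &
    exists2 g : V -> C, gh g w & nr w (fun y : V => A y <-> g y = 0)].
Proof.
move=> N0 [_ _ hd] x P Ax hP; have [h _] := hd _ Ax.
have [w [hw [_ Aw [U [g [oU Uw hg E _]]]]]] := h _ (nr_open (P := P)) hP.
have j0 : 'I_(N - (N - 1)) by apply: (@Ordinal _ 0); rewrite subn_gt0 subn1 prednK.
exists w; split=> //; first exact: nr_at hw.
exists (fun y : V => (g y : 'rV[C]_(N - (N - 1))) 0 j0); first exact: holo_gh hg Uw.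
apply: nrW (open_nr oU Uw) => y Uy.
have := zero_locusP E Uy => -[h1 h2]; split=> [/h1//|gy]; apply: h2 => j.
suff -> : j = j0 by [].
apply: val_inj; have e1 : (N - (N - 1) = 1)%N by rewrite subKn.
have z (i : 'I_(N - (N - 1))) : val i = 0%N.
  by apply/eqP; rewrite -leqn0 -ltnS; apply: leq_trans (ltn_ord i) _; rewrite e1.
by rewrite !z.
Qed.

(** An interior point is cut out by no equation, that is, by the zero map into a space of dimension
    $N-N=0$. For a hypersurface this contradicts the dimension bound, so its interior is empty. *)
Lemma regular_full (A : set (CN R N)) (x : V) : nr x A -> regular_dim A x N.
Proof.
move=> hx; split=> //; first exact: nr_at hx.
exists [set y : CN R N | nr (y : V) A], (fun _ => 0); split=> //.
- exact: nr_open.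
- by apply/seteqP; split=> y /= [h1 h2]; split=> //; exact: nr_at h1.
- move=> w _ _ v; exists 0; apply/rowP => j; exfalso.
  by have := ltn_ord j; rewrite {2}subnn.
Qed.

Lemma hypersurface_thin (A : set (CN R N)) : (0 < N)%N -> subvariety_codim A 1 ->
  forall x : V, ~ nr x A.
Proof.
move=> N0 [_ _ hd] x hx; have [_ [U [oU Ux h]]] := hd _ (nr_at hx).
by have := h _ _ Ux (regular_full hx); rewrite leq_subRL// add1n ltnn.
Qed.

(* identity theorem along segments: the interior of an analytic set is closed *)
Lemma codim0_full (A : set (CN R N)) (z : V) : subvariety_codim A 0 -> A z -> forall y : V, A y.
Proof.
move=> [_ hA hd] Az y; have [h _] := hd _ Az.
have [w [_ [_ Aw [U [g [oU Uw hg E _]]]]]] := h _ openT I.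
have Aw' : nr (w : V) A.
  apply: nrW (open_nr oU Uw) => u Uu; apply/(zero_locusP E Uu) => j; exfalso.
  have : (j < 0)%N by apply: leq_trans (ltn_ord j) _; rewrite subn0 subnn.
  by [].
pose q (t : R) : V := (w : V) + t%:C%C *: (y - w).
have q0 : q 0 = w by rewrite /q rmorph0 scale0r addr0.
have q1 : q 1 = y by rewrite /q rmorph1 scale1r addrC subrK.
suff : nr (q 0) A -> nr (q 1) A by rewrite q0 q1 => h1; exact: (nr_at (h1 Aw')).
have qB s t : q t - q s = (t - s)%:C%C *: (y - w).
  by rewrite /q opprD addrACA subrr add0r -scalerBl -rmorphB.
have qd s t : nV (q t - q s) <= `|t - s| * nV (y - w).
  by rewrite qB; apply: le_trans (nVZ _ _) _; rewrite nc_real.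
apply: (@bisect1 _ (fun a b => nr (q a) A -> nr (q b) A)); first exact: ler01.
  by move=> a m b _ _ _ h1 h2 h3; apply: h2; exact: h1.
move=> s _; have [m [fs [gf hf]]] := analytic_local hA (q s).
have [e e0 he] := nrI (nrI_fin (fun i => gh_nr (gf i))) (nr_nr hf).
have B0 : 0 < nV (y - w) + 1 by have := nV_ge0 (y - w); lra.
exists (e / (nV (y - w) + 1)); first by rewrite divr_gt0.
move=> a b _ _ /andP[as_ sb] ab0 hqa.
have ab : (b - a) * (nV (y - w) + 1) < e by rewrite -ltr_pdivlMr.
have inb c : a <= c <= b -> dist (q s) (q c) < e.
  move=> /andP[ac cb]; rewrite distVE; apply: le_lt_trans (qd _ _) _.
  apply: le_lt_trans ab; apply: ler_pM; rewrite ?normr_ge0 ?nV_ge0//.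
    by rewrite ler_norml; lra.
  by rewrite lerDl.
have ab' : a <= b by lra.
have aa : a <= a <= b by rewrite lexx.
have bb : a <= b <= b by rewrite lexx andbT.
have [_ ha] := he _ (inb a aa); have [_ hb] := he _ (inb b bb).
have fb : nr (q b) (fun u => forall i, fs i u = 0).
  apply: nrI_fin => i; apply: (gh_identity (x := q a)).
    move=> t /andP[t0 t1].
    have -> : q a + t%:C%C *: (q b - q a) = q (a + t * (b - a)).
      by rewrite qB scalerA -addrA -scalerDl -rmorphM -rmorphD.
    have h2 : 0 <= t * (b - a) by rewrite mulr_ge0// subr_ge0.
    have h3 : t * (b - a) <= 1 * (b - a) by rewrite ler_wpM2r// subr_ge0.
    have h4 : a <= a + t * (b - a) <= b by apply/andP; split; lra.
    by have [h1 _] := he _ (inb _ h4); exact: h1.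
  by apply: nrW2 ha hqa => u [h1 _] Au; exact: (h1 Au).
by apply: nrW2 hb fb => u [_ h2] h3; exact: h2.
Qed.

End Subvarieties.

(** * Separation of a point from a rationally convex set by a polynomial *)

Section Separation.
Context {R : realType}.
Local Notation C := R[i].
Variable N : nat.
Local Notation V := 'rV[C]_N.

Lemma poly_gh (p : V -> C) x : @poly_fun R N p -> gh p x.
Proof.
elim=> [c|i|p1 q1 _ h1 _ h2|p1 q1 _ h1 _ h2].
- exact: gh_cst.
- exact: gh_coord.
- exact: ghD.
- exact: ghM.
Qed.

Lemma compact_bound (K : set (CN R N)) (g : V -> R) : compact K ->
  (forall x : V, K x -> exists M, nr x (fun y => g y <= M)) ->
  exists2 M, 0 < M & forall x : V, K x -> g x <= M.
Proof.
move=> cK h.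
have [|e e0 he] := @compact_unif _ _ K (fun e y => g y <= e^-1) cK; last first.
  by exists e^-1; rewrite ?invr_gt0.
move=> x Kx; have [M hM] := h _ Kx.
have M0 : 0 < `|M| + 1 by have := normr_ge0 M; lra.
exists (`|M| + 1)^-1; first by rewrite invr_gt0.
apply: nrW hM => y hy e e0 he; apply: le_trans hy _.
rewrite -[e]invrK lef_pV2 ?posrE ?invr_gt0// in he.
by have := ler_norm M; lra.
Qed.

Lemma compact_max (K : set (CN R N)) (f : V -> C) : compact K -> (forall x, cont f x) ->
  exists2 M, 0 < M & forall x : V, K x -> nc (f x) <= M.
Proof.
move=> cK cf; apply: (compact_bound (g := fun x => nc (f x))) => // x _.
by exists (nc (f x) + 1); exact: cont_bound.
Qed.

Lemma compact_min (K : set (CN R N)) (f : V -> C) : compact K ->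
  (forall x : V, K x -> cont f x /\ f x != 0) ->
  exists2 d, 0 < d & forall x : V, K x -> d <= nc (f x).
Proof.
move=> cK cf.
have [|M M0 hM] := compact_bound (g := fun x => (nc (f x))^-1) cK.
  move=> x Kx; have [c1 c2] := cf _ Kx; exists (nc ((f x)^-1) + 1).
  by apply: nrW (cont_bound (contV c2 c1)) => y; rewrite -ncV.
exists M^-1 => [|x Kx]; first by rewrite invr_gt0.
have [_ f0] := cf _ Kx.
by rewrite -[leRHS]invrK lef_pV2 ?posrE ?invr_gt0 ?nc_gt0//; exact: hM.
Qed.

Lemma compact_radius (K : set (CN R N)) : compact K ->
  exists2 M, 0 < M & forall x : V, K x -> nV x <= M.
Proof.
move=> cK; apply: (compact_bound (g := fun x : V => nV x)) => // x _.
exists (nV x + 1); exists 1 => // y; rewrite distVE => hy.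
by have := nVD (y - x) x; rewrite subrK; lra.
Qed.

(** Rational convexity provides a subvariety of codimension 0 or 1. In codimension 0 it is the whole
    space, so [K] is empty and the zero polynomial serves; the hypersurface case uses a generator on
    a cube. *)
Lemma separating_polynomial (K : set (CN R N)) : (0 < N)%N -> compact K ->
  rationally_convex K -> forall z : V, ~ K z ->
  exists2 p, @poly_fun R N p & p z = 0 /\ forall x : V, K x -> p x != 0.
Proof.
move=> N0 cK rK z nKz.
have [A [m [m1 hA Az nA]]] : exists A m, [/\ (m <= 1)%N, subvariety_codim A m, A z &
    forall x : V, A x -> K x -> False].
  apply: contrapT => H; apply: nKz; rewrite -rK => A m m1 hA Az.
  apply: contrapT => H1; apply: H; exists A, m; split=> // x Ax Kx.
  by apply: H1; exists x.
case: m m1 hA => [|[|//]] _ hA.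
  exists (fun _ => 0); first exact: poly_cst.
  by split=> // x Kx; case: (nA x) => //; exact: codim0_full hA Az x.
have hA1 : analytic_set A by case: hA.
have a1 := analytic_local hA1.
have a2 := hypersurface_regular N0 hA.
have a3 := hypersurface_thin N0 hA.
have [M M0 hM] := compact_radius cK.
(* Twice the radius that contains [K] and [z], because [poly_approx] approximates on the polydisc of
   half size. *)
pose r := M + nV z; pose rho := 2 * r.
have r0 : 0 < r by have := nV_ge0 z; rewrite /r; lra.
have rho0 : 0 < rho by rewrite /rho; lra.
have lohi (k : 'I_N * bool) : - rho <= rho by lra.
have [F [e [e0 hF]]] := has_generator_all a1 a2 a3 lohi; clear lohi.
have small (x : V) : nV x <= r -> forall k, nc (x 0 k) <= rho / 2.
  by move=> hx k; have := nV_coord x k; rewrite /rho; lra.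
have zr : nV z <= r by rewrite /r; lra.
have Kr x : K x -> nV x <= r by move=> /hM; have := nV_ge0 z; rewrite /r; lra.
have gF (x : V) : nV x <= r -> generates A F x.
  by move=> hx; apply: hF; apply: small_cube => //; exact: small.
have Fz : F z = 0 by apply: generates_eq0 (gF _ zr) Az.
have [x Kx|d d0 hd] := compact_min (f := F) cK.
  have gx := gF _ (Kr _ Kx); split; first by apply: gh_cont; case: gx.
  exact: (generates_neq0 a1 gx (fun Ax => nA _ Ax Kx)).
have ghF x : bx (fun _ : 'I_N * bool => - rho) (fun _ => rho) e x -> gh F x.
  by move=> /hF[].
(* One error at [x] and one at [z] leave at least [d / 3] of the lower bound [d] after subtracting
   the value at [z]. *)
have d3 : 0 < d / 3 by lra.
have [p pp hp] := poly_approx rho0 e0 ghF d3.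
exists (fun x => p x + - p z); first by apply: poly_add => //; exact: poly_cst.
split=> [|x Kx]; first by rewrite subrr.
have h1 := hp _ (small _ zr); rewrite Fz sub0r ncN in h1.
have h2 := hp _ (small _ (Kr _ Kx)); have h3 := hd _ Kx.
rewrite -nc_gt0; have -> : p x - p z = F x - ((F x - p x) + p z) by ring.
by have := nc_sub (F x) (F x - p x + p z); have := ncD (F x - p x) (p z); lra.
Qed.

End Separation.

(** * Zero sets of polynomials have pure codimension one *)

Section PolynomialHypersurface.
Context {R : realType}.
Local Notation C := R[i].

Lemma cder_lip (H : C -> C) (a b : C) M : 0 <= M ->
  (forall t : R, 0 <= t <= 1 -> exists2 D, cder H (a + t%:C%C * (b - a)) D & nc D <= M) ->
  nc (H b - H a) <= M * nc (b - a).
Proof.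
move=> M0 h; pose G (t : R) := H (a + t%:C%C * (b - a)).
have -> : H b = G 1 by rewrite /G rmorph1 mul1r addrC subrK.
have -> : H a = G 0 by rewrite /G rmorph0 mul0r addr0.
rewrite -[M * _]mulr1 -[in X in _ <= _ * X](subr0 1).
apply: mvt => [|x e hx e0]; first exact: ler01.
have [D hD DM] := h x hx.
have b1 : 0 < nc (b - a) + 1 by have := nc_ge0 (b - a); lra.
have e1 : 0 < e / (nc (b - a) + 1) by rewrite divr_gt0.
have [d d0 hd] := cder_eps hD e1.
exists (d / (nc (b - a) + 1)); first by rewrite divr_gt0.
move=> y _ hy.
have E : (a + y%:C%C * (b - a)) - (a + x%:C%C * (b - a)) = (y - x)%:C%C * (b - a).
  by rewrite rmorphB /=; ring.
have ey : `|y - x| * nc (b - a) < d.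
  apply: le_lt_trans (_ : `|y - x| * (nc (b - a) + 1) < d); last by rewrite -ltr_pdivlMr.
  by rewrite ler_wpM2l// lerDl.
have := hd (a + y%:C%C * (b - a)); rewrite distCE E ncM nc_real => /(_ ey).
rewrite -/(G y) -/(G x) => h1.
set k := `|y - x| in h1 ey *; set l := nc (b - a) in h1 ey b1 *.
have k0 : 0 <= k := normr_ge0 _; have l0 : 0 <= l := nc_ge0 _.
have h2 : nc (D * ((y - x)%:C%C * (b - a))) <= M * (k * l).
  by rewrite !ncM nc_real ler_wpM2r// mulr_ge0.
have h3 : e / (l + 1) * (k * l) <= e * k.
  have -> : e / (l + 1) * (k * l) = e * k * (l / (l + 1)) by field; rewrite gt_eqF.
  rewrite ler_piMr ?mulr_ge0 ?(ltW e0)// ler_pdivrMr//; lra.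
have := ncD (G y - G x - D * ((y - x)%:C%C * (b - a))) (D * ((y - x)%:C%C * (b - a))).
rewrite subrK => h4.
have -> : (M * l + e) * k = M * (k * l) + e * k by ring.
lra.
Qed.

Lemma cderX m (s : C) : cder (fun t => t ^+ m.+1) s (m.+1%:R * s ^+ m).
Proof.
elim: m => [|m IH]; first by rewrite mulr1; exact: cder_id.
have := cderM (cder_id s) IH; rewrite mul1r => h.
have -> : m.+2%:R * s ^+ m.+1 = s ^+ m.+1 + s * (m.+1%:R * s ^+ m).
  by rewrite -[m.+2%:R]natr1 exprS; ring.
by apply: cder_eq h; apply: nr_all => t; rewrite [RHS]exprS.
Qed.

Variable N : nat.
Local Notation V := 'rV[C]_N.

Lemma dirder_val v (f : V -> C) x d : cder (fun t => f (x + t *: v)) 0 d -> dirder v f x = d.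
Proof. by move=> h; exact: (cder_uniq (cderivP (ex_intro _ d h)) h). Qed.

Lemma dirder_poly v (p : V -> C) : @poly_fun R N p -> @poly_fun R N (dirder v p).
Proof.
elim=> [c|i|p1 q1 h1 d1 h2 d2|p1 q1 h1 d1 h2 d2].
- rewrite (_ : dirder v _ = fun _ => 0); first exact: poly_cst.
  by apply/funext => x; apply: dirder_val; exact: cder_cst.
- rewrite (_ : dirder v _ = fun _ => v 0 i); first exact: poly_cst.
  apply/funext => x; apply: dirder_val.
  have := cderD (cder_cst (x 0 i) 0) (cderM (cder_id 0) (cder_cst (v 0 i) 0)).
  rewrite mul1r mul0r add0r addr0; apply: cder_eq; apply: nr_all => t; by rewrite !mxE.
- rewrite (_ : dirder v _ = fun x => dirder v p1 x + dirder v q1 x); first exact: poly_add.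
  apply/funext => x; apply: dirder_val; apply: cderD; apply: cderivP.
    by have [_] := gh_GH (poly_gh x h1).
  by have [_] := gh_GH (poly_gh x h2).
- rewrite (_ : dirder v _ = fun x => dirder v p1 x * q1 x + p1 x * dirder v q1 x).
    by apply: poly_add; exact: poly_mul.
  apply/funext => x; apply: dirder_val.
  have a1 : cder (fun t => p1 (x + t *: v)) 0 (dirder v p1 x).
    by apply: cderivP; have [_] := gh_GH (poly_gh x h1).
  have a2 : cder (fun t => q1 (x + t *: v)) 0 (dirder v q1 x).
    by apply: cderivP; have [_] := gh_GH (poly_gh x h2).
  by have := cderM a1 a2; rewrite scale0r addr0.
Qed.

Lemma poly_iter v m (p : V -> C) : @poly_fun R N p -> @poly_fun R N (iter m (dirder v) p).
Proof. by move=> h; elim: m => //= m; exact: dirder_poly. Qed.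

Lemma poly_diff (p : CN R N -> C) x : poly_fun p -> differentiable (p : CN R N -> C^o) x.
Proof.
elim=> [c|i|p1 q1 _ h1 _ h2|p1 q1 _ h1 _ h2].
- exact: differentiable_cst.
- exact: differentiable_coord.
- exact: differentiableD.
- exact: differentiableM.
Qed.

(** Each derivative lowers the order of vanishing by one: the derivative of $s^{m+1} g$ is
    $s^m((m+1)g + s g')$, and the new factor is again nonzero at 0. *)
Lemma iter_dirder_neq0 v m (f : V -> C) x (g : C -> C) : gh f x ->
  nr (0 : C) (fun t => f (x + t *: v) = t ^+ m * g t) -> nr (0 : C) (cdiff g) -> g 0 != 0 ->
  iter m (dirder v) f x != 0.
Proof.
elim: m f g => [|m IH] f g gf E dg g0.
  by have := nr_at E; rewrite scale0r addr0 mul1r /= => ->.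
rewrite iterSr; apply: (IH _ (fun s => m.+1%:R * g s + s * cderiv g s)).
- exact: gh_dirder.
- have hl : nr (0 : C) (fun s => GH f (x + s *: v)).
    apply: (cont_nr (f := fun s : C => x + s *: v) (P := GH f)); first exact: cont_line.
    by rewrite scale0r addr0.
  apply: nrW2 (nrI hl dg) (nr_nr E) => s [h1 h2] h3.
  have k1 := dirder_cder h1.
  have k2 := cderM (cderX m s) (cderivP h2).
  have k3 : cder (fun t => f (x + t *: v)) s (m.+1%:R * s ^+ m * g s + s ^+ m.+1 * cderiv g s).
    by apply: cder_eq k2; apply: nrW h3 => t ->.
  by rewrite (cder_uniq k1 k3) exprS; ring.
- apply: nrW (nr_nr dg) => s hs; apply: cdiffD.
    by apply: cdiffM; [exact: cdiff_cst|exact: nr_at hs].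
  by apply: cdiffM; [exact: cdiff_id|exact: cderiv_cdiff].
- by rewrite mul0r addr0 mulf_neq0// pnatr_eq0.
Qed.

(** The restriction of [p] to the line from [z] to [y] is not identically zero, so it vanishes to a
    finite order at [z]. *)
Lemma finite_order (p : V -> C) z y : @poly_fun R N p -> p y != 0 ->
  exists m, iter m (dirder (y - z)) p z != 0.
Proof.
move=> pp py; set v := y - z.
have df s : nr s (cdiff (fun t : C => p (z + t *: v))) by apply: gh_line; exact: poly_gh.
case: (isolated_zero (df 0)) => [h|[m [g [h1 h2 h3]]]].
  have := @identity_seg _ (fun t : C => p (z + t *: v)) 0 1 (fun _ _ => df _) h.
  by move=> /nr_at; rewrite scale1r /v addrC subrK => p0; rewrite p0 eqxx in py.
exists m; apply: (iter_dirder_neq0 (g := g)) => //.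
- exact: poly_gh.
- by apply: nr_all => t; rewrite h1 subr0.
- by apply: nrW (df 0) => t; exact: h2.
Qed.

(** Near [w] the function $q(y+tv)-dt$ has derivative of modulus at most $|d|/2$, so $q(y+tv)=q(y)$
    forces $|dt| \le |dt|/2$. The radius is the same for all base points near [w]. *)
Lemma line_injective v (q : V -> C) w : gh q w -> dirder v q w != 0 ->
  exists2 r, 0 < r & nr w (fun y => forall t, sq 0 r t -> q (y + t *: v) = q y -> t = 0).
Proof.
move=> gq d0; set d := dirder v q w in d0 *.
have dd : 0 < nc d / 2 by rewrite divr_gt0// nc_gt0.
have h := gh_cont (gh_dirder v gq) dd.
have [r r0 hr] := nr_line v (nrI gq h).
exists r => //; apply: nrW hr => y hy t ht E.
have zr : sq 0 r (0 : C) by apply: sqo_sq; exact: sqo0.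
have [] : nc ((q (y + t *: v) - d * t) - (q (y + 0 *: v) - d * 0)) <= nc d / 2 * nc (t - 0).
  apply: (@cder_lip (fun t => q (y + t *: v) - d * t)); first exact: ltW.
  move=> s hs; have := sq_seg zr ht hs; set u := 0 + _ => hu.
  have [hu1 hu2] := hy _ hu.
  exists (dirder v q (y + u *: v) - d); last by rewrite distCE in hu2; exact: ltW.
  have := cderD (dirder_cder hu1) (cderN (cderM (cder_cst d u) (cder_id u))).
  by rewrite mul0r add0r mulr1.
rewrite E scale0r addr0 mulr0 !subr0 addrAC subrr add0r ncN ncM => h1.
apply/eqP; rewrite -nc_eq0; have := nc_ge0 t; rewrite le_eqVlt => /orP[/eqP<-//|t0].
by have : nc d / 2 * nc t > 0 by [rewrite mulr_gt0]; lra.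
Qed.

Section Locus.
Variables (p : V -> C) (U : set (CN R N)) (v : V).
Hypotheses (pp : @poly_fun R N p) (oU : open U).

(* a derivative of p vanishing on its zero set but with nonzero differential at w; Hurwitz along v gives the converse inclusion *)
Lemma reduced_equation (q : V -> C) (w : V) : @poly_fun R N q -> U w -> p w = 0 ->
  (forall y : V, U y -> p y = 0 -> q y = 0) -> dirder v q w != 0 ->
  nr w (fun y => p y = 0 <-> q y = 0).
Proof.
move=> qq Uw pw hq dq.
have [r1 r10 inj] := line_injective (poly_gh w qq) dq.
have [r2 r20 hU] := nr_line v (open_nr oU Uw).
have [r3 r30 nz] : exists2 r3, 0 < r3 & forall t, sq 0 r3 t -> t != 0 -> p (w + t *: v) != 0.
  have df : nr (0 : C) (cdiff (fun t : C => p (w + t *: v))) by apply: gh_line; exact: poly_gh.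
  case: (isolated_nr df) => [h|/nr_sq[r3 r30 h]]; last by exists r3.
  exfalso; apply: (@nr_not_single R 0 0).
  have s1 : nr (0 : C) (sq 0 r1) by exists r1 => // t ht; apply: sqo_sq; exact: nc_sqo.
  have s2 : nr (0 : C) (sq 0 r2) by exists r2 => // t ht; apply: sqo_sq; exact: nc_sqo.
  apply: nrW2 h (nrI s1 s2) => t ht [h1 h2].
  apply: (nr_at inj) => //.
  by rewrite !hq//; exact: (nr_at hU).
pose r := Num.min r1 (Num.min r2 r3).
have r0 : 0 < r by rewrite !lt_min r10 r20.
have [rr1 rr2 rr3] : [/\ r <= r1, r <= r2 & r <= r3] by rewrite !ge_min !lexx !orbT.
have sub r' t : r <= r' -> sq 0 r t -> sq 0 r' t.
  by move=> h [/andP[? ?] /andP[? ?]]; split; apply/andP; split; lra.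
have jc z : jcont (fun (y : V) (t : C) => p (y + t *: v)) w z.
  apply: (cont_comp (f := fun u : metP (metV N) metC => u.1 + u.2 *: v) (g := p)).
    apply: contVD; first exact: cont_fst.
    by apply: contVZ; [exact: cont_snd|exact: cont_cst].
  by apply: gh_cont; exact: poly_gh.
have : nr w (fun y => exists2 t, sq 0 r t & p (y + t *: v) = 0).
  apply: (@param_zero R (metV N) (fun (y : V) (t : C) => p (y + t *: v)) w 0 r) => //.
  - by rewrite scale0r addr0.
  - move=> z hz; split; first exact: jc.
    apply: nz; first by apply: sub rr3 _; apply: sqb_sq hz; exact: ltW.
    by rewrite -nc_gt0; have := sqb_ge hz; rewrite subr0; lra.
  - apply: nr_all => y z _; apply: GH_line; apply: gh_GH; exact: poly_gh.
apply: nrW2 (nrI inj hU) => y [h1 h2] [t ht pt]; split.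
  move=> py; apply: hq => //.
  by have := h2 0; rewrite scale0r addr0; apply; apply: sqo_sq; exact: sqo0.
move=> qy; have qt : q (y + t *: v) = 0 by apply: hq => //; apply: h2; exact: sub rr2 ht.
have t0 : t = 0 by apply: h1; [exact: sub rr1 ht|rewrite qt qy].
by move: pt; rewrite t0 scale0r addr0.
Qed.

End Locus.

(** Subvarieties are cut out by maps into some [CN R m]; a single function enters as a multiple of
    the all-ones row. *)
Lemma poly_row_diff m (q : CN R N -> C) x : poly_fun q ->
  differentiable (fun y : CN R N => q y *: (const_mx 1 : CN R m)) x.
Proof. by move=> h; apply: differentiableZl; exact: poly_diff. Qed.

(** With repeated factors the differential of [p] may vanish on the whole zero set. Inside a given
    open set a derivative of [p] of suitable order replaces it as the regular equation. *)
Lemma poly_subvariety (p : CN R N -> C) (y0 : V) : (0 < N)%N -> poly_fun p -> p y0 != 0 ->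
  subvariety_codim [set y | p y = 0] 1.
Proof.
move=> N0 pp py0; split=> //.
  move=> x; exists setT, 1%N, (fun y => p y *: (const_mx 1 : CN R 1)); split=> //.
  - exact: openT.
  - by move=> w _; exact: poly_row_diff.
  apply/seteqP; split=> y /=; first by move=> [-> _]; rewrite scale0r.
  by move=> [_ /rowP/(_ 0)]; rewrite !mxE mulr1.
have e1 : (N - (N - 1) = 1)%N by rewrite subKn.
have z0 (i : 'I_(N - (N - 1))) : val i = 0%N.
  by apply/eqP; rewrite -leqn0 -ltnS; apply: leq_trans (ltn_ord i) _; rewrite e1.
have j0 : 'I_(N - (N - 1)) by apply: (@Ordinal _ 0); rewrite e1.
have all0 (i : 'I_(N - (N - 1))) : i = j0 by apply: val_inj; rewrite /= !z0.
move=> z /= pz; split; last first.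
  (* A regular point of dimension [N] would make [p] vanish on an open set and hence at [y0]. *)
  exists setT; split=> //; first exact: openT.
  move=> w e _ [eN _ [U [g [oU Uw hg E _]]]].
  rewrite leq_subRL// add1n ltn_neqAle eN andbT; apply/eqP => eN'; subst e.
  have : nr (w : V) (fun y => p y = 0).
    apply: nrW (open_nr oU Uw) => u Uu; apply/(zero_locusP E Uu) => j; exfalso.
    by have := ltn_ord j; rewrite {2}subnn.
  move=> /(gh_identity (y := y0) (fun _ _ => poly_gh _ pp)) /nr_at h.
  by rewrite h eqxx in py0.
move=> U oU Uz; set v : V := y0 - z.
(* For the least such order all lower derivatives vanish at every zero of [p] in [U]. The derivative
   of order one less is therefore an equation on [U] whose differential is nonzero at [w]. *)
pose S m := `[< exists w : V, [/\ U w, p w = 0 & iter m (dirder v) p w != 0] >].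
have exS : exists m, S m.
  have [m hm] := finite_order z pp py0.
  by exists m; apply/asboolP; exists z.
case: (ex_minnP exS) => -[|m] /asboolP[w [Uw pw dw]] mini.
  by rewrite /= pw eqxx in dw.
pose q := iter m (dirder v) p; have qq : @poly_fun R N q by exact: poly_iter.
have hq (y : V) : U y -> p y = 0 -> q y = 0.
  move=> Uy py; apply: contrapT => /eqP qy.
  have : S m by apply/asboolP; exists y.
  by move=> /mini; rewrite ltnn.
have dq : dirder v q w != 0 by [].
have eqn := reduced_equation pp oU qq Uw pw hq dq.
have dn : nr w (fun y => dirder v q y != 0).
  by apply: cont_neq0 => //; apply: gh_cont; apply: poly_gh; exact: dirder_poly.
exists w; split=> //; split=> //; first exact: leq_subr.
pose P (y : V) := (p y = 0 <-> q y = 0) /\ dirder v q y != 0.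
exists [set y : CN R N | nr (y : V) P], (fun y => q y *: (const_mx 1 : CN R (N - (N - 1)))).
split.
- exact: nr_open.
- exact: nrI.
- by move=> y _; exact: poly_row_diff.
- apply/seteqP; split=> y /=.
    by move=> [py hy]; split=> //; have [[h1 _] _] := nr_at hy; rewrite h1// scale0r.
  move=> [hy /rowP/(_ j0)]; rewrite !mxE mulr1 => qy; split=> //.
  by have [[_ h2] _] := nr_at hy; exact: h2.
move=> y py /nr_at[_ dy] u.
exists (((u : 'rV[C]_(N - (N - 1))) 0 j0 / dirder v q y) *: v).
rewrite linearZ; apply/rowP => j; rewrite (all0 j) mxE.
have := diff_cder v j0 (poly_row_diff (N - (N - 1)) y qq).
move=> h; have {}h : cder (fun t => q (y + t *: v)) 0
   (('d (fun y : CN R N => q y *: (const_mx 1 : CN R (N - (N - 1)))) y v : 'rV[C]__) 0 j0).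
  by apply: cder_eq h; apply: nr_all => t; rewrite !mxE mulr1.
by rewrite -(dirder_val h) divfK.
Qed.

End PolynomialHypersurface.

(** * Construction of X *)

Section CountableFamily.
Context {R : realType}.
Local Notation C := R[i].
Variable N : nat.
Local Notation V := 'rV[C]_N.

(* postfix programs over a stack of functions: they enumerate the polynomials with coefficients in Q(i) *)
Definition token := ((rat * rat) + ('I_N + bool))%type.

Definition exec (s : seq (V -> C)) (t : token) : seq (V -> C) :=
  match t with
  | inl (a, b) => (fun _ => Complex (ratr a) (ratr b)) :: s
  | inr (inl i) => (fun x : V => x 0 i) :: s
  | inr (inr b) =>
      if s is f :: g :: s' then
        (if b then (fun x => g x + f x) else (fun x => g x * f x)) :: s'
      else s
  end.

(** Running over an arbitrary stack [s] is what lets programs be concatenated. *)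
Definition program (q : V -> C) := exists t : seq token, forall s, foldl exec s t = q :: s.

Lemma program_rat (a b : rat) : program (fun _ => Complex (ratr a) (ratr b)).
Proof. by exists [:: inl (a, b)]. Qed.

Lemma program_coord i : program (fun x => x 0 i).
Proof. by exists [:: inr (inl i)]. Qed.

Lemma program_add p q : program p -> program q -> program (fun x => p x + q x).
Proof.
move=> [t ht] [u hu]; exists (t ++ u ++ [:: inr (inr true)]) => s.
by rewrite !foldl_cat ht hu.
Qed.

Lemma program_mul p q : program p -> program q -> program (fun x => p x * q x).
Proof.
move=> [t ht] [u hu]; exists (t ++ u ++ [:: inr (inr false)]) => s.
by rewrite !foldl_cat ht hu.
Qed.

Definition enum_poly (j : nat) : V -> C :=
  if unpickle j is Some t then head (fun _ => 1) (foldl exec [::] t) else (fun _ => 1).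

Lemma program_enum q : program q -> exists j, enum_poly j = q.
Proof. by move=> [t ht]; exists (pickle t); rewrite /enum_poly pickleK ht. Qed.

Lemma enum_poly_fun j : @poly_fun R N (enum_poly j).
Proof.
rewrite /enum_poly; case: (unpickle j) => [t|]; last exact: poly_cst.
(* Invariant: all stack entries are polynomials; the default 1 of [nth] covers positions past the
   end. *)
have : forall s, (forall i, @poly_fun R N (nth (fun _ => 1) s i)) ->
    forall i, @poly_fun R N (nth (fun _ => 1) (foldl exec s t) i).
  elim: t => [//|a t IH] s hs; apply: IH.
  case: a => [[a b]|[i|b]] /=.
  - by case=> [|i] /=; [exact: poly_cst|exact: hs].
  - by case=> [|j'] /=; [exact: poly_coord|exact: hs].
  case: s hs => [|f [|g s]] hs //=.
  have hf := hs 0%N; have hg := hs 1%N; rewrite /= in hf hg.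
  case=> [|i] /=; last exact: (hs i.+2).
  by case: b; [exact: poly_add|exact: poly_mul].
move=> /(_ [::]) h; rewrite -nth0; apply: h => i; rewrite nth_nil; exact: poly_cst.
Qed.

Lemma poly_bounded (p : V -> C) B : @poly_fun R N p ->
  exists2 M, 0 < M & forall x : V, nV x <= B -> nc (p x) <= M.
Proof.
elim=> [c|i|p1 q1 _ [M1 M10 h1] _ [M2 M20 h2]|p1 q1 _ [M1 M10 h1] _ [M2 M20 h2]].
- by exists (nc c + 1) => [|x _]; have := nc_ge0 c; lra.
- exists (`|B| + 1) => [|x hx]; first by have := normr_ge0 B; lra.
  by have := nV_coord x i; have := ler_norm B; lra.
- exists (M1 + M2) => [|x hx]; first lra.
  by have := ncD (p1 x) (q1 x); have := h1 _ hx; have := h2 _ hx; lra.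
- exists (M1 * M2) => [|x hx]; first exact: mulr_gt0.
  by rewrite ncM ler_pM ?nc_ge0//; [exact: h1|exact: h2].
Qed.

Lemma rat_dense (x e : R) : 0 < e -> exists a : rat, `|x - ratr a| < e.
Proof.
move=> e0; have [|a] := @rat_in_itvoo R (x - e) (x + e); first lra.
by rewrite in_itv /= => /andP[h1 h2]; exists a; rewrite ltr_norml; lra.
Qed.

Lemma program_dense (p : V -> C) B : @poly_fun R N p -> forall eps : R, 0 < eps ->
  exists2 q, program q & forall x : V, nV x <= B -> nc (p x - q x) <= eps.
Proof.
elim=> [c|i|p1 q1 pp1 h1 qq1 h2|p1 q1 pp1 h1 qq1 h2] eps eps0.
- have e2 : 0 < eps / 2 by lra.
  have [a ha] := rat_dense (re c) e2; have [b hb] := rat_dense (im c) e2.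
  exists (fun _ => Complex (ratr a) (ratr b)); first exact: program_rat.
  move=> x _; apply: le_trans (nc_le _) _; rewrite reD imD reN imN /=; lra.
- exists (fun x : V => x 0 i); first exact: program_coord.
  by move=> x _; rewrite subrr nc0 ltW.
- have e2 : 0 < eps / 2 by lra.
  have [p2 pp2 h3] := h1 _ e2; have [q2 qq2 h4] := h2 _ e2.
  exists (fun x => p2 x + q2 x); first exact: program_add.
  move=> x hx; have -> : p1 x + q1 x - (p2 x + q2 x) = (p1 x - p2 x) + (q1 x - q2 x) by ring.
  by have := ncD (p1 x - p2 x) (q1 x - q2 x); have := h3 _ hx; have := h4 _ hx; lra.
(* Both terms of $(p_1-p_2)q_1 + p_2(q_1-q_2)$ are to be at most [eps / 2]; so [q2] is chosen after
   [p2], whose bound is that of [p1] plus its error. *)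
have [M1 M10 b1] := poly_bounded B pp1; have [M2 M20 b2] := poly_bounded B qq1.
have e1 : 0 < eps / (2 * M2) by rewrite divr_gt0// mulr_gt0.
have [p2 pp2 h3] := h1 _ e1.
have M30 : 0 < M1 + eps / (2 * M2) by lra.
have e2 : 0 < eps / (2 * (M1 + eps / (2 * M2))) by rewrite divr_gt0// mulr_gt0.
have [q2 qq2 h4] := h2 _ e2.
exists (fun x => p2 x * q2 x); first exact: program_mul.
move=> x hx.
have -> : p1 x * q1 x - p2 x * q2 x = (p1 x - p2 x) * q1 x + p2 x * (q1 x - q2 x) by ring.
apply: le_trans (ncD _ _) _; rewrite !ncM.
have k1 : nc (p1 x - p2 x) * nc (q1 x) <= eps / (2 * M2) * M2.
  by apply: ler_pM; rewrite ?nc_ge0//; [exact: h3|exact: b2].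
have k2 : nc (p2 x) * nc (q1 x - q2 x) <=
    (M1 + eps / (2 * M2)) * (eps / (2 * (M1 + eps / (2 * M2)))).
  apply: ler_pM; rewrite ?nc_ge0//; last exact: h4.
  by have := nc_sub (p2 x) (p1 x); rewrite ncB; have := h3 _ hx; have := b1 _ hx; lra.
have E1 : eps / (2 * M2) * M2 = eps / 2 by field; rewrite gt_eqF.
have E2 : (M1 + eps / (2 * M2)) * (eps / (2 * (M1 + eps / (2 * M2)))) = eps / 2.
  by set M3 := M1 + _ in M30 *; field; rewrite gt_eqF.
by rewrite E1 in k1; rewrite E2 in k2; lra.
Qed.

End CountableFamily.

(** * Peaking polynomials and the trimmed set *)

Section Construction.
Context {R : realType}.
Local Notation C := R[i].
Variable N : nat.
Local Notation V := 'rV[C]_N.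
Variables (K Sigma : set (CN R N)).
Hypotheses (cK : compact K) (cS : compact Sigma).

(** The first clause matters when [K] is empty: the zero polynomial then satisfies the second one,
    but its zero set is not a hypersurface. *)
Definition admissible (q : V -> C) := (exists y, q y != 0) /\ forall x : V, K x -> q x != 0.

(** Inadmissible polynomials are replaced by 1, which is admissible, so that every index can be
    treated alike. *)
Definition family (j : nat) : V -> C :=
  if `[< admissible (enum_poly j) >] then @enum_poly R N j else fun _ => 1.

Lemma family_poly j : @poly_fun R N (family j).
Proof. by rewrite /family; case: ifP => _; [exact: enum_poly_fun|exact: poly_cst]. Qed.

Lemma family_admissible j : admissible (family j).
Proof.
rewrite /family; case: ifPn => [/asboolP//|_].
by split=> [|x _]; [exists 0|]; exact: oner_neq0.
Qed.

Lemma family_enum q : program q -> admissible q -> exists j, family j = q.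
Proof.
move=> /program_enum[j <-] h; exists j; rewrite /family; case: ifPn => // /asboolP.
by [].
Qed.

Definition peak (P : V -> C) := @poly_fun R N P /\ forall x : V, K x -> 1 <= nc (P x).

(* P' = P^m p / d with d the minimum of |p| on K, m large and e small *)
Lemma peak_step (P p : V -> C) : peak P -> @poly_fun R N p -> (forall x : V, K x -> p x != 0) ->
  exists Q : (V -> C) * R, [/\ peak Q.1, 0 < Q.2 & forall x : V, Sigma x ->
     nc (P x) <= 1 / 2 \/ nc (p x) <= Q.2 -> nc (Q.1 x) <= 1 / 2].
Proof.
move=> [pP hP] pp p0.
have cp x : cont p x by apply: gh_cont; exact: poly_gh.
have cP x : cont P x by apply: gh_cont; exact: poly_gh.
have [|d d0 hd] := compact_min (f := p) cK; first by move=> x Kx; split=> //; exact: p0.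
have [M M0 hM] := compact_max cS cp.
have [B B0 hB] := compact_max cS cP.
have [m hm] : exists m : nat, M / d * (1 / 2) ^+ m <= 1 / 2.
  apply: contrapT => H.
  have H' m : 1 / 2 < M / d * (1 / 2) ^+ m by rewrite ltNge; apply/negP => h; apply: H; exists m.
  suff : 1 <= 1 / 2 :> R by lra.
  apply: (@pow_bound _ _ _ (M / d * 2)); [lra|lra|move=> m].
  by rewrite expr1n; have := H' m; lra.
have Bm : 0 < B ^+ m by exact: exprn_gt0.
exists (fun x => d%:C%C^-1 * (P x ^+ m * p x), d / (2 * B ^+ m)) => /=.
have E x : nc (d%:C%C^-1 * (P x ^+ m * p x)) = nc (P x) ^+ m * (nc (p x) / d).
  by rewrite !ncM ncV ncX nc_real gtr0_norm// mulrC mulrA.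
split.
- split.
    apply: poly_mul; first exact: poly_cst.
    by apply: poly_mul => //; exact: poly_pow.
  move=> x Kx; rewrite E -[1]mulr1 ler_pM//; first exact: exprn_ege1 (hP _ Kx).
  by rewrite ler_pdivlMr// mul1r; exact: hd.
- by rewrite divr_gt0// mulr_gt0.
move=> x Sx h; rewrite E; case: h => [h|h].
  apply: le_trans hm; rewrite mulrC; apply: ler_pM.
  - by rewrite divr_ge0 ?nc_ge0 ?(ltW d0).
  - by rewrite exprn_ge0 ?nc_ge0.
  - by rewrite ler_wpM2r ?invr_ge0 ?(ltW d0)//; exact: hM.
  - by apply: lerXn2r; rewrite ?nnegrE ?nc_ge0// divr_ge0.
have -> : 1 / 2 = B ^+ m * (d / (2 * B ^+ m) / d) :> R by field; rewrite !gt_eqF.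
apply: ler_pM.
- by rewrite exprn_ge0 ?nc_ge0.
- by rewrite divr_ge0 ?nc_ge0 ?(ltW d0).
- by apply: lerXn2r; rewrite ?nnegrE ?nc_ge0 ?(ltW B0)//; exact: hB.
- by rewrite ler_wpM2r ?invr_ge0 ?(ltW d0).
Qed.

(** Dependent choice with [peak_step]. Smallness on the earlier bad parts is inherited because the
    next polynomial is at most 1/2 wherever on [Sigma] the previous one is. *)
Lemma peak_sequence : exists (P : nat -> V -> C) (eps : nat -> R),
  [/\ forall n, peak (P n), forall n, 0 < eps n & forall n (j : nat) (x : V), (j < n)%N -> Sigma x ->
      nc (family j x) <= eps j -> nc (P n x) <= 1 / 2].
Proof.
have : forall u : nat * (V -> C), exists Q : (V -> C) * R, peak u.2 ->
   [/\ peak Q.1, 0 < Q.2 & forall x : V, Sigma x ->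
     nc (u.2 x) <= 1 / 2 \/ nc (family u.1 x) <= Q.2 -> nc (Q.1 x) <= 1 / 2].
  (* A dummy value when [P] is not peaking keeps the choice function total. *)
  move=> [n P]; have [hP|hP] := pselect (peak P); last by exists (P, 0).
  have [_ f0] := family_admissible n.
  by have [Q hQ] := peak_step hP (family_poly n) f0; exists Q.
move=> /choice[F hF].
pose P := fix P (n : nat) : V -> C := if n is k.+1 then (F (k, P k)).1 else (fun _ => 1).
have hP n : peak (P n).
  elim: n => [|n IH] /=; last by have [] := hF (n, P n) IH.
  by split=> [|x _]; [exact: poly_cst|rewrite nc1].
exists P, (fun n => (F (n, P n)).2); split=> //.
  by move=> n; have [] := hF (n, P n) (hP n).
elim=> [//|n IH] j x; rewrite ltnS leq_eqVlt => /orP[/eqP->|jn] Sx hx.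
  by have [_ _ h] := hF (n, P n) (hP n); apply: h => //; right.
by have [_ _ h] := hF (n, P n) (hP n); apply: h => //; left; exact: IH jn Sx hx.
Qed.

Definition trimmed (eps : nat -> R) : set (CN R N) :=
  Sigma `&` [set x | forall j, eps j <= nc (family j x)].

Lemma trimmed_compact eps : compact (trimmed eps).
Proof.
apply: compact_closedI => //.
apply: (cont_closed (P := fun x : V => forall j, eps j <= nc (family j x))) => x /existsNP[j /negP].
rewrite -ltNge => hj.
have cp : cont (family j) x by apply: gh_cont; exact: poly_gh (family_poly j).
have e0 : 0 < eps j - nc (family j x) by lra.
apply: nrW (cp _ e0) => y; rewrite distCE => hy /(_ j).
by have := nc_sub (family j y) (family j x); lra.
Qed.

Lemma hull_trimmed k P eps : (forall n, peak (P n)) -> (forall n (j : nat) (x : V), (j < n)%N ->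
    Sigma x -> nc (family j x) <= eps j -> nc (P n x) <= 1 / 2) ->
  K `<=` k_poly_hull k Sigma -> K `<=` rat_hull_k k.-1 (trimmed eps).
Proof.
move=> hP hPe KS z Kz A m mk hA Az; apply: contrapT => H.
have hA1 := analytic_local (let: And3 _ h _ := hA in h).
(* The parameter [e] encodes a bound [e^-1] on the index [j], so smaller [e] is a weaker demand; the
   uniform [e] plays the role of a finite subcover. *)
have [x Sx|e e0 he] := @compact_unif _ _ Sigma
    (fun e y => A y -> exists2 j : nat, j%:R <= e^-1 & nc (family j y) < eps j) cS.
  have [Ax|Ax] := pselect (A x); last first.
    by exists 1 => //; apply: nrW (Vs_closed hA1 Ax) => y Ay e _ _ /Ay.
  have [j hj] : exists j, nc (family j x) < eps j.
    apply: contrapT => H1; apply: H; exists x; split=> //; split=> // j /=.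
    by rewrite leNgt; apply/negP => hj; apply: H1; exists j.
  exists (j.+1%:R)^-1; first by rewrite invr_gt0 ltr0n.
  have cp : cont (family j) x by apply: gh_cont; exact: poly_gh (family_poly j).
  have d0 : 0 < eps j - nc (family j x) by lra.
  apply: nrW (cp _ d0) => y; rewrite distCE => hy e e0 he _; exists j.
    rewrite -[e]invrK lef_pV2 ?posrE ?invr_gt0 ?ltr0n// in he.
    by apply: le_trans he; rewrite ler_nat.
  by have := nc_sub (family j y) (family j x); lra.
have [n hn] : exists n : nat, e^-1 < n%:R.
  by exists (Num.bound e^-1); apply: archi_boundP; rewrite invr_ge0 ltW.
have [_ hz] := KS _ Kz.
have := hz A m mk hA Az (P n) (proj1 (hP n)) (1 / 2).
have small x : (Sigma `&` A) x -> `|P n x| <= (1 / 2)%:C%C.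
  move=> [Sx Ax]; have [j je hj] := he _ Sx Ax.
  rewrite le_norm_nc; apply: (hPe n j) => //; last exact: ltW.
  by rewrite -(ltr_nat R); lra.
by move=> /(_ small); rewrite le_norm_nc; have := proj2 (hP n) _ Kz; lra.
Qed.

End Construction.

(** * Analytic discs outside a rationally convex set *)

Section Discs.
Context {R : realType}.
Local Notation C := R[i].
Variable N : nat.
Local Notation V := 'rV[C]_N.

Lemma disc_cder (sigma : C^o -> CN R N) (w : C^o) j : differentiable sigma w ->
  cder (fun t : C => (sigma t : V) 0 j) w (('d sigma w (1 : C^o) : V) 0 j).
Proof.
move=> dw; have h := diff_cder (1 : C^o) j dw.
have k : cder (fun t : C => t - w) w 1.
  by have := cderD (cder_id w) (cder_cst (- w) w); rewrite addr0.
have := cder_comp (f := fun t : C => t - w)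
  (g := fun t : C => (sigma ((w : C^o) + t *: (1 : C^o)) : V) 0 j) k.
rewrite subrr => /(_ _ h); rewrite mulr1; apply: cder_eq; apply: nr_all => t.
by rewrite /GRing.scale /= mulr1 addrC subrK.
Qed.

Lemma poly_curve (s : C -> V) (p : V -> C) w : @poly_fun R N p ->
  (forall j, cdiff (fun t => s t 0 j) w) -> cdiff (fun t => p (s t)) w.
Proof.
move=> pp hs; elim: pp => [c|i|p1 q1 _ h1 _ h2|p1 q1 _ h1 _ h2].
- exact: cdiff_cst.
- exact: hs.
- exact: cdiffD.
- exact: cdiffM.
Qed.

Lemma disc_lt1 (w : C) : (`|w| < 1) = (nc w < 1).
Proof. by rewrite -lt_norm_nc rmorph1. Qed.

(** If all derivatives vanished on the disc, [sigma] would take the same value at 0 and 1/2, against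
    injectivity. *)
Lemma disc_immersed (sigma : C^o -> CN R N) : analytic_disc sigma ->
  exists (w : C) j d, [/\ nc w < 1, d != 0 & cder (fun t : C => (sigma t : V) 0 j) w d].
Proof.
move=> [ds inj]; apply: contrapT => H.
have h0 (t : R) : 0 <= t <= 1 -> nc (0 + t%:C%C * ((1 / 2)%:C%C - 0)) < 1.
  move=> /andP[t0 t1]; rewrite add0r subr0 ncM !nc_real !ger0_norm ?divr_ge0//.
  lra.
have half : nc ((1 / 2)%:C%C : C) < 1 by rewrite nc_real ger0_norm ?divr_ge0//; lra.
have : sigma 0 = sigma (1 / 2)%:C%C.
  apply/rowP => j; apply/eqP; rewrite eq_sym -subr_eq0 -nc_eq0 eq_le nc_ge0 andbT.
  rewrite -(mul0r (nc ((1 / 2)%:C%C - 0))).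
  apply: (@cder_lip _ (fun t : C => (sigma t : V) 0 j)) => // t ht.
  set u := 0 + _; have hu : nc u < 1 := h0 t ht.
  have du : differentiable sigma (u : C^o) by apply: ds; rewrite disc_lt1.
  exists (('d sigma (u : C^o) (1 : C^o) : V) 0 j); first exact: disc_cder.
  have [->|d0] := eqVneq (('d sigma (u : C^o) (1 : C^o) : V) 0 j) 0; first by rewrite nc0.
  by exfalso; apply: H; exists u, j, (('d sigma (u : C^o) (1 : C^o) : V) 0 j); split=> //; exact: disc_cder.
move=> /inj; rewrite !disc_lt1 => /(_ _ half); rewrite nc0 => /(_ ltr01) /(congr1 (@nc R)).
by rewrite nc0 nc_real ger0_norm ?divr_ge0//; lra.
Qed.

(* adding a small multiple of the j-th coordinate makes p transverse to the curve at w *)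
Lemma transverse_polynomial (K : set (CN R N)) (s : C -> V) (w : C) j d (p : V -> C) : compact K ->
  (forall i, cdiff (fun t => s t 0 i) w) -> cder (fun t => s t 0 j) w d -> d != 0 ->
  @poly_fun R N p -> p (s w) = 0 -> (forall x : V, K x -> p x != 0) ->
  exists p1 a, [/\ @poly_fun R N p1, p1 (s w) = 0, forall x : V, K x -> p1 x != 0,
    a != 0 & cder (fun t => p1 (s t)) w a].
Proof.
move=> cK ds dj d0 pp pz pK.
have [a ha] := poly_curve pp ds.
have [a0|a0] := eqVneq a 0; last by exists p, a; split.
have [|dl dl0 hdl] := compact_min (f := p) cK.
  by move=> x Kx; split; [apply: gh_cont; exact: poly_gh|exact: pK].
have [M M0 hM] := compact_radius cK.
set z := s w in pz *.
have B0 : 0 < M + nV z by have := nV_ge0 z; lra.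
pose c := dl / (2 * (M + nV z)).
have c0 : 0 < c by rewrite divr_gt0// mulr_gt0.
exists (fun x : V => p x + c%:C%C * (x 0 j + - z 0 j)), (c%:C%C * d); split.
- apply: poly_add => //; apply: poly_mul; first exact: poly_cst.
  by apply: (poly_add (p := fun x : CN R N => (x : V) 0 j)); [exact: poly_coord|exact: poly_cst].
- by rewrite pz subrr mulr0 addr0.
- move=> x Kx; rewrite -nc_gt0.
  have h1 := hdl _ Kx; have h2 := hM _ Kx.
  have h3 : nc (c%:C%C * (x 0 j - z 0 j)) <= dl / 2.
    have -> : dl / 2 = c * (M + nV z) by rewrite /c; field; rewrite gt_eqF.
    rewrite ncM nc_real gtr0_norm// ler_wpM2l ?(ltW c0)//.
    have := ncD (x 0 j) (- z 0 j); rewrite ncN; have := nV_coord x j; have := nV_coord z j; lra.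
  have := nc_sub (p x) (- (c%:C%C * (x 0 j - z 0 j))); rewrite opprK ncN; lra.
- by rewrite mulf_neq0// -nc_gt0 nc_real gtr0_norm.
have := cderD ha (cderM (cder_cst c%:C%C w) (cderD dj (cder_cst (- z 0 j) w))).
by rewrite a0 mul0r !add0r addr0.
Qed.

Lemma disc_meets_family (K : set (CN R N)) (sigma : C^o -> CN R N) : (0 < N)%N -> compact K ->
  rationally_convex K -> analytic_disc sigma -> (forall w : C^o, `|w| < 1 -> ~ K (sigma w)) ->
  exists j (w : C), nc w < 1 /\ family K j (sigma w) = 0.
Proof.
move=> N0 cK rK hs nK.
have [w [j [d [w1 d0 hd]]]] := disc_immersed hs.
pose s : C -> V := sigma.
have ds t i : nc t < 1 -> cdiff (fun u => s u 0 i) t.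
  by move=> ht; eexists; apply: disc_cder; apply: (proj1 hs); rewrite disc_lt1.
have nKw : ~ K (s w) by apply: nK; rewrite disc_lt1.
have [p pp [pz pK]] := separating_polynomial N0 cK rK nKw.
have [p1 [a [pp1 pz1 pK1 a0 ha]]] :=
  transverse_polynomial cK (fun i => ds w i w1) hd d0 pp pz pK.
have na : 0 < nc a by rewrite nc_gt0.
have na2 : 0 < nc a / 2 by lra.
have cs : cont s w by apply: cont_row => i; apply: cdiff_cont; exact: ds.
have c1 : nr w (fun t => nc t < 1).
  exists (1 - nc w) => [|t]; first lra.
  by rewrite distCE => ht; have := nc_sub t w; lra.
have c2 := cs 1 ltr01; have c3 := cder_eps ha na2.
have [r r0 hr] := nr_sq (nrI c1 (nrI c2 c3)).
have [M M0 hM] := compact_radius cK.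
have [|dl dl0 hdl] := compact_min (f := p1) cK.
  by move=> x Kx; split; [apply: gh_cont; exact: poly_gh|exact: pK1].
(* Lower bound of $|p_1|$ along the disc on the contour: there $|t-w| \ge r$, and the first-order
   error takes away at most half of the linear term. *)
pose m := nc a * r / 2; have m0 : 0 < m by rewrite divr_gt0// mulr_gt0.
pose e := Num.min dl m / 3.
have e0 : 0 < e by rewrite divr_gt0// lt_min dl0.
(* An approximation within [e] then has modulus at least [2 * e] on the contour and on [K], but at
   most [e] at the centre; so it is admissible and has a zero inside. *)
have [e1 e2] : 3 * e <= dl /\ 3 * e <= m.
  rewrite /e mulrC divfK ?pnatr_eq0//; split; by rewrite ge_min lexx ?orbT.
(* Radius of a polydisc that contains both [K] and the image of the square. *)
pose B := M + nV (s w) + 1.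
have [q qq hq] := program_dense B pp1 e0.
have Bs t : sq w r t -> nV (s t) <= B.
  move=> /hr[_ []]; rewrite distVE => h _.
  by have := nVD (s t - s w) (s w); rewrite subrK /B; lra.
have BK x : K x -> nV x <= B by move=> /hM; rewrite /B; have := nV_ge0 (s w); lra.
have qb t : sqb w r t -> 2 * e <= nc (q (s t)).
  move=> hb; have ht := sqb_sq (ltW r0) hb; have [_ [_]] := hr _ ht.
  rewrite pz1 subr0 => h1; have h2 := sqb_ge hb; have h3 := hq _ (Bs _ ht).
  have h4 := nc_sub (a * (t - w)) (a * (t - w) - p1 (s t)).
  rewrite subKr (ncB (a * _)) ncM in h4.
  have h5 : nc a / 2 * r <= nc a / 2 * nc (t - w) by rewrite ler_wpM2l// ltW.
  have h6 : m = nc a / 2 * r by rewrite /m; ring.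
  have h7 := nc_sub (p1 (s t)) (p1 (s t) - q (s t)).
  by rewrite subKr in h7; lra.
have [j1 hj1] : exists j1, family K j1 = q.
  apply: family_enum => //; split.
    exists (s (w + r%:C%C)); rewrite -nc_gt0.
    have : sqb w r (w + r%:C%C).
      left; rewrite reD imD /= addr0; split; first by right.
      by apply/andP; split; lra.
    by move=> /qb; lra.
  move=> x Kx; rewrite -nc_gt0; have h1 := hdl _ Kx; have h2 := hq _ (BK _ Kx).
  have h3 := nc_sub (p1 x) (p1 x - q x).
  by rewrite subKr in h3; lra.
have pq : @poly_fun R N q by rewrite -hj1; exact: family_poly.
have [|||t ht qt] := @zero_exists _ (fun t => q (s t)) _ _ _ _ w (2 * e) (sqo0 w r0).
- by move=> t /hr[t1 _]; apply: poly_curve => // i; exact: ds.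
- by move=> t /qb.
- have wr : sq w r w by apply: sqo_sq; exact: sqo0.
  by have := hq _ (Bs _ wr); rewrite pz1 sub0r ncN; lra.
by exists j1, t; rewrite hj1; split=> //; have [] := hr _ ht.
Qed.

End Discs.

Theorem theorem5p5 (R : realType) (N : nat) (Sigma : set (CN R N)) (k : nat) :
  (2 <= N)%N -> compact Sigma -> (2 <= k)%N -> (k <= N)%N ->
  forall K : set (CN R N), compact K -> rationally_convex K ->
  K `<=` k_poly_hull k Sigma ->
  exists X : set (CN R N),
    [/\ X `<=` Sigma, compact X, K `<=` rat_hull_k k.-1 X &
        no_analytic_disc (rat_hull X `\` K)].
Proof.
move=> N2 cS _ _ K cK rK KS; have N0 : (0 < N)%N := ltnW N2.
have [P [eps [hP eps0 hPe]]] := peak_sequence cK cS.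
exists (trimmed K Sigma eps); split.
- by move=> x [].
- exact: trimmed_compact.
- exact: hull_trimmed hPe KS.
move=> [sigma [hs himg]].
have [|j [w [w1 fw]]] := disc_meets_family N0 cK rK hs; first by move=> w /himg[].
have w1' : `|w : R[i]^o| < 1 by rewrite disc_lt1.
have [hull _] := himg _ w1'.
have [[y fy] _] := family_admissible K j.
(* The hull point [sigma w] lies on the zero set of [family K j], which must then meet the trimmed
   set, where this polynomial has modulus at least [eps j]. *)
have [x [fx [_ /(_ j)]]] := hull _ 1%N (leqnn 1) (poly_subvariety N0 (family_poly K j) fy) fw.
by have := eps0 j; rewrite fx nc0; lra.
Qed.
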